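(* Let $F$ be Thompson's group and, for $(p,q)\in\mathbb{Z}^2\smallsetminus\{(0,0)\}$, let $N_{p,q}=\ker(p\chi_0-q\chi_1)\triangleleft F$. Then: (1) if $p\cdot q=0$, then $N_{p,q}$ is infinitely generated; (2) if $p\cdot q>0$, then $N_{p,q}$ is finitely presentable and isolated; (3) if $p\cdot q<0$, then $N_{p,q}$ is a finitely generated extrinsic condensation group (and thus infinitely presented).
   Context: Thompson's group $F$ is the group of all increasing piecewise linear homeomorphisms of the unit interval $[0,1]$ whose points of non-differentiability are (finitely many) dyadic rational numbers and whose slopes are integer powers of $2$. The homomorphism $\chi_0\colon F\to\mathbb{R}$ (resp. $\chi_1\colon F\to\mathbb{R}$) sends $f$ to the binary logarithm of its slope at $0$ (resp. at $1$). For $m\ge 1$ let $F_m$ be the free group of rank $m$. The space $\mathcal{G}_m$ of marked groups is identified with the set of normal subgroups $S$ of $F_m$ ($S$ representing the marked group $F_m/S$), with the topology having as basis the sets $\mathcal{O}_{\mathcal{F},\mathcal{F}'}=\{S\triangleleft F_m\mid \mathcal{F}\subseteq S,\ S\cap\mathcal{F}'=\emptyset\}$, where $\mathcal{F},\mathcal{F}'$ range over finite subsets of $F_m$. A finitely generated group $G$ is isolated if for some (equivalently any) $m$ and epimorphism $F_m\to G$ the kernel is an isolated point of $\mathcal{G}_m$. A finitely generated group $G$ is an extrinsic condensation group if for every finitely presentable group $H$ and every epimorphism $H\to G$ with kernel $N$, there exist uncountably many normal subgroups of $H$ contained in $N$. A group is infinitely presented if it is finitely generated but does not admit a finite presentation;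 infinitely generated means not finitely generated. *)

(* Defs.v *)
From HB Require Import structures.
From mathcomp Require Import all_boot all_order all_algebra finmap ring lra.
From mathcomp Require Import all_classical all_reals all_analysis.

Set Implicit Arguments.
Unset Strict Implicit.
Unset Printing Implicit Defensive.

Import Order.TTheory GRing.Theory Num.Theory.
Import numFieldNormedType.Exports.

Local Open Scope classical_set_scope.

Section Subgroups.
Local Open Scope group_scope.
Variable G : groupType.

Definition subgroup (S : set G) : Prop :=
  S 1 /\ forall x y, S x -> S y -> S (x / y).

Definition normal_subgroup (S : set G) : Prop :=
  subgroup S /\ forall x y, S x -> S (x ^ y).

Definition generated (A : set G) : set G :=
  \bigcap_(S in [set S : set G | subgroup S /\ A `<=` S]) S.

Definition normal_closure (A : set G) : set G :=
  \bigcap_(S in [set S : set G | normal_subgroup S /\ A `<=` S]) S.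

Definition finitely_generated : Prop :=
  exists A : set G, finite_set A /\ generated A = setT.

Definition infinitely_generated : Prop := ~ finitely_generated.

End Subgroups.

Section Kernel.
Local Open Scope group_scope.
Variables (G H : groupType) (f : {multiplicative G -> H}).

Definition hom_kernel : set G := [set x | f x = 1].

Definition epimorphism : Prop := forall y : H, exists x : G, f x = y.

Lemma kernel_normal : normal_subgroup hom_kernel.
Proof.
have f1 : f 1 = 1.
  by apply: (mulgI (f 1)); rewrite -gmulfM !mulg1.
have fV x : f x^-1 = (f x)^-1.
  by apply: (mulgI (f x)); rewrite -gmulfM !mulgV.
rewrite /hom_kernel; split; first split => //= x y fx fy.
  by rewrite gmulfM fV fx fy mulgV.
by move=> x y /= fx; rewrite conjgE !gmulfM fV fx mul1g mulVg.
Qed.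

End Kernel.

(* The letter [(i, false)] stands for the [i]-th free generator and [(i, true)]
   for its inverse; an element of the free group is a reduced word. *)
Section FreeGroup.
Variable m : nat.
Local Notation letter := ('I_m * bool)%type.
Implicit Types (a b : letter) (u v w : seq letter).

Definition letter_inv a : letter := (a.1, ~~ a.2).

Definition reduced w : bool := sorted (fun a b => b != letter_inv a) w.

Definition push a w : seq letter :=
  if w is b :: w' then if b == letter_inv a then w' else a :: w else [:: a].

Definition word_mul u v : seq letter := foldr push v u.

Definition word_inv w : seq letter := rev (map letter_inv w).

Lemma letter_invK : involutive letter_inv.
Proof. by case=> i b; rewrite /letter_inv /= negbK. Qed.

Lemma reduced_push a w : reduced w -> reduced (push a w).
Proof.
case: w => [//|b w] /= rw; case: ifPn => [_|ba]; first exact: path_sorted rw.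
by rewrite /reduced /= ba.
Qed.

Lemma reduced_mul u v : reduced v -> reduced (word_mul u v).
Proof. by move=> rv; elim: u => //= a u /reduced_push. Qed.

Lemma reduced_inv w : reduced w -> reduced (word_inv w).
Proof.
rewrite /reduced /word_inv rev_sorted sorted_map; apply: sub_sorted => a b /=.
by rewrite letter_invK eq_sym.
Qed.

Lemma push_invK a w : reduced w -> push a (push (letter_inv a) w) = w.
Proof.
case: w => [_|b w]; rewrite /= ?eqxx // letter_invK; case: eqP => [->|_ _].
  by case: w => [//|c w] /= /andP[/negbTE ->].
by rewrite /= eqxx.
Qed.

Lemma word_mul_push a v w :
  reduced w -> word_mul (push a v) w = push a (word_mul v w).
Proof.
move=> rw; case: v => [//|b v] /=; case: eqP => [->|//].
by rewrite push_invK // reduced_mul.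
Qed.

Lemma word_mulA u v w :
  reduced w -> word_mul u (word_mul v w) = word_mul (word_mul u v) w.
Proof.
by move=> rw; elim: u => //= a u ->; rewrite word_mul_push.
Qed.

Lemma word_mul1 w : reduced w -> word_mul w [::] = w.
Proof.
elim: w => //= a w IH rw; rewrite IH; last exact: path_sorted rw.
by case: w rw {IH} => //= b w /andP[/negbTE->].
Qed.

Lemma word_mulV w : reduced w -> word_mul (word_inv w) w = [::].
Proof.
elim: w => //= a w IH rw.
rewrite /word_inv map_cons rev_cons /word_mul foldr_rcons /= letter_invK eqxx.
exact: (IH (path_sorted rw)).
Qed.

Lemma word_invK : involutive word_inv.
Proof.
move=> w; rewrite /word_inv map_rev revK -map_comp -[RHS]map_id.
by apply: eq_map => a /=; rewrite letter_invK.
Qed.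

Definition free_group := {w : seq letter | reduced w}.

HB.instance Definition _ := Choice.on free_group.

Definition free_one : free_group := exist _ [::] isT.
Definition free_mul (x y : free_group) : free_group :=
  exist _ (word_mul (val x) (val y)) (reduced_mul _ (valP y)).
Definition free_inv (x : free_group) : free_group :=
  exist _ (word_inv (val x)) (reduced_inv (valP x)).

Fact free_mulA : associative free_mul.
Proof. by move=> x y z; apply: val_inj; rewrite /= word_mulA // (valP z). Qed.

Fact free_mul1g : left_id free_one free_mul.
Proof. by move=> x; apply: val_inj. Qed.

Fact free_mulg1 : right_id free_one free_mul.
Proof. by move=> x; apply: val_inj; rewrite /= word_mul1 // (valP x). Qed.

Fact free_mulVg : left_inverse free_one free_inv free_mul.
Proof. by move=> x; apply: val_inj; rewrite /= word_mulV // (valP x). Qed.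

Fact free_mulgV : right_inverse free_one free_inv free_mul.
Proof.
move=> x; apply: val_inj; rewrite /= -{1}[val x]word_invK word_mulV //.
exact: reduced_inv (valP x).
Qed.

HB.instance Definition _ := isGroup.Build free_group
  free_mulA free_mul1g free_mulg1 free_mulVg free_mulgV.

End FreeGroup.

Section MarkedGroups.
Variable m : nat.

Definition marked_group :=
  {S : set (free_group m) | `[< normal_subgroup S >]}.

HB.instance Definition _ := Choice.on marked_group.

Definition mg_basic (E : {fset free_group m} * {fset free_group m}) :
    set marked_group :=
  [set S | [set` E.1] `<=` val S /\ val S `&` [set` E.2] = set0].

Fact mg_basic_cover : \bigcup_(E in setT) mg_basic E = setT.
Proof.
rewrite -subTset => S _; exists (fset0, fset0) => //; split => //=.
by rewrite -subset0 => x [].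
Qed.

Fact mg_basic_join E E' S : setT E -> setT E' -> mg_basic E S ->
  mg_basic E' S ->
  exists E'', [/\ setT E'', mg_basic E'' S &
    mg_basic E'' `<=` mg_basic E `&` mg_basic E'].
Proof.
move=> _ _ [E1 E2] [E1' E2']; exists (E.1 `|` E'.1, E.2 `|` E'.2)%fset.
split => //; first split => /=.
- by move=> x /=; rewrite in_fsetU => /orP[/E1|/E1'].
- rewrite -subset0 => x [Sx] /=; rewrite in_fsetU => /orP[xE|xE].
    by rewrite -[False]/(set0 x) -E2.
  by rewrite -[False]/(set0 x) -E2'.
- move=> T [T1 T2].
  have no x : val T x -> x \in (E.2 `|` E'.2)%fset -> False.
    by move=> Tx xE; rewrite -[False]/(set0 x) -T2.
  split; split.
  + by move=> x /= xE; apply: T1; rewrite /= in_fsetU xE.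
  + by rewrite -subset0 => x [/no + /= xE]; apply; rewrite in_fsetU xE.
  + by move=> x /= xE; apply: T1; rewrite /= in_fsetU xE orbT.
  + by rewrite -subset0 => x [/no + /= xE]; apply; rewrite in_fsetU xE orbT.
Qed.

HB.instance Definition _ :=
  isBaseTopological.Build marked_group mg_basic_cover mg_basic_join.

End MarkedGroups.

Definition marking (G : groupType) (m : nat)
    (phi : {multiplicative free_group m -> G}) : marked_group m :=
  exist _ (hom_kernel phi) (asboolT (kernel_normal phi)).

Section GroupProperties.
Variable G : groupType.

Definition finitely_presentable : Prop :=
  exists (m : nat) (phi : {multiplicative free_group m -> G})
         (A : set (free_group m)),
    [/\ epimorphism phi, finite_set A & hom_kernel phi = normal_closure A].

Definition infinitely_presented : Prop :=
  finitely_generated G /\ ~ finitely_presentable.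

Definition isolated_group : Prop :=
  exists (m : nat) (phi : {multiplicative free_group m -> G}),
    [/\ (0 < m)%N, epimorphism phi &
        isolated [set: marked_group m] (marking phi)].

End GroupProperties.

Definition extrinsic_condensation (G : groupType) : Prop :=
  finitely_generated G /\
  forall (H : groupType) (phi : {multiplicative H -> G}),
    finitely_presentable H -> epimorphism phi ->
    ~ countable [set K : set H | normal_subgroup K /\ K `<=` hom_kernel phi].

Local Open Scope ring_scope.

Section Thompson.
Variable R : realType.
Implicit Types (f g : R -> R) (s : seq R).

Definition dyadic (x : R) : Prop :=
  exists (a : int) (n : nat), x = a%:~R / 2 ^+ n.

Definition homeomorphism f : Prop :=
  exists g, [/\ cancel f g, cancel g f, continuous f & continuous g].

Definition piecewise_linear f : Prop :=
  exists s, forall a b, 0 <= a -> a < b -> b <= 1 ->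
    (forall x, x \in s -> x \notin `]a, b[) ->
    exists m c, {in `[a, b], forall x, f x = m * x + c}.

(* A homeomorphism of the unit interval fixing 0 and 1 is represented by its
   extension to the line by the identity, which is a homeomorphism of the
   line. Differentiability is only tested in the open interval: the end points
   are dyadic, and the one-sided slopes there are slopes of nearby points. *)
Definition thompson f : Prop :=
  [/\ homeomorphism f,
      {homo f : x y / x < y},
      forall x, x \notin `]0, 1[ -> f x = x,
      piecewise_linear f &
      {in `]0, 1[, forall x, (~ derivable f x 1 -> dyadic x) /\
         (derivable f x 1 -> exists k : int, derive1 f x = 2 ^ k)}].

Definition dyadic_pieces f s : Prop :=
  {in s, forall x, dyadic x} /\
  forall a b, 0 <= a -> a < b -> b <= 1 ->
    (forall x, x \in s -> x \notin `]a, b[) ->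
    exists (k : int) c, {in `[a, b], forall x, f x = 2 ^ k * x + c}.


Lemma separation s (x : R) :
  exists2 e, 0 < e & forall y, y \in s -> y != x -> e <= `|y - x|.
Proof.
elim: s => [|z s [e e0 IH]]; first by exists 1.
have [->|zx] := eqVneq z x.
  exists e => // y; rewrite inE => /orP[/eqP-> /eqP//|]; exact: IH.
exists (Num.min e `|z - x|).
  by rewrite lt_min e0 normr_gt0 subr_eq0.
move=> y; rewrite inE ge_min => /orP[/eqP->|/IH h /h ->//].
by rewrite lexx orbT.
Qed.

Lemma near_cst_cvg (F : set_system R) (FF : ProperFilter F) (g : R -> R) (m : R) :
  (\forall h \near F, g h = m) -> g @ F --> m.
Proof. exact: cvg_near_cst. Qed.

Lemma quotE f (x h : R) :
  h^-1 *: ((f \o shift x) (h *: 1) - f x) = (f (x + h) - f x) / h.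
Proof. by rewrite /= /GRing.scale /= mulr1 [h + x]addrC mulrC. Qed.

Lemma derivable_affine f x m e : 0 < e ->
  (forall h, `|h| <= e -> f (x + h) = f x + m * h) ->
  is_derive x 1 f m.
Proof.
move=> e0 H.
have C : (fun h => h^-1 *: ((f \o shift x) (h *: 1) - f x)) @ 0^' --> m.
  apply: near_cst_cvg; near=> h.
  have h0 : h != 0 by near: h; exact: nbhs_dnbhs_neq.
  transitivity ((f (x + h) - f x) / h); first exact: quotE.
  rewrite H; last first.
    near: h; exact: dnbhs0_le.
  by rewrite addrAC subrr add0r mulfK //.
split; first by apply/cvg_ex; exists m.
exact: (cvg_lim _ C).
Unshelve. all: by end_near. Qed.

Lemma derive_right_affine f x m e : 0 < e ->
  (forall h, 0 <= h -> h <= e -> f (x + h) = f x + m * h) ->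
  derivable f x 1 -> derive1 f x = m.
Proof.
move=> e0 H /cvg_ex[/= l C].
have Cr := cvg_dnbhs_at_right C.
have D : 'D_1 f x = l by exact: (cvg_lim _ C).
rewrite derive1E D; apply: (cvg_unique _ Cr) => //.
apply: near_cst_cvg; near=> h.
have h0 : 0 < h by near: h; exact: nbhs_right_gt.
transitivity ((f (x + h) - f x) / h); first exact: quotE.
have he : h <= e by near: h; exact: nbhs_right_le.
rewrite (H _ (ltW h0) he).
by rewrite addrAC subrr add0r mulfK ?gt_eqF //.
Unshelve. all: by end_near. Qed.

Lemma derive_left_affine f x m e : 0 < e ->
  (forall h, 0 <= h -> h <= e -> f (x - h) = f x - m * h) ->
  derivable f x 1 -> derive1 f x = m.
Proof.
move=> e0 H /cvg_ex[/= l C].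
have Cr := cvg_dnbhs_at_left C.
have D : 'D_1 f x = l by exact: (cvg_lim _ C).
rewrite derive1E D; apply: (cvg_unique _ Cr) => //.
apply: near_cst_cvg; near=> h.
have h0 : h < 0 by near: h; exact: nbhs_left_lt.
transitivity ((f (x - (- h)) - f x) / h); first by rewrite opprK; exact: quotE.
have he : - h <= e.
  by rewrite lerNl; near: h; apply: nbhs_left_ge; rewrite oppr_lt0.
have h0' : 0 <= - h by rewrite oppr_ge0 ltW.
rewrite (H _ h0' he).
rewrite mulrN opprK addrAC subrr add0r mulfK ?lt_eqF //.
Unshelve. all: by end_near. Qed.

Lemma count_itv s0 (a b c d z : R) : z \in s0 -> z \in `]a, b[ ->
  a <= c -> d <= b -> z \notin `]c, d[ ->
  (count (fun x => x \in `]c, d[) s0 < count (fun x => x \in `]a, b[) s0)%N.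
Proof.
move=> zs0 zab ac db zcd.
have sub x : x \in `]c, d[ -> x \in `]a, b[.
  rewrite !in_itv /= => /andP[? ?]; apply/andP.
  by split; [exact: le_lt_trans ac _ | exact: lt_le_trans db].
elim: s0 zs0 => // y s0 IH; rewrite inE /= => /orP[/eqP<-|/IH {}IH].
  by rewrite (negbTE zcd) zab /= ltnS; exact: sub_count.
case: (boolP (y \in `]c, d[)) => [/sub -> //|_].
by rewrite add0n (leq_trans IH) // leq_addl.
Qed.

Lemma affine_count f s0 s a b : 
  (forall a b, 0 <= a -> a < b -> b <= 1 ->
    (forall x, x \in s0 -> x \notin `]a, b[) ->
    exists m c, {in `[a, b], forall x, f x = m * x + c}) ->
  {in s0, forall x, x \in `]0, 1[ -> x \in s \/ derivable f x 1} ->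
  0 <= a -> a < b -> b <= 1 ->
  (forall x, x \in s -> x \notin `]a, b[) ->
  exists m c, {in `[a, b], forall x, f x = m * x + c}.
Proof.
move=> PL ds; have [n] := ubnP (count (fun x => x \in `]a, b[) s0).
elim: n a b => // n IH a b cn a0 ab b1 abs.
have [/hasP[z zs0 zab]|/hasPn H] := boolP (has (fun x => x \in `]a, b[) s0); last exact: PL.
have /andP[az zb] : a < z < b by move: zab; rewrite /= in_itv.
have z01 : z \in `]0, 1[ by rewrite in_itv /= (le_lt_trans a0 az) (lt_le_trans zb b1).
have [/abs /negP//|dz] := ds _ zs0 z01.
have cnt c d : a <= c -> d <= b -> z \notin `]c, d[ ->
    (count (fun x => x \in `]c, d[) s0 < n)%N.
  by move=> ac db zcd; exact: leq_trans (count_itv zs0 zab ac db zcd) cn.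
have avoid c d : a <= c -> d <= b -> forall x, x \in s -> x \notin `]c, d[.
  move=> ac db x /abs; apply: contra; rewrite !in_itv /= => /andP[? ?].
  by apply/andP; split; [exact: le_lt_trans ac _ | exact: lt_le_trans db].
have [|||||m1 [c1 E1]] := IH a z; rewrite ?lexx ?(ltW zb) //.
- by apply: cnt; rewrite ?lexx ?(ltW zb) // in_itv /= ltxx andbF.
- exact: le_trans (ltW zb) b1.
- by apply: avoid; rewrite ?lexx ?(ltW zb).
have [|||||m2 [c2 E2]] := IH z b; rewrite ?lexx ?(ltW az) //.
- by apply: cnt; rewrite ?lexx ?(ltW az) // in_itv /= ltxx.
- exact: le_trans a0 (ltW az).
- by apply: avoid; rewrite ?lexx ?(ltW az).
have fz1 : f z = m1 * z + c1 by apply: E1; rewrite in_itv /= lexx ltW.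
have fz2 : f z = m2 * z + c2 by apply: E2; rewrite in_itv /= lexx ltW.
have d1 : derive1 f z = m1.
  apply: (@derive_left_affine _ _ _ (z - a)); rewrite ?subr_gt0 // => h h0 ha.
  rewrite E1 ?in_itv /= ?fz1; first by ring.
  by apply/andP; split; lra.
have d2 : derive1 f z = m2.
  apply: (@derive_right_affine _ _ _ (b - z)); rewrite ?subr_gt0 // => h h0 ha.
  rewrite E2 ?in_itv /= ?fz2; first by ring.
  by apply/andP; split; lra.
have mm : m1 = m2 by rewrite -d1.
have cc : c1 = c2 by apply: (addrI (m1 * z)); rewrite -fz1 fz2 mm.
exists m1, c1 => x; rewrite in_itv /= => /andP[ax xb].
have [xz|/ltW zx] := leP x z; first by apply: E1; rewrite in_itv /= ax.
by rewrite mm cc; apply: E2; rewrite in_itv /= zx.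
Qed.

Lemma thompson_pieces f : thompson f -> exists s, dyadic_pieces f s.
Proof.
move=> [_ _ _ [s0 PL] D]; exists [seq x <- s0 | `[< dyadic x >]]; split.
  by move=> x; rewrite mem_filter => /andP[/asboolP].
move=> a b a0 ab b1 abs.
have [||||//|m [c E]] := affine_count (a := a) (b := b) PL (s := [seq x <- s0 | `[< dyadic x >]]) => //.
  move=> x xs0 x01; rewrite mem_filter xs0 andbT.
  have [N _] := D _ x01.
  have [dx|ndx] := pselect (derivable f x 1); [by right|left].
  exact/asboolP/N.
pose x := (a + b) / 2.
have x01 : x \in `]0, 1[ by rewrite in_itv /= /x; apply/andP; split; lra.
have dx : is_derive x 1 f m.
  apply: (@derivable_affine _ _ _ ((b - a) / 2)); first by lra.
  move=> h; rewrite ler_norml /x => /andP[h1 h2].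
  by rewrite !E ?in_itv /=; [ring|apply/andP; split; lra..].
have [_ /(_ _)[|k]] := D _ x01; first exact: ex_derive.
by rewrite derive1E derive_val => mk; exists k, c; rewrite -mk.
Qed.

Lemma pieces_thompson f s : dyadic_pieces f s -> piecewise_linear f /\
  {in `]0, 1[, forall x, (~ derivable f x 1 -> dyadic x) /\
         (derivable f x 1 -> exists k : int, derive1 f x = 2 ^ k)}.
Proof.
move=> [ds PL]; split.
  exists s => a b a0 ab b1 abs; have [k [c E]] := PL _ _ a0 ab b1 abs.
  by exists (2 ^ k), c.
move=> x; rewrite in_itv /= => /andP[x0 x1].
have [e0 e00 sep0] := separation s x.
pose e := Num.min e0 (Num.min x (1 - x)).
have e_gt0 : 0 < e by rewrite !lt_min e00 x0 subr_gt0.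
have ee0 : e <= e0 by rewrite ge_min lexx.
have ex : e <= x by rewrite !ge_min lexx orbT.
have e1x : e <= 1 - x by rewrite !ge_min lexx !orbT.
split => [nd|d].
  apply: contrapT => ndx; apply: nd.
  have [|||y ys|k [c E]] := PL (x - e) (x + e); [lra..| |].
    have yx : y != x by apply/eqP => yx; apply: ndx; rewrite -yx; exact: ds.
    rewrite in_itv /= -[_ && _]/(_ && _) -ltr_distl -leNgt.
    exact: le_trans (sep0 _ ys yx).
  suff : is_derive x 1 f (2 ^ k) by move=> ?; exact: ex_derive.
  apply: (@derivable_affine _ _ _ e) => // h; rewrite ler_norml => /andP[h1 h2].
  by rewrite !E ?in_itv /=; [ring|apply/andP; split; lra..].
have [|||y ys|k [c E]] := PL x (x + e); [lra..| |].
  rewrite in_itv /=; apply/negP => /andP[xy yxe].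
  have := sep0 _ ys; rewrite gt_eqF // => /(_ isT).
  by rewrite gtr0_norm ?subr_gt0 // leNgt => /negP; apply; lra.
exists k; apply: (@derive_right_affine _ _ _ e) => // h h0 he.
by rewrite !E ?in_itv /=; [ring|apply/andP; split; lra..].
Qed.

Lemma dyadic0 : dyadic 0.
Proof. by exists 0, 0%N; rewrite mul0r. Qed.

Lemma dyadicN x : dyadic x -> dyadic (- x).
Proof. by move=> [a [n ->]]; exists (- a), n; rewrite intrN mulNr. Qed.

Lemma dyadicD x y : dyadic x -> dyadic y -> dyadic (x + y).
Proof.
move=> [a [n ->]] [b [l ->]].
exists (a * 2 ^+ l + b * 2 ^+ n), (n + l)%N.
rewrite intrD !intrM !rmorphXn /= exprD.
have n0 : (2 ^+ n : R) != 0 by rewrite expf_neq0 // pnatr_eq0.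
have l0 : (2 ^+ l : R) != 0 by rewrite expf_neq0 // pnatr_eq0.
by field; rewrite n0 l0.
Qed.

Lemma dyadicM (k : int) x : dyadic x -> dyadic (2 ^ k * x).
Proof.
move=> [a [n ->]]; case: k => k.
  by exists (2 ^+ k * a), n; rewrite intrM rmorphXn /= mulrA -exprnP.
exists a, (k.+1 + n)%N; rewrite NegzE -exprnN exprD invfM.
by rewrite mulrCA mulrA.
Qed.

Lemma pieces_dyadic_diff f s a b : dyadic_pieces f s -> dyadic a -> dyadic b ->
  0 <= a -> a < b -> b <= 1 -> dyadic (f b - f a).
Proof.
move=> [ds PL]; have [n] := ubnP (count (fun x => x \in `]a, b[) s).
elim: n a b => // n IH a b cn da db a0 ab b1.
have [/hasP[z zs zab]|/hasPn H] := boolP (has (fun x => x \in `]a, b[) s).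
  have /andP[az zb] : a < z < b by move: zab; rewrite /= in_itv.
  have -> : f b - f a = (f b - f z) + (f z - f a) by ring.
  have dz := ds _ zs.
  apply: dyadicD; apply: IH => //; rewrite ?(le_trans a0) ?(le_trans _ b1) ?ltW //.
    apply: leq_trans (count_itv zs zab _ _ _) cn; rewrite ?lexx ?ltW //.
    by rewrite in_itv /= ltxx.
  apply: leq_trans (count_itv zs zab _ _ _) cn; rewrite ?lexx ?ltW //.
  by rewrite in_itv /= ltxx andbF.
have [k [c E]] := PL _ _ a0 ab b1 H.
rewrite !E ?in_itv /= ?lexx ?ltW //.
have -> : 2 ^ k * b + c - (2 ^ k * a + c) = 2 ^ k * (b + - a) by ring.
by apply/dyadicM/dyadicD => //; apply: dyadicN.
Qed.

Lemma pieces_dyadic f s x : dyadic_pieces f s ->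
  (forall x, x \notin `]0, 1[ -> f x = x) -> dyadic x -> dyadic (f x).
Proof.
move=> P fix_ dx; have [x01|/fix_-> //] := boolP (x \in `]0, 1[).
have := x01; rewrite in_itv /= => /andP[x0 x1].
have f0 : f 0 = 0 by apply: fix_; rewrite in_itv /= ltxx.
have := pieces_dyadic_diff P dyadic0 dx (lexx _) x0 (ltW x1).
by rewrite f0 subr0.
Qed.

Lemma incr_inv f g : {homo f : x y / x < y} -> cancel g f ->
  {homo g : x y / x < y}.
Proof.
move=> fi gf x y xy; rewrite ltNge le_eqVlt; apply/negP => /orP[/eqP|/fi].
  by move/(congr1 f); rewrite !gf => yx; rewrite yx ltxx in xy.
by rewrite !gf ltNge ltW.
Qed.

Lemma incr_le f : {homo f : x y / x < y} -> {homo f : x y / x <= y}.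
Proof. by move=> fi x y; rewrite le_eqVlt => /orP[/eqP->//|/fi/ltW]. Qed.

Lemma pieces_inv f g s : {homo f : x y / x < y} ->
  (forall x, x \notin `]0, 1[ -> f x = x) ->
  cancel f g -> cancel g f -> dyadic_pieces f s ->
  dyadic_pieces g [seq f x | x <- s].
Proof.
move=> fi fix_ fg gf P; have [ds PL] := P; split.
  by move=> _ /mapP[x xs ->]; exact: pieces_dyadic P fix_ (ds _ xs).
have gi := incr_inv fi gf.
have gfix x : x \notin `]0, 1[ -> g x = x by move=> /fix_ {1}<-.
have g0 : g 0 = 0 by apply: gfix; rewrite in_itv /= ltxx.
have g1 : g 1 = 1 by apply: gfix; rewrite in_itv /= ltxx andbF.
move=> a b a0 ab b1 abs.
have [||||k [c E]] := PL (g a) (g b).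
- by rewrite -g0; exact: incr_le gi _ _ a0.
- exact: gi.
- by rewrite -g1; exact: incr_le gi _ _ b1.
- move=> x xs; have := abs _ (map_f f xs); apply: contra.
  rewrite !in_itv /= => /andP[/fi + /fi +]; rewrite !gf => -> //.
exists (- k), (- (2 ^ (- k) * c)) => y; rewrite in_itv /= => /andP[ay yb].
have Ey : y = 2 ^ k * g y + c.
  by rewrite -E ?gf // in_itv /= !(incr_le gi).
rewrite {2}Ey mulrDr mulrA -expfzDr ?pnatr_eq0 // addNr expr0z mul1r.
by rewrite addrK.
Qed.

Lemma pieces_comp f g sf sg finv : {homo f : x y / x < y} ->
  (forall x, x \notin `]0, 1[ -> f x = x) ->
  cancel f finv -> cancel finv f -> dyadic_pieces f sf ->
  dyadic_pieces g sg ->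
  dyadic_pieces (g \o f) (sf ++ [seq finv x | x <- sg]).
Proof.
move=> fi fix_ fK Kf Pf Pg; have [df PLf] := Pf; have [dg PLg] := Pg.
have gi := incr_inv fi Kf.
have gfix x : x \notin `]0, 1[ -> finv x = x by move=> /fix_ {1}<-.
split.
  move=> x; rewrite mem_cat => /orP[/df //|/mapP[y ys ->]].
  exact: (pieces_dyadic (pieces_inv fi fix_ fK Kf Pf) gfix (dg _ ys)).
have f0 : f 0 = 0 by apply: fix_; rewrite in_itv /= ltxx.
have f1 : f 1 = 1 by apply: fix_; rewrite in_itv /= ltxx andbF.
move=> a b a0 ab b1 abs.
have [|k [c E]] := PLf a b a0 ab b1.
  by move=> x xs; apply: abs; rewrite mem_cat xs.
have [||||l [d E']] := PLg (f a) (f b).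
- by rewrite -f0; exact: incr_le fi _ _ a0.
- exact: fi.
- by rewrite -f1; exact: incr_le fi _ _ b1.
- move=> x xs; have : finv x \notin `]a, b[ by apply: abs; rewrite mem_cat map_f ?orbT.
  apply: contra; rewrite !in_itv /= => /andP[/gi + /gi +].
  by rewrite !fK => -> ->.
exists (l + k), (2 ^ l * c + d) => x xab /=.
have := xab; rewrite in_itv /= => /andP[ax xb].
rewrite E' ?in_itv /= ?(incr_le fi) // E // expfzDr ?pnatr_eq0 //.
by ring.
Qed.

Lemma thompson_id : thompson id.
Proof.
have [|PL D] := @pieces_thompson id [::].
  split=> // a b _ _ _ _; exists 0, 0 => x _.
  by rewrite expr0z mul1r addr0.
split => //; exists id; split => // x; exact: cvg_id.
Qed.

Lemma thompson_comp g f : thompson g -> thompson f -> thompson (g \o f).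
Proof.
move=> Tg Tf.
have [sg Pg] := thompson_pieces Tg; have [sf Pf] := thompson_pieces Tf.
have [[g' [gK Kg gc g'c]] gi gfix _ _] := Tg.
have [[f' [fK Kf fc f'c]] fi ffix _ _] := Tf.
have [PL D] := pieces_thompson (pieces_comp fi ffix fK Kf Pf Pg).
split => //.
- exists (f' \o g'); split.
  + by move=> x /=; rewrite gK fK.
  + by move=> x /=; rewrite Kf Kg.
  + by move=> x; apply: continuous_comp; [exact: fc|exact: gc].
  + by move=> x; apply: continuous_comp; [exact: g'c|exact: f'c].
- by move=> x y /fi/gi.
- by move=> x x01 /=; rewrite ffix // gfix.
Qed.

Lemma thompson_inv f g : thompson f -> cancel f g -> cancel g f -> thompson g.
Proof.
move=> Tf fK Kf; have [sf Pf] := thompson_pieces Tf.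
have [[f' [f'K Kf' fc f'c]] fi ffix _ _] := Tf.
have gf' : g = f' by apply/funext => x; rewrite -{1}(Kf' x) fK.
have [PL D] := pieces_thompson (pieces_inv fi ffix fK Kf Pf).
split => //.
- by exists f; split=> //; rewrite gf'.
- exact: incr_inv fi Kf.
- by move=> x /ffix {1}<-.
Qed.

Definition thompson_group := {f : R -> R | `[< thompson f >]}.

HB.instance Definition _ := Choice.on thompson_group.

Implicit Types u v : thompson_group.

Lemma thompsonP u : thompson (val u).
Proof. exact/asboolP/(valP u). Qed.

Lemma thompson_invertible u : exists g, cancel (val u) g /\ cancel g (val u).
Proof. by have [[g [? ? _ _]] _ _ _ _] := thompsonP u; exists g. Qed.

Definition thompson_inv_fun u : R -> R := projT1 (cid (thompson_invertible u)).

Lemma thompson_inv_funP u : thompson (thompson_inv_fun u).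
Proof.
rewrite /thompson_inv_fun; case: cid => g /= [gK Kg].
exact: thompson_inv (thompsonP u) gK Kg.
Qed.

Definition thompson_one : thompson_group := exist _ id (asboolT thompson_id).
Definition thompson_mul u v : thompson_group :=
  exist _ (val u \o val v) (asboolT (thompson_comp (thompsonP u) (thompsonP v))).
Definition thompson_invg u : thompson_group :=
  exist _ (thompson_inv_fun u) (asboolT (thompson_inv_funP u)).

Fact thompson_mulA : associative thompson_mul.
Proof. by move=> u v w; apply: val_inj. Qed.

Fact thompson_mul1g : left_id thompson_one thompson_mul.
Proof. by move=> u; apply: val_inj. Qed.

Fact thompson_mulg1 : right_id thompson_one thompson_mul.
Proof. by move=> u; apply: val_inj. Qed.

Fact thompson_mulVg : left_inverse thompson_one thompson_invg thompson_mul.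
Proof.
move=> u; apply: val_inj => /=; rewrite /thompson_inv_fun.
by case: cid => g /= [gK _]; apply/funext => x /=; rewrite gK.
Qed.

Fact thompson_mulgV : right_inverse thompson_one thompson_invg thompson_mul.
Proof.
move=> u; apply: val_inj => /=; rewrite /thompson_inv_fun.
by case: cid => g /= [_ Kg]; apply/funext => x /=; rewrite Kg.
Qed.

HB.instance Definition _ := isGroup.Build thompson_group
  thompson_mulA thompson_mul1g thompson_mulg1 thompson_mulVg thompson_mulgV.

Definition slope0 f : R := lim ((f x - f 0) / x @[x --> 0^'+]).
Definition slope1 f : R := lim ((f x - f 1) / (x - 1) @[x --> 1^'-]).

Definition chi0 u : R := ln (slope0 (val u)) / ln 2.
Definition chi1 u : R := ln (slope1 (val u)) / ln 2.

Lemma thompson_near0 f : thompson f -> exists (k : int) (e : R),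
  0 < e /\ {in `[0, e], forall x, f x = 2 ^ k * x}.
Proof.
move=> Tf; have [s [_ PL]] := thompson_pieces Tf; have [_ _ fix_ _ _] := Tf.
have f0 : f 0 = 0 by apply: fix_; rewrite in_itv /= ltxx.
have [e0 e00 sep0] := separation s 0.
pose e := Num.min e0 1.
have e_gt0 : 0 < e by rewrite lt_min e00 ltr01.
have ee0 : e <= e0 by rewrite ge_min lexx.
have e1 : e <= 1 by rewrite ge_min lexx orbT.
have [y ys|k [c E]] := PL 0 e (lexx _) e_gt0 e1.
  rewrite in_itv /=; apply/negP => /andP[y0 ye].
  have := sep0 _ ys; rewrite gt_eqF // => /(_ isT).
  by rewrite subr0 gtr0_norm // leNgt => /negP; apply; lra.
exists k, e; split=> // x xe; rewrite E //.
have := E 0; rewrite in_itv /= lexx ltW // f0 mulr0 add0r => <- //.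
by rewrite addr0.
Qed.

Lemma thompson_near1 f : thompson f -> exists (k : int) (e : R),
  0 < e /\ {in `[1 - e, 1], forall x, f x = 2 ^ k * (x - 1) + 1}.
Proof.
move=> Tf; have [s [_ PL]] := thompson_pieces Tf; have [_ _ fix_ _ _] := Tf.
have f1 : f 1 = 1 by apply: fix_; rewrite in_itv /= ltxx andbF.
have [e0 e00 sep0] := separation s 1.
pose e := Num.min e0 1.
have e_gt0 : 0 < e by rewrite lt_min e00 ltr01.
have ee0 : e <= e0 by rewrite ge_min lexx.
have e1 : e <= 1 by rewrite ge_min lexx orbT.
have [|||y ys|k [c E]] := PL (1 - e) 1; [lra..| |].
  rewrite in_itv /=; apply/negP => /andP[ye y1].
  have := sep0 _ ys; rewrite lt_eqF // => /(_ isT).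
  by rewrite ltr0_norm ?subr_lt0 // leNgt => /negP; apply; lra.
exists k, e; split=> // x xe; rewrite E //.
have : f 1 = 2 ^ k * 1 + c by apply: E; rewrite in_itv /= lexx andbT; lra.
rewrite f1 mulr1 => c1; have -> : c = 1 - 2 ^ k by rewrite {1}c1 addrC addKr.
by ring.
Qed.

Lemma slope0E f (m e : R) : 0 < e -> {in `[0, e], forall x, f x = m * x} ->
  slope0 f = m.
Proof.
move=> e0 H; apply: cvg_lim => //; apply: near_cst_cvg; near=> h.
have h0 : 0 < h by near: h; exact: nbhs_right_gt.
have he : h <= e by near: h; exact: nbhs_right_le.
rewrite !H ?in_itv /= ?lexx ?ltW // mulr0 subr0 mulfK // gt_eqF //.
Unshelve. all: by end_near. Qed.

Lemma slope1E f (m e : R) : 0 < e ->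
  {in `[1 - e, 1], forall x, f x = m * (x - 1) + 1} -> slope1 f = m.
Proof.
move=> e0 H; apply: cvg_lim => //; apply: near_cst_cvg; near=> h.
have h1 : h < 1 by near: h; exact: nbhs_left_lt.
have he : 1 - e <= h by near: h; apply: nbhs_left_ge; lra.
rewrite !H ?in_itv /=; try by apply/andP; split; lra.
rewrite subrr mulr0 add0r addrK mulfK // lt_eqF // subr_lt0 //.
Unshelve. all: by end_near. Qed.

Lemma chi0M u v : chi0 (u * v)%g = chi0 u + chi0 v.
Proof.
have [k [e [e0 E]]] := thompson_near0 (thompsonP u).
have [l [d [d0 D]]] := thompson_near0 (thompsonP v).
have p (n : int) : (0 : R) < 2 ^ n by rewrite exprz_gt0.
rewrite /chi0 (slope0E e0 E) (slope0E d0 D).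
have -> : slope0 (val (u * v)%g) = 2 ^ k * 2 ^ l.
  apply: (@slope0E _ _ (Num.min d (e / 2 ^ l))).
    by rewrite lt_min d0 divr_gt0.
  move=> x; rewrite in_itv /= le_min => /andP[x0 /andP[xd xe]].
  have y0 : 0 <= 2 ^ l * x by rewrite mulr_ge0 // ltW.
  have ye : 2 ^ l * x <= e by rewrite mulrC -ler_pdivlMr.
  by rewrite /= D ?E ?mulrA // in_itv /= ?x0 ?xd ?y0 ?ye.
by rewrite lnM ?posrE // mulrDl.
Qed.

Lemma chi1M u v : chi1 (u * v)%g = chi1 u + chi1 v.
Proof.
have [k [e [e0 E]]] := thompson_near1 (thompsonP u).
have [l [d [d0 D]]] := thompson_near1 (thompsonP v).
have p (n : int) : (0 : R) < 2 ^ n by rewrite exprz_gt0.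
rewrite /chi1 (slope1E e0 E) (slope1E d0 D).
have -> : slope1 (val (u * v)%g) = 2 ^ k * 2 ^ l.
  apply: (@slope1E _ _ (Num.min d (e / 2 ^ l))).
    by rewrite lt_min d0 divr_gt0.
  move=> x; rewrite in_itv /= => /andP[x0 x1].
  have : 1 - x <= Num.min d (e / 2 ^ l) by lra.
  rewrite le_min ler_pdivlMr // => /andP[xd xe].
  rewrite /= D ?in_itv /=; last by apply/andP; split; lra.
  rewrite E ?in_itv /= ?addrK ?mulrA //.
  apply/andP; split; last first.
    by rewrite gerDr pmulr_rle0 // subr_le0.
  by move: xe; rewrite -[x - 1]opprB mulrN [2 ^ l * _]mulrC; lra.
by rewrite lnM ?posrE // mulrDl.
Qed.

Variables p q : int.

Definition chi_pq u : R := p%:~R * chi0 u - q%:~R * chi1 u.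

Definition chi_pq_kernel : {pred thompson_group} := fun u => chi_pq u == 0.

Lemma chi_pqM u v : chi_pq (u * v)%g = chi_pq u + chi_pq v.
Proof. by rewrite /chi_pq chi0M chi1M; ring. Qed.

Fact chi_pq_kernel_closed : group_closed chi_pq_kernel.
Proof.
have c1 : chi_pq 1%g = 0.
  by apply: (addrI (chi_pq 1%g)); rewrite -chi_pqM mulg1 addr0.
split=> [|u v]; rewrite /chi_pq_kernel !unfold_in ?c1 // => /eqP u0 /eqP v0.
have : chi_pq (u / v * v)%g = 0 by rewrite mulgVK.
by rewrite chi_pqM v0 addr0 => ->.
Qed.

Definition N_pq := {u : thompson_group | chi_pq_kernel u}.

HB.instance Definition _ := SubChoice.on N_pq.
HB.instance Definition _ :=
  SubChoice_isSubGroup.Build thompson_group chi_pq_kernel N_pq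
    chi_pq_kernel_closed.

End Thompson.

(* Main.v *)
(* All explicit elements are built from the bump of F with support [c, c + 4h] and
   slopes 1/2, 1, 2, for dyadic c and h.

   If q = 0, every element of N is trivial near 0, so finitely many elements, and
   the subgroup they generate, fix a common neighbourhood of 0 pointwise, which N
   does not; p = 0 is symmetric.

   If pq > 0, N contains an element t that contracts (0, 1) towards 1/2, and every
   element of N is t^-i f t^j with f supported in [1/4, 3/4]. These f form a copy
   of F, presented by x_j x_i = x_i x_(j+1) for i < j, so N is an ascending HNN
   extension of a finitely presented group. It is isolated because there is one
   nontrivial element, a commutator, contained in every nontrivial normal subgroup.

   If pq < 0, N contains an element t with t(x) > x on (0, 1), and N is generated
   by t and the compactly supported elements of F. Let H be finitely presented and
   mapped onto N. For r large, replacing a compactly supported f by the product of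
   its conjugates under the powers of t^r (making N periodic) respects the finitely
   many relators, hence yields an action Psi_r of H on the line. If x and y do not
   commute and live in a fundamental domain of t, then for primes r and l the map
   Psi_r kills the commutator [x, y^(t^l)] if and only if r <> l, whereas N always
   kills it. So the sets of large primes r give pairwise distinct normal subgroups
   of H inside the kernel of H -> N. *)

From HB Require Import structures.
Require Import Defs.
From mathcomp Require Import all_boot all_order all_algebra finmap ring lra zify.
From mathcomp Require Import all_classical all_reals all_analysis.

Set Implicit Arguments.
Unset Strict Implicit.
Unset Printing Implicit Defensive.

Import Order.TTheory GRing.Theory Num.Theory.
Import numFieldNormedType.Exports.

Local Open Scope classical_set_scope.
Local Open Scope ring_scope.

(** * Elements of Thompson's group as homeomorphisms *)

(** The bump is the classical generator x_0 of F, rescaled. Near the right end of its support it is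
    the dilation by 2 about that end, so bumps whose supports share the right end and halve in
    length are carried to one another by conjugation: this is where the relations x_j x_i = x_i
    x_(j+1) come from. That they suffice is read off from the action on the line, on which a sorted
    positive word is determined by the map it represents. In the last case the obstacle is that H is
    arbitrary and known only through finitely many relators. So Psi_r is defined on a free group and
    descends to H because each element of N is uniquely a power of t times a compactly supported
    map, a splitting whose multiplication rule survives periodization once r is large. For l > 0,
    Psi_r kills [x, y^(t^l)] exactly when r does not divide l; primes turn divisibility into
    equality, so that each commutator tests a single r. *)

Ltac case_minmax :=
  repeat match goal with
  | |- context [@Order.max _ _ ?a ?b] =>
    lazymatch constr:((a, b)) with
    | context [@Order.max _ _ _ _] => fail
    | context [@Order.min _ _ _ _] => fail
    | _ => case: (leP a b) => ?
    end
  | |- context [@Order.min _ _ ?a ?b] =>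
    lazymatch constr:((a, b)) with
    | context [@Order.max _ _ _ _] => fail
    | context [@Order.min _ _ _ _] => fail
    | _ => case: (leP a b) => ?
    end
  end.

Section ThompsonAction.
Variable R : realType.
Implicit Types (u v w : thompson_group R) (a b c h x y z : R).

Lemma thompson_ext u v : val u =1 val v -> u = v.
Proof. by move=> uv; apply: val_inj; apply/funext. Qed.

Lemma thompson_invK u : cancel (val u) (val u^-1%g).
Proof. by move=> x; rewrite -[LHS]/(val (u^-1 * u)%g x) mulVg. Qed.

Lemma thompson_invVK u : cancel (val u^-1%g) (val u).
Proof. by move=> x; rewrite -[LHS]/(val (u * u^-1)%g x) mulgV. Qed.

Lemma thompson_ltW u : {homo val u : x y / x < y}.
Proof. by have [] := thompsonP u. Qed.

Lemma thompson_le u : {mono val u : x y / x <= y}.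
Proof. exact: le_mono (@thompson_ltW u). Qed.

Lemma thompson_lt u : {mono val u : x y / x < y}.
Proof. exact: leW_mono (@thompson_le u). Qed.

Lemma thompson_out u x : ~~ (0 < x < 1) -> val u x = x.
Proof. by have [_ _ H _ _] := thompsonP u => nx; apply: H; rewrite in_itv. Qed.

Lemma thompson_0 u : val u 0 = 0.
Proof. by apply: thompson_out; rewrite ltxx. Qed.

Lemma thompson_1 u : val u 1 = 1.
Proof. by apply: thompson_out; rewrite ltxx andbF. Qed.

Lemma thompson_itv u x : (0 < val u x < 1) = (0 < x < 1).
Proof. by rewrite -{1}(thompson_0 u) -{1}(thompson_1 u) !thompson_lt. Qed.

Lemma thompson_cont u : continuous (val u).
Proof. by have [[? []]] := thompsonP u. Qed.

Lemma thompson_dyadic u x : dyadic x -> dyadic (val u x).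
Proof.
have [s P] := thompson_pieces (thompsonP u).
by have [_ _ H _ _] := thompsonP u; exact: pieces_dyadic P H.
Qed.

Lemma thompson_build (f g : R -> R) s : cancel f g -> cancel g f ->
  continuous f -> continuous g -> {homo f : x y / x < y} ->
  (forall x, ~~ (0 < x < 1) -> f x = x) ->
  dyadic_pieces f s -> exists u : thompson_group R, val u = f.
Proof.
move=> fg gf fc gc fi fo P; have [PL D] := pieces_thompson P.
have Tf : thompson f.
  by split => //; exists g.
by exists (exist _ f (asboolT Tf)).
Qed.

Definition supported u a b := forall x, ~~ (a < x < b) -> val u x = x.

Lemma supported1 a b : supported 1%g a b.
Proof. by []. Qed.

Lemma supportedW u a b c d : c <= a -> b <= d ->
  supported u a b -> supported u c d.
Proof.
move=> ca bd H x nx; apply: H; apply: contra nx => /andP[ax xb].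
by rewrite (le_lt_trans ca ax) (lt_le_trans xb bd).
Qed.

Lemma supportedV u a b : supported u a b -> supported u^-1%g a b.
Proof. by move=> H x /H {1}<-; rewrite thompson_invK. Qed.

Lemma supportedM u v a b :
  supported u a b -> supported v a b -> supported (u * v)%g a b.
Proof. by move=> H K x nx; rewrite /= (K _ nx) (H _ nx). Qed.

Lemma supportedJ u v a b : supported u (val v a) (val v b) ->
  supported (u ^ v)%g a b.
Proof.
move=> H x nx; rewrite conjgE.
rewrite -[LHS]/(val v^-1%g (val u (val v x))) H ?thompson_invK //.
by rewrite !thompson_lt.
Qed.

Lemma supportedJV u v a b : supported u a b ->
  supported (u ^ v^-1)%g (val v a) (val v b).
Proof. by move=> H; apply: supportedJ; rewrite !thompson_invK. Qed.

Lemma supported_itv u a b x : supported u a b ->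
  (a < val u x < b) = (a < x < b).
Proof.
move=> H; have [xa|ax] := leP x a.
  by rewrite H ?ltNge ?xa.
have [bx|xb] := leP b x.
  by rewrite H ?ltNge ?bx ?andbF //.
rewrite -{1}(H a) ?ltxx // -{1}(H b) ?ltxx ?andbF //.
by rewrite !thompson_lt ax xb.
Qed.

Lemma supported_commute u v a b c d : b <= c ->
  supported u a b -> supported v c d -> commute u v.
Proof.
move=> bc Hu Hv; apply: thompson_ext => x /=.
have [xb|bx] := ltP x b.
  have nx z : z < b -> ~~ (c < z < d).
    by move=> zb; rewrite ltNge (le_trans (ltW zb) bc).
  rewrite (Hv _ (nx _ xb)) (Hv (val u x)) //; apply: nx.
  case: (boolP (a < x < b)); last by move=> /Hu ->.
  by rewrite -(supported_itv x Hu) => /andP[].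
rewrite (Hu x) ?(ltNge x) ?bx ?andbF // Hu //.
case: (boolP (c < x < d)) => [|/Hv->]; last by rewrite (ltNge x) bx andbF.
rewrite -(supported_itv x Hv) => /andP[/ltW cx _].
by rewrite (ltNge _ b) (le_trans bc cx) andbF.
Qed.

Lemma supported_split u a b y : dyadic y -> supported u a b -> val u y = y ->
  exists v w, [/\ supported v a y, supported w y b & u = (v * w)%g].
Proof.
move=> dy Hu uy.
(* When [u] fixes [y], this is [u] to the left of [y] and the identity to the right. The closed
   formula makes continuity immediate; [y] becomes a break point, hence must be dyadic. *)
pose f u x := Num.min (val u x) y + Num.max x y - y.
have fl v x : val v y = y -> x <= y -> f v x = val v x.
  move=> vy xy; rewrite /f (max_idPr xy) addrK; apply/min_idPl.
  by rewrite -vy thompson_le.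
have fr v x : val v y = y -> y <= x -> f v x = x.
  move=> vy xy; rewrite /f (max_idPl xy) (_ : Num.min _ _ = y).
    by rewrite addrC addKr.
  by apply/min_idPr; rewrite -{1}vy thompson_le.
have fK v : val v y = y -> cancel (f v) (f v^-1%g).
  move=> vy x; have vy' : val v^-1%g y = y by rewrite -{1}vy thompson_invK.
  have [xy|/ltW xy] := leP x y; last by rewrite !fr.
  by rewrite fl // fl ?thompson_invK // -vy thompson_le.
have uy' : val u^-1%g y = y by rewrite -{1}uy thompson_invK.
have fc v : continuous (f v).
  move=> x; apply: cvgB; last exact: cvg_cst.
  apply: cvgD; first apply: continuous_min.
  - exact: thompson_cont.
  - exact: cvg_cst.
  - by apply: continuous_max; [exact: cvg_id|exact: cvg_cst].
have fi : {homo f u : x x' / x < x'}.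
  move=> x x' xx'; have [xy|/ltW xy] := leP x y; last first.
    by rewrite !fr // (le_trans xy (ltW xx')).
  have [xy'|yx'] := leP x' y; first by rewrite !fl // thompson_lt.
  rewrite fl // fr ?ltW //; apply: le_lt_trans yx'.
  by rewrite -uy thompson_le.
have [s [ds PL]] := thompson_pieces (thompsonP u).
have [|||v vE] := @thompson_build (f u) (f u^-1%g) (y :: s) (fK _ uy) _ (fc _)
  (fc _) fi.
- by rewrite -{2}(invgK u); exact: fK.
- move=> x nx; have [xy|/ltW xy] := leP x y; last by rewrite fr.
  by rewrite fl // thompson_out.
- split; first by move=> x; rewrite inE => /orP[/eqP->|/ds].
  move=> c d c0 cd d1 H.
  have yN : y \notin `]c, d[ by apply: H; rewrite inE eqxx.
  have [|k [e E]] := PL _ _ c0 cd d1.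
    by move=> x xs; apply: H; rewrite inE xs orbT.
  move: yN; rewrite in_itv /= negb_and -!leNgt => /orP[yc|dy'].
    exists 0, 0 => x; rewrite in_itv /= => /andP[cx _].
    by rewrite expr0z mul1r addr0 fr // (le_trans yc).
  exists k, e => x xcd; rewrite -E //; apply: fl => //.
  by move: xcd; rewrite in_itv /= => /andP[_ xd]; exact: le_trans dy'.
have vL x : x <= y -> val v x = val u x by move=> xy; rewrite vE fl.
have vR x : y <= x -> val v x = x by move=> xy; rewrite vE fr.
exists v, (v^-1 * u)%g; split; last by rewrite mulVKg.
- move=> x; rewrite negb_and -!leNgt => /orP[xa|]; last exact: vR.
  have [xy|yx] := leP x y; first by rewrite vL // Hu // ltNge xa.
  by rewrite vR // ltW.
- move=> x; rewrite negb_and -!leNgt => /orP[xy|bx].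
    by rewrite -[LHS]/(val v^-1%g (val u x)) -vL // thompson_invK.
  have ux : val u x = x by rewrite Hu // !ltNge bx andbF.
  rewrite -[LHS]/(val v^-1%g (val u x)) ux.
  have [xy|yx] := leP x y; last by rewrite -{1}(vR x (ltW yx)) thompson_invK.
  by rewrite -{1}ux -vL // thompson_invK.
Qed.

(** Otherwise the orbit of [y] has a supremum s in [y, z]. Since s < u s, some orbit point exceeds
    u^-1 s, and the next one exceeds s. *)
Lemma thompson_push u y z :
  (forall x, y <= x <= z -> x < val u x) -> exists n, z < val (u ^+ n)%g y.
Proof.
move=> H; apply: contrapT => /forallNP N.
have {}N n : val (u ^+ n)%g y <= z by rewrite leNgt; exact/negP/N.
pose A := [set val (u ^+ n)%g y | n in [set: nat]].
have hs : has_sup A.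
  split; first by exists y, 0%N.
  by exists z => _ [n _ <-]; exact: N.
have ys : y <= sup A by apply: sup_upper_bound => //; exists 0%N.
have sz : sup A <= z by apply: ge_sup; [case: hs|move=> _ [n _ <-]; exact: N].
have := H (sup A); rewrite ys sz => /(_ isT).
rewrite -(thompson_lt u^-1%g) thompson_invK => /(sup_gt hs.1).
move=> [_ [n _ <-]]; rewrite -(thompson_lt u) thompson_invVK => lt_s.
have : val (u ^+ n.+1)%g y <= sup A by apply: sup_upper_bound => //; exists n.+1.
by rewrite expgS /= leNgt lt_s.
Qed.

(** Min and max replace a definition by cases: continuity is inherited, and statements about the
    pieces reduce to linear arithmetic. *)
Definition bump_fun c h x : R :=
  Num.min x (Num.max (c + (x - c) / 2) (Num.max (x - h) (2 * x - (c + 4 * h)))).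

Definition bump_inv c h x : R :=
  Num.max x (Num.min (c + 2 * (x - c)) (Num.min (x + h) ((x + (c + 4 * h)) / 2))).

Lemma bump_funP c h : 0 < h ->
  [/\ forall x, x <= c \/ c + 4 * h <= x -> bump_fun c h x = x,
      forall x, c <= x <= c + 2 * h -> bump_fun c h x = c + (x - c) / 2,
      forall x, c + 2 * h <= x <= c + 3 * h -> bump_fun c h x = x - h &
      forall x, c + 3 * h <= x <= c + 4 * h ->
        bump_fun c h x = 2 * x - (c + 4 * h)].
Proof.
rewrite /bump_fun => h0; split=> x.
- by case_minmax; case=> ?; lra.
all: by case_minmax => /andP[? ?]; lra.
Qed.

Lemma bump_fun_lt c h x : 0 < h -> c < x < c + 4 * h -> bump_fun c h x < x.
Proof. by rewrite /bump_fun => h0 /andP[cx xd]; case_minmax; lra. Qed.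

Lemma bump_funK c h : 0 < h -> cancel (bump_fun c h) (bump_inv c h).
Proof. by rewrite /bump_fun /bump_inv => h0 x; case_minmax; lra. Qed.

Lemma bump_invK c h : 0 < h -> cancel (bump_inv c h) (bump_fun c h).
Proof. by rewrite /bump_fun /bump_inv => h0 x; case_minmax; lra. Qed.

End ThompsonAction.

(** * Dyadic numbers, bumps as elements of F, and the two characters *)

Section Bumps.
Variable R : realType.
Implicit Types (u v w : thompson_group R) (a b c h x y z : R).

Lemma dyadic_int (k : int) : dyadic (k%:~R : R).
Proof. by exists k, 0%N; rewrite expr0 divr1. Qed.

Lemma dyadic1 : dyadic (1 : R).
Proof. exact: (dyadic_int 1). Qed.

Lemma dyadic_nat (n : nat) : dyadic (n%:R : R).
Proof. exact: (dyadic_int n%:Z). Qed.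

Lemma dyadicB x y : dyadic x -> dyadic y -> dyadic (x - y).
Proof. by move=> dx dy; apply: dyadicD => //; exact: dyadicN. Qed.

Lemma dyadicX n x : dyadic x -> dyadic (2 ^+ n * x).
Proof. by move=> dx; apply: (dyadicM n dx). Qed.

Lemma dyadic_div n x : dyadic x -> dyadic (x / 2 ^+ n).
Proof. by move=> /(dyadicM (- n%:Z)); rewrite -exprnN mulrC. Qed.

Lemma dyadic_mulrn x n : dyadic x -> dyadic (x *+ n).
Proof.
move=> dx; elim: n => [|n IH]; first by rewrite mulr0n; exact: dyadic0.
by rewrite mulrS; exact: dyadicD.
Qed.

Lemma dyadic_dense x y : x < y -> exists2 z, dyadic z & x < z < y.
Proof.
move=> xy; have d0 : 0 < y - x by rewrite subr_gt0.
have [n] : exists n : nat, (y - x)^-1 < 2 ^+ n.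
  exists (Num.truncn (y - x)^-1).+1; apply: lt_le_trans (truncnS_gt _) _.
  rewrite -natrX ler_nat ltnW //; exact: ltn_expl.
move=> H; have p0 : (0 : R) < 2 ^+ n by rewrite exprn_gt0.
have {}H : 1 < (y - x) * 2 ^+ n.
  by rewrite mulrC -ltr_pdivrMr // div1r.
exists ((Num.floor (x * 2 ^+ n) + 1)%:~R / 2 ^+ n).
  exact/dyadic_div/dyadic_int.
rewrite ltr_pdivlMr // ltr_pdivrMr //.
have /andP[f1 f2] := floor_itv (x * 2 ^+ n).
rewrite f2 /=; move: H; rewrite mulrBl rmorphD /= => H.
by move: f1; set m := _%:~R => f1; lra.
Qed.

Definition bump_valid c h := [/\ dyadic c, dyadic h, 0 < h, 0 <= c & c + 4 * h <= 1].

(** Total in [c] and [h]: the identity is the default where [bump_fun] does not define an element of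
    F. *)
Definition dyadic_bump c h : thompson_group R :=
  xget 1%g [set u : thompson_group R | val u = bump_fun c h].

Lemma bump_val c h : bump_valid c h -> val (dyadic_bump c h) = bump_fun c h.
Proof.
move=> [dc dh h0 c0 c1]; have [E1 E2 E3 E4] := bump_funP c h0.
have id_cont : continuous (fun x : R => x) by move=> x; exact: cvg_id.
have cont_min (f g : R -> R) : continuous f -> continuous g ->
    continuous (fun x => Num.min (f x) (g x)).
  by move=> fc gc x; exact: (continuous_min (fc x) (gc x)).
have cont_max (f g : R -> R) : continuous f -> continuous g ->
    continuous (fun x => Num.max (f x) (g x)).
  by move=> fc gc x; exact: (continuous_max (fc x) (gc x)).
suff [u uE] : exists u : thompson_group R, val u = bump_fun c h.
  by rewrite /dyadic_bump; case: xgetP => [v _ ->//|/(_ u)].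
apply: (@thompson_build _ _ (bump_inv c h)
  [:: c; c + 2 * h; c + 3 * h; c + 4 * h]).
- exact: bump_funK.
- exact: bump_invK.
- rewrite /bump_fun; apply: (cont_min _ _ id_cont); apply/cont_max; last apply/cont_max.
  + by move=> x; apply: cvgD; [exact: cvg_cst|apply: cvgMl; apply: cvgB; [exact: cvg_id|exact: cvg_cst]].
  + by move=> x; apply: cvgB; [exact: cvg_id|exact: cvg_cst].
  + by move=> x; apply: cvgB; [apply: cvgMr; exact: cvg_id|exact: cvg_cst].
- rewrite /bump_inv; apply: (cont_max _ _ id_cont); apply/cont_min; last apply/cont_min.
  + by move=> x; apply: cvgD; [exact: cvg_cst|apply: cvgMr; apply: cvgB; [exact: cvg_id|exact: cvg_cst]].
  + by move=> x; apply: cvgD; [exact: cvg_id|exact: cvg_cst].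
  + by move=> x; apply: cvgMl; apply: cvgD; [exact: cvg_id|exact: cvg_cst].
- move=> x y xy; rewrite /bump_fun; case_minmax; lra.
- move=> x nx; apply: E1; have [|xc] := leP x c; [by left|right].
  rewrite leNgt; apply: contra nx => xd.
  by rewrite (le_lt_trans c0 xc) (lt_le_trans xd c1).
- have d4 : (4 : R) * h = 2 ^+ 2 * h by rewrite -natrX.
  split.
    move=> x; rewrite !inE => /or4P[] /eqP->; rewrite ?d4 //.
    + by apply: dyadicD => //; apply: (dyadicM 1).
    + by rewrite mulr_natl; apply: dyadicD => //; exact: dyadic_mulrn.
    + by apply: dyadicD => //; exact: dyadicX.
  move=> a b a0 ab b1 H.
  have {}H x : x \in [:: c; c + 2 * h; c + 3 * h; c + 4 * h] -> x <= a \/ b <= x.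
    move=> /H; rewrite in_itv /= negb_and -!leNgt => /orP[]; by [left|right].
  (* No break point lies inside (a, b), so the first one at or beyond [b] determines the piece that
     contains the interval. *)
  have [H1|H1] : c <= a \/ b <= c by apply: H; rewrite !inE eqxx ?orbT.
    have [H2|H2] : c + 2 * h <= a \/ b <= c + 2 * h by apply: H; rewrite !inE eqxx ?orbT.
      have [H3|H3] : c + 3 * h <= a \/ b <= c + 3 * h by apply: H; rewrite !inE eqxx ?orbT.
        have [H4|H4] : c + 4 * h <= a \/ b <= c + 4 * h by apply: H; rewrite !inE eqxx ?orbT.
          exists 0, 0 => x; rewrite in_itv /= => /andP[? ?].
          by rewrite E1 ?expr0z; [lra|right; lra].
        exists 1, (- (c + 4 * h)) => x; rewrite in_itv /= => /andP[? ?].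
        by rewrite E4 ?expr1z; [lra|apply/andP; split; lra].
      exists 0, (- h) => x; rewrite in_itv /= => /andP[? ?].
      by rewrite E3 ?expr0z; [lra|apply/andP; split; lra].
    exists (-1), (c - c / 2) => x; rewrite in_itv /= => /andP[? ?].
    by rewrite E2 ?exprN1; [lra|apply/andP; split; lra].
  exists 0, 0 => x; rewrite in_itv /= => /andP[? ?].
  by rewrite E1 ?expr0z; [lra|left; lra].
Qed.

Lemma bump_supported c h : bump_valid c h -> supported (dyadic_bump c h) c (c + 4 * h).
Proof.
move=> V x; rewrite bump_val // negb_and -!leNgt => nx.
case: V => _ _ h0 _ _; have [-> //] := bump_funP c h0.
by move: nx => /orP[]; [left|right].
Qed.

Lemma bump_lt c h x : bump_valid c h -> c < x < c + 4 * h ->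
  val (dyadic_bump c h) x < x.
Proof. by move=> V; rewrite bump_val //; apply: bump_fun_lt; case: V. Qed.

Lemma bump_le c h x : bump_valid c h -> val (dyadic_bump c h) x <= x.
Proof.
move=> V; have [/(bump_lt V)/ltW//|nx] := boolP (c < x < c + 4 * h).
by rewrite (bump_supported V).
Qed.

(** The shape of a bump is invariant under affine changes of coordinate, and [u] is affine on the
    support. This lemma is the source of the forest relations. *)
Lemma bumpJ u c h c' m : 0 < m ->
  bump_valid c h -> bump_valid c' (m * h) ->
  (forall x, c <= x <= c + 4 * h -> val u x = c' + m * (x - c)) ->
  (u * dyadic_bump c h = dyadic_bump c' (m * h) * u)%g.
Proof.
move=> m0 V V' uE; apply: thompson_ext => x /=.
have h0 : 0 < h by case: V.
have mh0 : 0 < m * h by rewrite mulr_gt0.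
have [xc|nx] := boolP (c < x < c + 4 * h); last first.
  rewrite (bump_supported V) // (bump_supported V') //.
  have -> : c' + 4 * (m * h) = val u (c + 4 * h).
    by rewrite uE ?lexx ?andbT; [ring|lra].
  have -> : c' = val u c by rewrite uE ?lexx ?subrr ?mulr0 ?addr0 //=; lra.
  by rewrite !thompson_lt.
have /andP[cx xd] := xc.
have {xc} : c < val (dyadic_bump c h) x < c + 4 * h.
  by rewrite (supported_itv x (bump_supported V)).
rewrite bump_val // => /andP[cy yd].
have uF y : c <= y -> y <= c + 4 * h -> val u y = c' + m * (y - c).
  by move=> cy' yd'; apply: uE; rewrite cy' yd'.
rewrite bump_val // (uF _ (ltW cy) (ltW yd)) (uF _ (ltW cx) (ltW xd)) bump_val //.
have [E1 E2 E3 E4] := bump_funP c h0; have [E1' E2' E3' E4'] := bump_funP c' mh0.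
have M y : 0 <= y -> 0 <= m * y by move=> ?; rewrite mulr_ge0 // ltW.
have [x2|x2] := leP x (c + 2 * h).
  have M1 : 0 <= m * (x - c) by apply: M; lra.
  have M2 : 0 <= m * (c + 2 * h - x) by apply: M; lra.
  rewrite E2; last by apply/andP; split; lra.
  by rewrite E2'; [field|apply/andP; split; lra].
have [x3|x3] := leP x (c + 3 * h).
  have M1 : 0 <= m * (x - (c + 2 * h)) by apply: M; lra.
  have M2 : 0 <= m * (c + 3 * h - x) by apply: M; lra.
  rewrite E3; last by apply/andP; split; lra.
  by rewrite E3'; [ring|apply/andP; split; lra].
have M1 : 0 <= m * (x - (c + 3 * h)) by apply: M; lra.
have M2 : 0 <= m * (c + 4 * h - x) by apply: M; lra.
rewrite E4; last by apply/andP; split; lra.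
by rewrite E4'; [ring|apply/andP; split; lra].
Qed.

Lemma ln2_exp (k : int) : ln (2 ^ k : R) = k%:~R * ln 2.
Proof.
case: k => n.
  by rewrite -exprnP lnXn // mulr_natl.
by rewrite NegzE -exprnN lnV ?posrE ?exprn_gt0 // lnXn // intrN mulNr mulr_natl.
Qed.

Lemma ln2_neq0 : ln (2 : R) != 0.
Proof. by rewrite gt_eqF // ln_gt0 // ltr1n. Qed.

Lemma chi0E u (k : int) e : 0 < e -> (forall x, 0 <= x <= e -> val u x = 2 ^ k * x) ->
  chi0 u = k%:~R.
Proof.
move=> e0 H; rewrite /chi0 (slope0E e0 (m := 2 ^ k)) ?ln2_exp ?mulfK ?ln2_neq0 //.
Qed.

Lemma chi1E u (k : int) e : 0 < e ->
  (forall x, 1 - e <= x <= 1 -> val u x = 2 ^ k * (x - 1) + 1) -> chi1 u = k%:~R.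
Proof.
move=> e0 H; rewrite /chi1 (slope1E e0 (m := 2 ^ k)) ?ln2_exp ?mulfK ?ln2_neq0 //.
Qed.

Lemma chi0P u : exists (k : int) e, [/\ 0 < e, chi0 u = k%:~R &
  forall x, 0 <= x <= e -> val u x = 2 ^ k * x].
Proof.
have [k [e [e0 E]]] := thompson_near0 (thompsonP u).
by exists k, e; split => //; exact: chi0E e0 E.
Qed.

Lemma chi1P u : exists (k : int) e, [/\ 0 < e, chi1 u = k%:~R &
  forall x, 1 - e <= x <= 1 -> val u x = 2 ^ k * (x - 1) + 1].
Proof.
have [k [e [e0 E]]] := thompson_near1 (thompsonP u).
by exists k, e; split => //; exact: chi1E e0 E.
Qed.

Lemma chi0_eq0 u a : 0 < a -> (forall x, 0 <= x <= a -> val u x = x) -> chi0 u = 0.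
Proof.
by move=> a0 H; rewrite (@chi0E u 0 a) // => x /H ->; rewrite expr0z mul1r.
Qed.

Lemma chi1_eq0 u b : b < 1 -> (forall x, b <= x <= 1 -> val u x = x) -> chi1 u = 0.
Proof.
move=> b1 H; rewrite (@chi1E u 0 (1 - b)) ?subr_gt0 // => x.
by rewrite subKr => /H ->; rewrite expr0z mul1r subrK.
Qed.

Lemma chi0_supported u a b : 0 < a -> supported u a b -> chi0 u = 0.
Proof.
by move=> a0 H; apply: (chi0_eq0 a0) => x /andP[_ xa]; rewrite H // ltNge xa.
Qed.

Lemma chi1_supported u a b : b < 1 -> supported u a b -> chi1 u = 0.
Proof.
by move=> b1 H; apply: (chi1_eq0 b1) => x /andP[bx _]; rewrite H // !ltNge bx andbF.
Qed.

Lemma supported_chi u : chi0 u = 0 -> chi1 u = 0 ->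
  exists a b, [/\ 0 < a, b < 1 & supported u a b].
Proof.
have [k [e [e0 -> E]]] := chi0P u; have [l [d [d0 -> D]]] := chi1P u.
move=> /eqP; rewrite intr_eq0 => /eqP k0 /eqP; rewrite intr_eq0 => /eqP l0.
exists e, (1 - d); split=> //; first by rewrite gtrDl oppr_lt0.
move=> x; rewrite negb_and -!leNgt => nx.
have [x0|x0] := leP x 0; first by rewrite thompson_out // ltNge x0.
have [x1|x1] := leP 1 x; first by rewrite thompson_out // !ltNge x1 andbF.
case/orP: nx => H; first by rewrite E ?(ltW x0) // k0 expr0z mul1r.
by rewrite D ?H ?(ltW x1) // l0 expr0z mul1r subrK.
Qed.

Lemma chi0_1 : chi0 (1%g : thompson_group R) = 0.
Proof. by apply: (addrI (chi0 1%g)); rewrite -chi0M mulg1 addr0. Qed.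

Lemma chi1_1 : chi1 (1%g : thompson_group R) = 0.
Proof. by apply: (addrI (chi1 1%g)); rewrite -chi1M mulg1 addr0. Qed.

Lemma chi0V u : chi0 u^-1%g = - chi0 u.
Proof. by apply: (addrI (chi0 u)); rewrite -chi0M mulgV chi0_1 subrr. Qed.

Lemma chi1V u : chi1 u^-1%g = - chi1 u.
Proof. by apply: (addrI (chi1 u)); rewrite -chi1M mulgV chi1_1 subrr. Qed.

Lemma chi0X u n : chi0 (u ^+ n)%g = chi0 u *+ n.
Proof. by elim: n => [|n IH]; rewrite ?chi0_1 // expgS chi0M IH mulrS. Qed.

Lemma chi1X u n : chi1 (u ^+ n)%g = chi1 u *+ n.
Proof. by elim: n => [|n IH]; rewrite ?chi1_1 // expgS chi1M IH mulrS. Qed.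

Lemma chi0_bump0 h : bump_valid 0 h -> chi0 (dyadic_bump 0 h) = -1.
Proof.
move=> V; have h0 : 0 < h by case: V.
rewrite (@chi0E _ (-1) (2 * h)) ?mulr_gt0 // => x xh.
have [_ E _ _] := bump_funP 0 h0.
by rewrite bump_val // E ?add0r // subr0 exprN1 mulrC.
Qed.

Lemma chi1_bump1 c h : bump_valid c h -> c + 4 * h = 1 -> chi1 (dyadic_bump c h) = 1.
Proof.
move=> V c1; have h0 : 0 < h by case: V.
rewrite (@chi1E _ 1 h) // => x xh.
have [_ _ _ E] := bump_funP c h0.
by rewrite bump_val // E ?expr1z; [|move/andP: xh => []]; lra.
Qed.

End Bumps.

(** * Moving points and intervals *)

Section Moving.
Variable R : realType.
Implicit Types (u v w : thompson_group R) (a b c h x y z : R).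

Lemma exp2_small e k0 : 0 < e -> exists2 k, (k0 <= k)%N & 1 / 2 ^+ k < e :> R.
Proof.
move=> e0; pose k := (Num.truncn e^-1).+1.
have H : e^-1 < 2 ^+ k.
  apply: lt_le_trans (truncnS_gt _) _.
  by rewrite -natrX ler_nat ltnW //; exact: ltn_expl.
exists (k0 + k)%N; first exact: leq_addr.
rewrite ltr_pdivrMr ?exprn_gt0 // mulrC -ltr_pdivrMr // div1r.
apply: lt_le_trans H _; rewrite exprD ler_peMl ?exprn_ge0 //.
by rewrite exprn_ege1 // ler1n.
Qed.

Lemma dyadic_exp2 k : dyadic (1 / 2 ^+ k : R).
Proof. exact/dyadic_div/dyadic1. Qed.

Lemma bump_between a b : dyadic a -> dyadic b -> 0 <= a -> a < b -> b <= 1 ->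
  bump_valid a ((b - a) / 4) /\ a + 4 * ((b - a) / 4) = b.
Proof.
move=> da db a0 ab b1; have -> : a + 4 * ((b - a) / 4) = b by field.
split=> //; split=> //; [|by lra|by have -> : a + 4 * ((b - a) / 4) = b by field].
have -> : (4 : R) = 2 ^+ 2 by rewrite -natrX.
exact/dyadic_div/dyadicB.
Qed.

Definition bump_on a b := dyadic_bump a ((b - a) / 4).

Lemma bump_push_right a b y z : dyadic a -> dyadic b -> 0 <= a -> b <= 1 ->
  a < y -> z < b -> exists n, z < val ((bump_on a b)^-1 ^+ n)%g y.
Proof.
move=> da db a0 b1 ay zb.
have [zy|yz] := ltP z y; first by exists 0%N.
have [V e4] := bump_between da db a0 (lt_le_trans ay (le_trans yz (ltW zb))) b1.
apply: thompson_push => x /andP[yx xz].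
rewrite -(thompson_lt (bump_on a b)) thompson_invVK.
by apply: bump_lt => //; rewrite e4 (lt_le_trans ay yx) (le_lt_trans xz zb).
Qed.

Lemma bump_push_left a b y z : dyadic a -> dyadic b -> 0 <= a -> b <= 1 ->
  a < y -> z < b -> exists n, val (bump_on a b ^+ n)%g z < y.
Proof.
move=> da db a0 b1 ay zb; have [n H] := bump_push_right da db a0 b1 ay zb.
exists n; move: H; rewrite -(thompson_lt (bump_on a b ^+ n)%g).
by rewrite expVgn thompson_invVK.
Qed.

Lemma supportedX u a b n : supported u a b -> supported (u ^+ n)%g a b.
Proof.
move=> H; elim: n => [|n IH]; first exact: supported1.
by rewrite expgS; exact: supportedM.
Qed.

(** A power [v] of one bump brings [b] to the left of [i]. A power [w] of an inverse bump then lifts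
    the image of [a] above [i]; its support ends at some f < j, so the image of [b] cannot pass
    f. *)
Lemma squeeze a b i j : 0 < a -> a < b -> b < 1 -> 0 < i -> i < j -> j < 1 ->
  exists u c d, [/\ 0 < c, d < 1, supported u c d, i < val u a & val u b < j].
Proof.
move=> a0 ab b1 i0 ij j1.
have [c dc /andP[c0]] : exists2 c, dyadic c & 0 < c < Num.min a i.
  by apply: dyadic_dense; rewrite lt_min a0.
rewrite lt_min => /andP[ca ci].
have [d dd /andP[]] : exists2 d, dyadic d & Num.max b j < d < 1.
  by apply: dyadic_dense; rewrite gt_max b1.
rewrite gt_max => /andP[bd jd] d1.
have [f df /andP[fi fj]] := dyadic_dense ij.
have cd := lt_trans ca (lt_trans ab bd).
have [n Hn] := bump_push_left dc dd (ltW c0) (ltW d1) ci bd.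
have [V e4] := bump_between dc dd (ltW c0) cd (ltW d1).
set v := (bump_on c d ^+ n)%g in Hn.
have Sv : supported v c d by apply: supportedX; rewrite -{2}e4; exact: bump_supported.
have va : c < val v a.
  by have := supported_itv a Sv; rewrite ca (lt_trans ab bd) => /andP[].
have [m Hm] := bump_push_right dc df (ltW c0) (ltW (lt_trans fj j1)) va fi.
have [V' e4'] := bump_between dc df (ltW c0) (lt_trans ci fi) (ltW (lt_trans fj j1)).
set w := (_ ^+ m)%g in Hm.
have Sw : supported w c f.
  by apply/supportedX/supportedV; rewrite -{2}e4'; exact: bump_supported.
exists (w * v)%g, c, d; split=> //.
  by apply: supportedM => //; apply: supportedW Sw => //; lra.
have /andP[_ wb] : c < val w (val v b) < f.
  rewrite (supported_itv _ Sw) (lt_trans va) ?thompson_lt //=.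
  exact: lt_trans fi.
exact: lt_trans fj.
Qed.

(** A bump is the translation by -h on its middle piece [c + 2h, c + 3h], so taking c = y - 3h moves
    [y] down by exactly [h]; this is repeated [n] times. *)
Lemma dyadic_transitive_down a b y h n : 0 <= a -> b <= 1 -> dyadic y ->
  dyadic h -> 0 < h -> a + 3 * h <= y - n%:R * h -> y + h <= b ->
  exists2 u, supported u a b & val u y = y - n%:R * h.
Proof.
move=> a0 b1 + dh h0; elim: n y => [|n IH] y dy ay yb.
  by exists 1%g; [exact: supported1|rewrite mul0r subr0].
have nh : 0 <= n%:R * h by rewrite mulr_ge0 // ltW.
have Sn : n.+1%:R = n%:R + 1 :> R by rewrite -natr1.
rewrite Sn mulrDl mul1r in ay *.
have [|||u Su uy] := IH (y - h).
- exact: dyadicB.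
- lra.
- lra.
have V : bump_valid (y - 3 * h) h.
  split=> //; [|lra|lra]; apply: dyadicB => //.
  by rewrite mulr_natl; exact: dyadic_mulrn.
have e4 : y - 3 * h + 4 * h = y + h by ring.
exists (u * dyadic_bump (y - 3 * h) h)%g.
  apply: supportedM => //; apply: supportedW (bump_supported V); lra.
have [_ _ E _] := bump_funP (y - 3 * h) h0.
rewrite -[LHS]/(val u (val (dyadic_bump (y - 3 * h) h) y)) bump_val // E.
  by rewrite uy; ring.
by apply/andP; split; lra.
Qed.

Lemma dyadic_transitive a b y z : 0 <= a -> b <= 1 -> dyadic y -> dyadic z ->
  a < y < b -> a < z < b -> exists2 u, supported u a b & val u y = z.
Proof.
move=> a0 b1; wlog zy : y z / z <= y.
  move=> H dy dz yab zab; have [/H|/ltW/H] := leP z y; first exact.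
  move=> [] // u /supportedV Su uz; exists u^-1%g => //.
  by rewrite -uz thompson_invK.
move=> dy dz /andP[ay yb] /andP[az zb].
have [m [k E]] : dyadic (y - z) by exact: dyadicB.
(* The step 1 / 2^l divides y - z and leaves room for three steps above [a] at the low end and one
   step below [b] at the high end. *)
have [l kl lt_e] : exists2 l, (k <= l)%N & 1 / 2 ^+ l < Num.min ((z - a) / 3) (b - y).
  by apply: exp2_small; rewrite lt_min; apply/andP; split; lra.
have h0 : 0 < 1 / 2 ^+ l :> R by rewrite divr_gt0 ?exprn_gt0.
move: lt_e; rewrite lt_min => /andP[l1 l2].
have m0 : 0 <= m.
  have : 0 <= (y - z) * 2 ^+ k by rewrite mulr_ge0 ?exprn_ge0 // subr_ge0.
  by rewrite E mulfVK ?expf_neq0 ?pnatr_eq0 // ler0z.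
case: m m0 E => // m _ E.
have zE : z = y - (m * 2 ^ (l - k))%:R * (1 / 2 ^+ l).
  rewrite natrM natrX -(subnK kl) exprD.
  have -> : z = y - (y - z) by ring.
  rewrite E addnK -pmulrn; field.
  by rewrite !expf_neq0 ?pnatr_eq0.
rewrite {1}zE; have := @dyadic_transitive_down a b y (1 / 2 ^+ l) (m * 2 ^ (l - k)).
rewrite -zE; apply=> //; [exact: dyadic_exp2|lra|lra].
Qed.

(* The factor [k], taken from one of the two subgroups, makes [k^-1 * u] fix a
   dyadic point between [d] and [b], where it can be cut. *)
Lemma supported_fragment u a b c d : 0 <= a -> a < d -> d < b -> b < c -> c <= 1 ->
  supported u a c -> exists k v w, [/\ supported k a b \/ supported k d c,
    supported v a b, supported w d c & u = (k * (v * w))%g].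
Proof.
move=> a0 ad db bc c1 Su.
have [y dy /andP[dy' yb]] := dyadic_dense db.
have /andP[auy uyc] : a < val u y < c.
  by rewrite (supported_itv y Su) (lt_trans ad dy') (lt_trans yb bc).
have duy := thompson_dyadic u dy.
have [k Sk ky] : exists2 k, supported k a b \/ supported k d c & val k y = val u y.
  have [uyb|buy] := ltP (val u y) b.
    have [||||||k Sk ky] := @dyadic_transitive a b y (val u y); rewrite ?auy //.
    - by rewrite (le_trans _ c1) // ltW.
    - by rewrite (lt_trans ad dy').
    by exists k => //; left.
  have [||||||k Sk ky] := @dyadic_transitive d c y (val u y); rewrite ?uyc ?andbT //.
  - by rewrite (le_trans a0) // ltW.
  - by rewrite dy' (lt_trans yb bc).
  - exact: lt_le_trans buy.
  by exists k => //; right.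
have Sku : supported (k^-1 * u)%g a c.
  apply: supportedM => //; apply: supportedV.
  by case: Sk => Sk; apply: supportedW Sk; lra.
have [|v [w [Sv Sw E]]] := supported_split dy Sku.
  by rewrite -[LHS]/(val k^-1%g (val u y)) -ky thompson_invK.
exists k, v, w; split=> //; last by rewrite -E mulVKg.
  by apply: supportedW Sv; lra.
by apply: supportedW Sw; lra.
Qed.

(** The right end a + 2h of the smaller support is fixed by the smaller bump, but the larger bump
    moves it to a + h, which the smaller one moves. *)
Lemma bump_noncommute a h : bump_valid a h ->
  bump_valid a (h / 2) /\ ~ commute (dyadic_bump a h) (dyadic_bump a (h / 2)).
Proof.
move=> V; have [da dh h0 a0 h1] := V.
have V2 : bump_valid a (h / 2).
  by split=> //; [exact: (dyadic_div 1)|lra|lra].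
split=> // /(congr1 (fun u : thompson_group R => val u (a + 2 * h))).
have [_ E _ _] := bump_funP a h0.
have e2 : a + 4 * (h / 2) = a + 2 * h by field.
rewrite -[LHS]/(val (dyadic_bump a h) (val (dyadic_bump a (h / 2)) (a + 2 * h))).
rewrite -[RHS]/(val (dyadic_bump a (h / 2)) (val (dyadic_bump a h) (a + 2 * h))).
rewrite (bump_supported V2) ?e2 ?ltxx ?andbF // bump_val // E; last first.
  by apply/andP; split; lra.
have -> : a + (a + 2 * h - a) / 2 = a + h by field.
have := @bump_lt R a (h / 2) (a + h) V2; rewrite e2 => H E'.
have : val (dyadic_bump a (h / 2)) (a + h) < a + h by apply: H; apply/andP; split; lra.
by rewrite -E' ltxx.
Qed.

End Moving.

(** * The case pq = 0 *)

Section InfinitelyGenerated.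
Variables (R : realType) (p q : int).
Local Notation N := (N_pq R p q).

Lemma N_pq_ex (u : thompson_group R) : chi_pq p q u = 0 -> exists n : N, val n = u.
Proof. by move=> /eqP u0; exists (exist _ u u0). Qed.

Lemma N_pqP (n : N) : chi_pq p q (val n) = 0.
Proof. exact/eqP/(valP n). Qed.

Lemma N_compact (u : thompson_group R) a b : 0 < a -> b < 1 -> supported u a b ->
  exists n : N, val n = u.
Proof.
move=> a0 b1 Su; apply: N_pq_ex.
by rewrite /chi_pq (chi0_supported a0 Su) (chi1_supported b1 Su) !mulr0 subrr.
Qed.

Lemma finite_common (T : choiceType) (A : set T) (P : T -> R -> Prop) :
  finite_set A -> (forall t d e, d <= e -> P t e -> P t d) ->
  (forall t, exists2 e, 0 < e & P t e) ->
  exists2 e, 0 < e & forall t, A t -> P t e.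
Proof.
move=> fA Pmono Pex; have [e eP] := choice (fun t => let: ex_intro2 e e0 Pe := Pex t in
  ex_intro (fun e => 0 < e /\ P t e) e (conj e0 Pe)).
have [m [m0 mP]] : exists m, 0 < m /\ forall t, A t -> m <= e t.
  move/finite_seqP: fA => [s ->]; elim: s => [|t s [m [m0 IH]]]; first by exists 1.
  exists (Num.min (e t) m); rewrite lt_min (eP t).1 m0; split=> // r /=.
  rewrite inE ge_min => /orP[/eqP->|/IH->]; by rewrite ?lexx ?orbT.
by exists m => // t /mP mt; exact: Pmono mt (eP t).2.
Qed.

Lemma generated_sub (G : groupType) (A S : set G) :
  subgroup S -> A `<=` S -> generated A `<=` S.
Proof. by move=> sS AS x; apply; split. Qed.

Lemma N_infinitely_generated0 : p != 0 -> q = 0 -> infinitely_generated N.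
Proof.
move=> p0 q0 [A [fA genA]].
have [||e e0 eP] := @finite_common _ A
    (fun n e => forall x, x <= e -> val (val n) x = x) fA.
- by move=> n d e de H x xd; apply: H; exact: le_trans de.
- move=> n; have : chi0 (val n) = 0.
    have := N_pqP n; rewrite /chi_pq; move: (chi0 _) (chi1 _) => x y.
    by rewrite q0 mul0r subr0 => /eqP; rewrite mulf_eq0 intr_eq0 (negbTE p0) => /eqP.
  have [k [e [e0 -> E]]] := chi0P (val n) => /eqP; rewrite intr_eq0 => /eqP k0.
  exists e => // x xe; have [x0|x0] := leP x 0.
    by rewrite thompson_out // ltNge x0.
  by rewrite E ?xe ?ltW // k0 expr0z mul1r.
have sub : @setT N `<=` [set n : N | forall x, x <= e -> val (val n) x = x].
  rewrite -genA; apply: generated_sub => //; split=> // n m nP mP x xe.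
  rewrite -[LHS]/(val (val n) (val (val m)^-1%g x)) -{1}(mP x xe) thompson_invK.
  exact: nP.
(* A bump supported in (a, b) with 0 < a < b < e is trivial near 0, hence in the kernel as q = 0,
   but it moves points below [e]. *)
have [a da] : exists2 a, dyadic a & 0 < a < Num.min e (1 / 2).
  by apply: dyadic_dense; rewrite lt_min e0; lra.
rewrite lt_min => /and3P[a0 ae a2].
have [b db /andP[ab]] : exists2 b, dyadic b & a < b < Num.min e (1 / 2).
  by apply: dyadic_dense; rewrite lt_min ae.
rewrite lt_min => /andP[be b2].
have [|V e4] := bump_between da db (ltW a0) ab; first by lra.
have [|n nE] := @N_pq_ex (bump_on a b).
  by rewrite /chi_pq (chi0_supported a0 (bump_supported V)) q0 mul0r mulr0 subrr.
have m1 : a < (a + b) / 2 < a + 4 * ((b - a) / 4).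
  by rewrite e4; apply/andP; split; lra.
have := bump_lt V m1; rewrite -[dyadic_bump _ _]/(bump_on a b) -nE (sub n I) ?ltxx //; lra.
Qed.

Lemma N_infinitely_generated1 : p = 0 -> q != 0 -> infinitely_generated N.
Proof.
move=> p0 q0 [A [fA genA]].
have [||e e0 eP] := @finite_common _ A
    (fun n e => forall x, 1 - e <= x -> val (val n) x = x) fA.
- by move=> n d e de H x xd; apply: H; lra.
- move=> n; have : chi1 (val n) = 0.
    have := N_pqP n; rewrite /chi_pq; move: (chi0 _) (chi1 _) => x y.
    rewrite p0 mul0r add0r => /eqP.
    by rewrite oppr_eq0 mulf_eq0 intr_eq0 (negbTE q0) => /eqP.
  have [k [e [e0 -> E]]] := chi1P (val n) => /eqP; rewrite intr_eq0 => /eqP k0.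
  exists e => // x xe; have [x1|x1] := leP 1 x.
    by rewrite thompson_out // !ltNge x1 andbF.
  by rewrite E ?xe ?ltW // k0 expr0z mul1r subrK.
have sub : @setT N `<=` [set n : N | forall x, 1 - e <= x -> val (val n) x = x].
  rewrite -genA; apply: generated_sub => //; split=> // n m nP mP x xe.
  rewrite -[LHS]/(val (val n) (val (val m)^-1%g x)) -{1}(mP x xe) thompson_invK.
  exact: nP.
have [a da] : exists2 a, dyadic a & Num.max (1 - e) (1 / 2) < a < 1.
  by apply: dyadic_dense; rewrite gt_max; apply/andP; split; lra.
rewrite gt_max -andbA => /and3P[ae a2 a1].
have [b db /andP[ab b1]] := dyadic_dense a1.
have [||V e4] := bump_between da db _ ab; [lra..|].
have [|n nE] := @N_pq_ex (bump_on a b).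
  have S := bump_supported V; rewrite e4 in S.
  by rewrite /chi_pq (chi1_supported b1 S) p0 mul0r mulr0 subrr.
have m1 : a < (a + b) / 2 < a + 4 * ((b - a) / 4).
  by rewrite e4; apply/andP; split; lra.
have := bump_lt V m1; rewrite -[dyadic_bump _ _]/(bump_on a b) -nE (sub n I) ?ltxx //; lra.
Qed.

End InfinitelyGenerated.

Arguments N_compact {R} p q {u a b}.

(** * Free groups, quotients and presentations *)

Section Homs.
Local Open Scope group_scope.
Variables (G H : groupType) (f : {multiplicative G -> H}).

Lemma hom1 : f 1 = 1.
Proof. by apply: (mulgI (f 1)); rewrite -gmulfM !mulg1. Qed.

Lemma homV x : f x^-1 = (f x)^-1.
Proof. by apply: (mulgI (f x)); rewrite -gmulfM !mulgV hom1. Qed.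

Lemma homX x n : f (x ^+ n) = f x ^+ n.
Proof. by elim: n => [|n IH]; rewrite ?hom1 // !expgS gmulfM IH. Qed.

Lemma homJ x y : f (x ^ y) = f x ^ f y.
Proof. by rewrite !conjgE !gmulfM homV. Qed.

Lemma homR x y : f [~ x, y] = [~ f x, f y].
Proof. by rewrite !commgEl gmulfM homV homJ. Qed.

End Homs.

Section FreeEvaluation.
Local Open Scope group_scope.
Variables (m : nat) (G : groupType) (e : 'I_m -> G).
Implicit Types (x y : free_group m).

Definition letter_eval (a : 'I_m * bool) : G := if a.2 then (e a.1)^-1 else e a.1.

Definition word_eval (w : seq ('I_m * bool)) : G :=
  foldr (fun a g => letter_eval a * g) 1 w.

Lemma word_eval_push a w : word_eval (push a w) = letter_eval a * word_eval w.
Proof.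
case: w => [//|b w] /=; case: eqP => [->|//].
rewrite mulgA; suff -> : letter_eval a * letter_eval (letter_inv a) = 1.
  by rewrite mul1g.
by case: a => i [] /=; rewrite /letter_eval /= ?mulVg ?mulgV.
Qed.

Definition free_eval x : G := word_eval (val x).

Fact free_evalM : {morph free_eval : x y / x * y}.
Proof.
move=> [u ru] [v rv]; rewrite /free_eval /= {ru}.
elim: u => [|a u IH] /=; first by rewrite mul1g.
by rewrite word_eval_push IH mulgA.
Qed.

HB.instance Definition _ := isMultiplicative.Build (free_group m) G free_eval free_evalM.

Definition free_gen (i : 'I_m) : free_group m := exist _ [:: (i, false)] isT.

Lemma free_eval_gen i : free_eval (free_gen i) = e i.
Proof. exact: mulg1. Qed.

Lemma free_ind (P : free_group m -> Prop) : P 1 ->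
  (forall i x, P x -> P (free_gen i * x)) ->
  (forall i x, P x -> P ((free_gen i)^-1 * x)) -> forall x, P x.
Proof.
move=> P1 Pp Pn [w]; elim: w => [rw|a w IH rw].
  by have -> : (exist _ [::] rw : free_group m) = 1 by exact: val_inj.
have rw' : reduced w by exact: path_sorted rw.
have pw : push a w = a :: w.
  by case: w {IH} rw {rw'} => //= b w /andP[/negbTE->].
case: a rw pw => i b rw pw; have := IH rw'.
pose w' : free_group m := exist _ w rw'.
have [->|->] : (exist _ ((i, b) :: w) rw : free_group m) = free_gen i * w' \/
    (exist _ ((i, b) :: w) rw : free_group m) = (free_gen i)^-1 * w'.
- by case: b rw pw => rw pw; [right|left]; apply: val_inj; rewrite /= pw.
- exact: Pp.
- exact: Pn.
Qed.

End FreeEvaluation.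

Section Quotient.
Local Open Scope group_scope.
Variable G : groupType.

Lemma normal_closure_normal (A : set G) : normal_subgroup (normal_closure A).
Proof.
split; first split.
- by move=> S [[[]]].
- by move=> x y Kx Ky S nS; case: (nS) => [[[_ nM] _] _]; apply: nM; [exact: Kx|exact: Ky].
- by move=> x y Kx S nS; case: (nS) => [[_ nJ] _]; apply: nJ; exact: Kx.
Qed.

Lemma normal_closure_sub (A : set G) : A `<=` normal_closure A.
Proof. by move=> x Ax S [_]; exact. Qed.

Variables (K : set G) (nK : normal_subgroup K).

Let K1 : K 1. Proof. by case: nK => [[]]. Qed.
Let KF x y : K x -> K y -> K (x / y). Proof. by case: nK => [[_ H] _]; exact: H. Qed.
Let KJ x y : K x -> K (x ^ y). Proof. by case: nK => [_]; exact. Qed.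
Let KV x : K x -> K x^-1. Proof. by move=> Kx; rewrite -div1g; exact: KF. Qed.
Let KM x y : K x -> K y -> K (x * y).
Proof. by move=> Kx Ky; rewrite -[y]invgK; apply/KF/KV. Qed.

Definition coset (x : G) : set G := [set y | K (x^-1 * y)].

Lemma coset_eqP x y : coset x = coset y <-> K (x^-1 * y).
Proof.
split=> [E|H]; first by rewrite -[K _]/(coset x y) E /coset /= mulVg.
apply/seteqP; split=> z; rewrite /coset /= => Hz.
  have := KM (KV H) Hz; rewrite invgM invgK.
  by rewrite mulgA mulgK.
by have := KM H Hz; rewrite mulgA mulgK.
Qed.

(** The normality proof is a parameter of the type so that the group structure, which depends on it,
    can be attached as an instance. *)
Definition quotient_by (h : normal_subgroup K) :=
  {C : set G | `[< exists x, C = coset x >]}.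

HB.instance Definition _ h := Choice.on (quotient_by h).

Let Q := quotient_by nK.

Definition quotient_pi (x : G) : Q :=
  exist _ (coset x) (asboolT (ex_intro _ x erefl)).

Lemma quotient_repr_ex (C : Q) : exists x, C = quotient_pi x.
Proof.
case: C => C hC; have /asboolP[x E] := hC.
by exists x; apply: val_inj.
Qed.

Definition quotient_repr (C : Q) : G := projT1 (cid (quotient_repr_ex C)).

Lemma quotient_reprK C : quotient_pi (quotient_repr C) = C.
Proof. by rewrite /quotient_repr; case: cid. Qed.

Lemma quotient_piP x y : quotient_pi x = quotient_pi y <-> K (x^-1 * y).
Proof.
rewrite -coset_eqP; split=> [/(congr1 val)//|E]; exact: val_inj.
Qed.

Definition quotient_one : Q := quotient_pi 1.
Definition quotient_mul (C D : Q) : Q := quotient_pi (quotient_repr C * quotient_repr D).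
Definition quotient_inv (C : Q) : Q := quotient_pi (quotient_repr C)^-1.

Lemma quotient_mulE x y : quotient_mul (quotient_pi x) (quotient_pi y) = quotient_pi (x * y).
Proof.
apply/quotient_piP.
have /quotient_piP Hx := quotient_reprK (quotient_pi x).
have /quotient_piP Hy := quotient_reprK (quotient_pi y).
move: (quotient_repr _) Hx (quotient_repr _) Hy => x' Hx y' Hy.
have -> : (x' * y')^-1 * (x * y) = (x'^-1 * x) ^ y' * (y'^-1 * y).
  by rewrite conjgE invgM !mulgA mulgK.
by apply: KM Hy; exact: KJ.
Qed.

Lemma quotient_invE x : quotient_inv (quotient_pi x) = quotient_pi x^-1.
Proof.
apply/quotient_piP; have /quotient_piP Hx := quotient_reprK (quotient_pi x).
move: (quotient_repr _) Hx => x' Hx; rewrite invgK.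
have -> : x' * x^-1 = ((x'^-1 * x)^-1) ^ x'^-1.
  by rewrite conjgE invgM !invgK !mulgA mulgK.
exact/KJ/KV.
Qed.

Fact quotient_mulA : associative quotient_mul.
Proof.
move=> C D E; rewrite -(quotient_reprK C) -(quotient_reprK D) -(quotient_reprK E).
by rewrite !quotient_mulE mulgA.
Qed.

Fact quotient_mul1g : left_id quotient_one quotient_mul.
Proof. by move=> C; rewrite -(quotient_reprK C) quotient_mulE mul1g. Qed.

Fact quotient_mulg1 : right_id quotient_one quotient_mul.
Proof. by move=> C; rewrite -(quotient_reprK C) quotient_mulE mulg1. Qed.

Fact quotient_mulVg : left_inverse quotient_one quotient_inv quotient_mul.
Proof.
by move=> C; rewrite -(quotient_reprK C) quotient_invE quotient_mulE mulVg.
Qed.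

Fact quotient_mulgV : right_inverse quotient_one quotient_inv quotient_mul.
Proof.
by move=> C; rewrite -(quotient_reprK C) quotient_invE quotient_mulE mulgV.
Qed.

HB.instance Definition _ := isGroup.Build (quotient_by nK)
  quotient_mulA quotient_mul1g quotient_mulg1 quotient_mulVg quotient_mulgV.

HB.instance Definition _ := isMultiplicative.Build G (quotient_by nK) quotient_pi
  (fun x y => esym (quotient_mulE x y)).

Lemma quotient_hom : exists (E : groupType) (f : {multiplicative G -> E}),
  epimorphism f /\ hom_kernel f = K.
Proof.
exists (quotient_by nK), quotient_pi; split.
  by move=> C; exists (quotient_repr C); exact: quotient_reprK.
apply/seteqP; split=> x /=.
  rewrite /hom_kernel /= => /esym/quotient_piP.
  by rewrite invg1 mul1g.
by move=> Kx; apply/esym/quotient_piP; rewrite invg1 mul1g.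
Qed.

End Quotient.

Section Presentations.
Local Open Scope group_scope.
Variable G : groupType.

Lemma hom_factor (F E : groupType) (phi : {multiplicative F -> G})
    (f : {multiplicative F -> E}) : epimorphism f ->
  hom_kernel f `<=` hom_kernel phi ->
  exists g : {multiplicative E -> G}, forall x, g (f x) = phi x.
Proof.
move=> ef kf; have [h hK] := choice ef.
have gf x : phi (h (f x)) = phi x.
  apply: divg1_eq; rewrite -homV -gmulfM; apply: kf.
  by rewrite /hom_kernel /= gmulfM homV hK mulgV.
have gM : {morph phi \o h : y z / y * z}.
  by move=> y z /=; rewrite -gmulfM -[RHS]gf gmulfM !hK.
pose gm := isMultiplicative.Build E G (phi \o h) gM.
by exists (HB.pack_for {multiplicative E -> G} (phi \o h) gm).
Qed.

(* In the proof [E] is the group presented by [A]; the last hypothesis says that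
   the map [g] which it induces is injective. *)
Lemma finitely_presentableP m (phi : {multiplicative free_group m -> G})
    (A : set (free_group m)) :
  epimorphism phi -> finite_set A -> A `<=` hom_kernel phi ->
  (forall (E : groupType) (f : {multiplicative free_group m -> E})
     (g : {multiplicative E -> G}), A `<=` hom_kernel f ->
     (forall x, g (f x) = phi x) -> forall x, phi x = 1 -> f x = 1) ->
  finitely_presentable G.
Proof.
move=> epi fA Aphi H; exists m, phi, A; split=> //.
have [E [f [ef kf]]] := quotient_hom (normal_closure_normal A).
have Nphi : normal_closure A `<=` hom_kernel phi.
  by move=> x; apply; split => //; exact: kernel_normal.
have [|g gf] := hom_factor ef (phi := phi); first by rewrite kf.
apply/seteqP; split=> // x; rewrite -kf; apply: (H E f g) => //.
by rewrite kf; exact: normal_closure_sub.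
Qed.

(* A presentation together with the requirement that one element survives is an
   open condition that isolates the kernel. *)
Lemma isolated_groupP (w : G) : w <> 1 ->
  (forall M : set G, normal_subgroup M -> (exists2 x, M x & x <> 1) -> M w) ->
  finitely_presentable G -> isolated_group G.
Proof.
move=> w1 H [m [phi [A [epi fA kA]]]]; have [x xw] := epi w.
exists m, phi; split => //.
  rewrite lt0n; apply/eqP => m0; case: w1; rewrite -xw.
  suff -> : x = 1 by exact: hom1.
  by elim/free_ind: x {xw} => // -[i i0]; exfalso; rewrite m0 in i0.
split; first by rewrite in_setT.
pose U := mg_basic (fset_set A, [fset x]%fset).
have phiU : U (marking phi).
  split=> /= [y|].
    by rewrite /= in_fset_set // inE kA; exact: normal_closure_sub.
  rewrite -subset0 => y /= []; rewrite /hom_kernel /= => y1.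
  by rewrite in_fset1 => /eqP yx; apply: w1; rewrite -xw -yx.
exists U.
  apply: open_nbhs_nbhs; split.
    by exists [set (fset_set A, [fset x]%fset)] => //; rewrite bigcup_set1.
  exact: phiU.
rewrite setIT; apply/seteqP; split => [[S nS] [/= AS Sx]|S ->//].
apply: val_inj => /=; have {}nS := asboolW nS.
have kS : hom_kernel phi `<=` S.
  by rewrite kA => y; apply; split=> // z Az; apply: AS; rewrite /= in_fset_set // inE.
apply/seteqP; split=> // y Sy; apply: contrapT => y1.
have Sx' : ~ S x.
  by move=> Sx'; rewrite -[False]/(set0 x) -Sx; split; rewrite //= in_fset1.
apply: Sx'; have [[S1 SF] SJ] := nS.
(* [S] contains the kernel and an element [y] outside it, so its image is a nontrivial normal
   subgroup and contains [w]. Then [x], which differs from [z] by an element of the kernel, lies in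
   [S], a contradiction. *)
have [||z Sz zw] := H [set phi z | z in S].
- split; first split; first by exists 1; [exact: S1|exact: hom1].
    by move=> _ _ [a Sa <-] [b Sb <-]; exists (a / b); [exact: SF|rewrite gmulfM homV].
  move=> _ b [a Sa <-]; have [c <-] := epi b.
  by exists (a ^ c); [exact: SJ|exact: homJ].
- by exists (phi y) => //; exists y.
have -> : x = (x / z) / z^-1 by rewrite invgK mulgVK.
apply: (SF); first by apply: kS; rewrite /hom_kernel /= gmulfM homV xw zw mulgV.
by rewrite -div1g; exact: SF.
Qed.

End Presentations.

(** * The forest presentation of Thompson's group *)

Section ForestGroups.
Local Open Scope group_scope.
Variable E : groupType.
Implicit Types (e : nat -> E) (s t : seq nat).

(* Thompson's infinite presentation, as satisfied by carets of binary forests. *)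
Definition forest_rel e := forall i j, (i < j)%N -> e j * e i = e i * e j.+1.

Definition forest_prod e s : E := foldr (fun i g => e i * g) 1 s.

(** Moving [e i] to the right past [e j] with j < i raises its index by one: e_i e_j = e_j e_(i+1).
    Insertion stops at the first index that is not smaller. *)
Fixpoint forest_insert i s : seq nat :=
  if s is j :: s' then
    if (j < i)%N then j :: forest_insert i.+1 s' else i :: s
  else [:: i].

Definition forest_sort s : seq nat := foldr forest_insert [::] s.

Lemma forest_insertE e i s : forest_rel e ->
  forest_prod e (forest_insert i s) = e i * forest_prod e s.
Proof.
move=> re; elim: s i => [//|j s IH] i /=; case: ifP => ji //=.
by rewrite IH !mulgA (re j i ji).
Qed.

Lemma forest_sortE e s : forest_rel e -> forest_prod e (forest_sort s) = forest_prod e s.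
Proof. by move=> re; elim: s => //= i s IH; rewrite forest_insertE // IH. Qed.

Lemma forest_insert_path k i s : path leq k s -> (k <= i)%N ->
  path leq k (forest_insert i s).
Proof.
elim: s k i => [|j s IH] k i /=; first by move=> _ ->.
move=> /andP[kj js] ki; case: ifP => ji /=; first by rewrite kj IH // ltnW // ltnW.
by rewrite ki js leqNgt ji.
Qed.

Lemma forest_sort_sorted s : sorted leq (forest_sort s).
Proof.
suff: path leq 0%N (forest_sort s) by exact: path_sorted.
by elim: s => //= i s IH; exact: forest_insert_path.
Qed.

(** An Ore condition: e_k^-1 e_i equals e_i e_(k+1)^-1 if i < k, e_(i+1) e_k^-1 if k < i, and 1 if i
    = k. So a negative letter can be moved to the right through a positive word, and fractions
    become closed under products. *)
Lemma forest_invM e k s : forest_rel e -> exists s' t,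
  (e k)^-1 * forest_prod e s = forest_prod e s' * (forest_prod e t)^-1.
Proof.
move=> re; elim: s k => [|i s IH] k /=.
  by exists [::], [:: k]; rewrite /= mul1g !mulg1.
have [ik|ki|->] := ltngtP i k.
- have [s' [t E1]] := IH k.+1; exists (i :: s'), t => /=.
  rewrite -mulgA -E1 !mulgA; congr (_ * _).
  by apply: (mulgI (e k)); apply: (mulIg (e k.+1)); rewrite !mulgA mulgV mul1g mulgVK (re i k ik).
- have [s' [t E1]] := IH k; exists (i.+1 :: s'), t => /=.
  rewrite -mulgA -E1 !mulgA; congr (_ * _).
  by apply: (mulgI (e k)); apply: (mulIg (e k)); rewrite !mulgA mulgV mul1g mulgVK (re k i ki).
- by exists s, [::]; rewrite mulKg invg1 mulg1.
Qed.

Lemma forest_fracV e s t : (forest_prod e s * (forest_prod e t)^-1)^-1 =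
  forest_prod e t * (forest_prod e s)^-1.
Proof. by rewrite invgM invgK. Qed.

Lemma forest_prod_cat e s t : forest_prod e (s ++ t) = forest_prod e s * forest_prod e t.
Proof. by elim: s => [|i s IH] /=; rewrite ?mul1g // IH mulgA. Qed.

Lemma forest_prod_invM e s t : forest_rel e -> exists s' t',
  (forest_prod e t)^-1 * forest_prod e s = forest_prod e s' * (forest_prod e t')^-1.
Proof.
move=> re; elim: t s => [|k t IH] s /=; first by exists s, [::]; rewrite invg1 mul1g mulg1.
rewrite invgM -mulgA; have [s1 [t1 ->]] := forest_invM k s re.
have [s2 [t2 E2]] := IH s1; rewrite mulgA E2.
exists s2, (t1 ++ t2); rewrite forest_prod_cat invgM mulgA //.
Qed.

Definition forest_frac e : E -> Prop := fun y =>
  exists s t, y = forest_prod e s * (forest_prod e t)^-1.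

Lemma forest_fracM e x y : forest_rel e ->
  forest_frac e x -> forest_frac e y -> forest_frac e (x * y).
Proof.
move=> re [s [t ->]] [s' [t' ->]].
have [s2 [t2 E2]] := forest_prod_invM s' t re.
exists (s ++ s2), (t' ++ t2); rewrite !forest_prod_cat invgM !mulgA.
by rewrite -(mulgA (forest_prod e s)) E2 !mulgA.
Qed.

Lemma forest_frac_inv e x : forest_frac e x -> forest_frac e x^-1.
Proof. by move=> [s [t ->]]; exists t, s; rewrite forest_fracV. Qed.

Lemma forest_frac_gen e i : forest_frac e (e i).
Proof. by exists [:: i], [::]; rewrite /= invg1 !mulg1. Qed.

Lemma forest_frac1 e : forest_frac e 1.
Proof. by exists [::], [::]; rewrite /= invg1 !mulg1. Qed.

(** The relations with i = 0 say that conjugation by x_0 shifts the indices from 1 on, so x_0 and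
    x_1 determine the family. *)
Definition forest_fam (x0 x1 : E) (n : nat) : E :=
  if n is k.+1 then x1 ^ (x0 ^+ k) else x0.

Lemma forest_famE e : forest_rel e -> forest_fam (e 0%N) (e 1%N) =1 e.
Proof.
move=> re; case=> // n /=; elim: n => [|n IH]; first by rewrite conjg1.
rewrite expgSr conjgM IH conjgE; apply: (mulgI (e 0%N)).
by rewrite mulVKg (re 0%N n.+1).
Qed.

(* Two relators suffice: conjugation by [x0] shifts the family, and [e_j] is
   obtained from [e_(j-1)] by conjugation with [e_2]. *)
Lemma forest_fam_rel x0 x1 (e := forest_fam x0 x1) :
  e 2%N ^ e 1%N = e 3%N -> e 3%N ^ e 1%N = e 4%N -> forest_rel e.
Proof.
move=> r3 r4.
have shift j n : e (j.+1 + n)%N = e j.+1 ^ (x0 ^+ n).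
  by rewrite /e /= -conjgM -expgnDr.
have r j : e j.+2 ^ e 1%N = e j.+3.
  elim/ltn_ind: j => -[|[|j]] IH; [exact: r3|exact: r4|].
  have R2 n : e (j.+2 + n)%N ^ e (1 + n)%N = e (j.+3 + n)%N.
    by rewrite !shift -conjJg -IH.
  have R21 : e j.+3 ^ e 2%N = e j.+4 by have := R2 1%N; rewrite !addnS !addn0.
  have R22 : e j.+4 ^ e 3%N = e j.+4.+1 by have := R2 2%N; rewrite !addnS !addn0.
  (* With e_(j+4) = e_(j+3)^(e_2), conjugation by e_1 gives (e_(j+3)^(e_1))^(e_3) = e_(j+4)^(e_3) =
     e_(j+5). The two preceding cases are used, which is why there are two base relations. *)
  by rewrite -{1}R21 conjJg r3 IH.
have rr i j : (i < j)%N -> e j ^ e i = e j.+1.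
  case: i => [|i]; case: j => // j.
    by move=> _; have := shift j 1%N; rewrite addnS addn0 expg1 => ->.
  rewrite ltnS => /subnKC <-; set d := (j - i.+1)%N.
  have -> : (i.+1 + d).+1 = (d.+1.+1 + i)%N by lia.
  rewrite (shift d.+1 i) (_ : i.+1 = (1 + i)%N) // (shift 0%N i) -conjJg.
  by rewrite (r d) -(shift d.+2 i).
by move=> i j /rr <-; rewrite conjgE mulVKg.
Qed.

End ForestGroups.

Section ForestGenerators.
Variables (R : realType) (a : R) (e : nat).
Local Notation L := (1 / 2 ^+ e : R).
Local Notation b := (a + L).
Hypotheses (da : dyadic a) (a0 : 0 <= a) (b1 : b <= 1).
Implicit Types (u v w : thompson_group R) (x y z : R).

(** Each cut bisects what is left of [a, b] on the right; the cuts are the ends of the leaves of the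
    right vine among binary trees. The length is a power of 2 so that bisections of [a, b] reach all
    its dyadic points. *)
Definition cut_gap i : R := L / 2 ^+ i.
Definition vcut i : R := b - cut_gap i.
Definition caret i : thompson_group R := bump_on (vcut i) b.

Lemma L_gt0 : 0 < L.
Proof. by rewrite divr_gt0 ?exprn_gt0. Qed.

Lemma cut_gap_gt0 i : 0 < cut_gap i.
Proof. by rewrite divr_gt0 ?exprn_gt0 ?L_gt0. Qed.

Lemma cut_gapS i : cut_gap i = 2 * cut_gap i.+1.
Proof. by rewrite /cut_gap [2 ^+ i.+1]exprS; field; rewrite !expf_neq0 ?pnatr_eq0. Qed.

Lemma cut0 : vcut 0 = a.
Proof. by rewrite /vcut /cut_gap expr0 divr1 addrK. Qed.

Lemma cut_lt i : vcut i < b.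
Proof. by rewrite /vcut gtrDl oppr_lt0 cut_gap_gt0. Qed.

Lemma cutS i : vcut i < vcut i.+1.
Proof. by rewrite /vcut; have := cut_gap_gt0 i.+1; rewrite (cut_gapS i); lra. Qed.

Lemma cut_le i j : (i <= j)%N -> vcut i <= vcut j.
Proof.
by move=> /subnKC <-; elim: (j - i)%N => [|n IH];
  rewrite ?addn0 // addnS (le_trans IH) // ltW // cutS.
Qed.

Lemma cut_lt_cut i j : (i < j)%N -> vcut i < vcut j.
Proof. by move=> ij; exact: lt_le_trans (cutS i) (cut_le ij). Qed.

Lemma cut_ge i : a <= vcut i.
Proof. by rewrite -cut0 cut_le. Qed.

Lemma dyadic_L : dyadic L. Proof. exact: dyadic_exp2. Qed.

Lemma dyadic_b : dyadic b. Proof. exact: dyadicD da dyadic_L. Qed.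

Lemma dyadic_cut i : dyadic (vcut i).
Proof. by apply/dyadicB/dyadic_div/dyadic_L; exact: dyadic_b. Qed.

Lemma caret_valid i : bump_valid (vcut i) ((b - vcut i) / 4).
Proof.
have [] // := bump_between (dyadic_cut i) dyadic_b _ (cut_lt i) b1.
exact: le_trans (cut_ge i).
Qed.

Lemma cutE i : [/\ vcut i + 4 * ((b - vcut i) / 4) = b,
   vcut i + 2 * ((b - vcut i) / 4) = vcut i.+1 &
   vcut i + 3 * ((b - vcut i) / 4) = vcut i.+2].
Proof. by rewrite /vcut (cut_gapS i) (cut_gapS i.+1); split; field. Qed.

Lemma caret_supported i : supported (caret i) (vcut i) b.
Proof. by have := bump_supported (caret_valid i); have [-> _ _] := cutE i. Qed.

Lemma caret_lt i x : vcut i < x < b -> val (caret i) x < x.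
Proof. by move=> H; apply: bump_lt (caret_valid i) _; have [-> _ _] := cutE i. Qed.

Lemma caret_le i x : val (caret i) x <= x.
Proof. exact: bump_le (caret_valid i). Qed.

Lemma caret_pieces i :
  [/\ forall x, vcut i <= x <= vcut i.+1 -> val (caret i) x = vcut i + (x - vcut i) / 2,
      forall x, vcut i.+1 <= x <= vcut i.+2 -> val (caret i) x = x - cut_gap i.+2 &
      forall x, vcut i.+2 <= x <= b -> val (caret i) x = 2 * x - b].
Proof.
have h0 : 0 < (b - vcut i) / 4 by case: (caret_valid i).
have := bump_funP (vcut i) h0; have [-> -> ->] := cutE i => -[_ E2 E3 E4].
have vE : val (caret i) = bump_fun (vcut i) ((b - vcut i) / 4).
  exact: bump_val (caret_valid i).
split=> x xi; rewrite vE; [exact: E2|rewrite E3 //|exact: E4].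
by rewrite /vcut (cut_gapS i) (cut_gapS i.+1); field.
Qed.

(** To the right of the cut i + 2, [caret i] is the dilation by 2 about [b]. For i < j it therefore
    maps [vcut (j+1), b] affinely onto [vcut j, b], and [bumpJ] applies with m = 2. *)
Lemma caret_rel : forest_rel caret.
Proof.
move=> i j ij; have [_ _ E] := caret_pieces i.
have h : (b - vcut j) / 4 = 2 * ((b - vcut j.+1) / 4).
  by rewrite /vcut (cut_gapS j); field.
rewrite [caret j]/(dyadic_bump _ _) h; apply/esym/bumpJ => //.
- exact: caret_valid.
- by rewrite -h; exact: caret_valid.
have [-> _ _] := cutE j.+1 => x /andP[jx xb]; rewrite E.
  by rewrite /vcut (cut_gapS j); ring.
by rewrite xb andbT (le_trans _ jx) // cut_le.
Qed.

Local Notation P := (forest_prod caret).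

Lemma forest_caret_le s x : val (P s) x <= x.
Proof.
elim: s => [|i s IH] //=.
by rewrite (le_trans _ IH) // -[X in X <= _]/(val (caret i) (val (P s) x)) caret_le.
Qed.

Lemma forest_caret_supported s : supported (P s) a b.
Proof.
elim: s => [|i s IH] /=; first exact: supported1.
apply: supportedM => //.
apply: (supportedW _ _ (@caret_supported i)) => //.
exact: cut_ge.
Qed.

Lemma forest_caret_fix s k x : path leq k s -> x <= vcut k -> val (P s) x = x.
Proof.
elim: s k => [//|i s IH] k /= /andP[ki ps] xk.
have xi : x <= vcut i by rewrite (le_trans xk) // cut_le.
rewrite -[LHS]/(val (caret i) (val (P s) x)) (IH i) // caret_supported //.
by rewrite ltNge xi.
Qed.

(** The first index of a sorted product is visible in the action: the product fixes everything up to
    the cut [i] and moves all points of (vcut i, b) strictly to the left. Cancelling the first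
    factor gives an induction. *)
Lemma forest_caret_inj s t : sorted leq s -> sorted leq t -> P s = P t -> s = t.
Proof.
have mv i s' x : vcut i < x < b -> val (P (i :: s')) x < x.
  move=> /caret_lt; apply: le_lt_trans.
  rewrite -[X in X <= _]/(val (caret i) (val (P s') x)) thompson_le.
  exact: forest_caret_le.
have mid i : vcut i < vcut i.+1 < b by rewrite cutS cut_lt.
have aux i j s' t' : path leq j t' -> P (i :: s') = P (j :: t') -> (j <= i)%N.
  move=> pt E; rewrite leqNgt; apply/negP => ij.
  have : val (P (i :: s')) (vcut j) < vcut j by apply: mv; rewrite cut_lt_cut // cut_lt.
  by rewrite E (@forest_caret_fix _ j) ?ltxx //= leqnn.
elim: s t => [|i s IH] [|j t] // ss st E.
- by have := mv j t _ (mid j); rewrite -E ltxx.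
- by have := mv i s _ (mid i); rewrite E ltxx.
have ij : i = j by apply/eqP; rewrite eqn_leq (aux _ _ _ _ _ E) ?(aux _ _ _ _ _ (esym E)).
rewrite -ij in E *; congr (_ :: _); apply: IH; rewrite ?(path_sorted ss) ?(path_sorted st) //.
exact: mulgI E.
Qed.

End ForestGenerators.

(** * Standard dyadic subdivisions and generation by carets *)

Section AffinePieces.
Variable R : realType.
Implicit Types (g h : thompson_group R) (x y z : R).

Definition affmap g x0 x1 y0 y1 := forall x, x0 <= x <= x1 ->
  val g x = y0 + (y1 - y0) / (x1 - x0) * (x - x0).

Lemma affmapP g x0 x1 y0 y1 c : x0 < x1 -> y1 - y0 = c * (x1 - x0) ->
  (forall x, x0 <= x <= x1 -> val g x = y0 + c * (x - x0)) -> affmap g x0 x1 y0 y1.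
Proof.
move=> x01 E H x /H ->; rewrite E mulfK // gt_eqF // subr_gt0 //.
Qed.

Lemma affmap_ends g x0 x1 y0 y1 : x0 < x1 -> affmap g x0 x1 y0 y1 ->
  val g x0 = y0 /\ val g x1 = y1.
Proof.
move=> x01 H; have x10 : x1 - x0 != 0 by rewrite gt_eqF // subr_gt0.
rewrite !H ?lexx ?(ltW x01) // subrr mulr0 addr0; split=> //.
by rewrite divfK // addrC subrK.
Qed.

Lemma affmap_comp g h x0 x1 y0 y1 z0 z1 : x0 < x1 ->
  affmap g x0 x1 y0 y1 -> affmap h y0 y1 z0 z1 -> affmap (h * g)%g x0 x1 z0 z1.
Proof.
move=> x01 Hg Hh x x_in; have [e0 e1] := affmap_ends x01 Hg.
have y01 : y0 < y1 by rewrite -e0 -e1 thompson_lt.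
have /andP[xx0 xx1] := x_in.
rewrite -[LHS]/(val h (val g x)) Hh; last by rewrite -e0 -e1 !thompson_le.
rewrite Hg //; field.
by rewrite !gt_eqF // subr_gt0.
Qed.

Lemma affmap_halves g x0 x1 y0 y1 : x0 < x1 -> affmap g x0 x1 y0 y1 ->
  affmap g x0 ((x0 + x1) / 2) y0 ((y0 + y1) / 2) /\
  affmap g ((x0 + x1) / 2) x1 ((y0 + y1) / 2) y1.
Proof.
move=> x01 H; have x10 : x1 - x0 != 0 by rewrite gt_eqF // subr_gt0.
split; apply: (@affmapP _ _ _ _ _ ((y1 - y0) / (x1 - x0))); [lra|by field| |lra|by field|].
  by move=> x /andP[? ?]; rewrite H //; apply/andP; split; lra.
by move=> x /andP[? ?]; rewrite H; [field|apply/andP; split; lra].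
Qed.

End AffinePieces.

Section ForestGeneration.
Variables (R : realType) (a : R) (e : nat).
Local Notation L := (1 / 2 ^+ e : R).
Local Notation b := (a + L).
Hypotheses (da : dyadic a) (a0 : 0 <= a) (b1 : b <= 1).
Implicit Types (u v w : thompson_group R) (x z : R) (y : nat -> R).
Local Notation vcut := (vcut a e).
Local Notation cut_gap := (cut_gap R e).
Local Notation caret := (caret a e).
Local Notation P := (forest_prod caret).

(* [vine k] subdivides [a, b] along its right end into k intervals; a forest
   product maps it piecewise affinely onto a prescribed subdivision. *)
Definition vine k i : R := if (i < k)%N then vcut i else b.

Definition vine_to u k y := forall j, (j < k)%N ->
  affmap u (vine k j) (vine k j.+1) (y j) (y j.+1).

Lemma vine_lt k j : (j < k)%N -> vine k j < vine k j.+1.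
Proof.
by rewrite /vine => ->; case: ifP => _; [exact: cutS|exact: cut_lt].
Qed.

Lemma cut_mid i : (vcut i + b) / 2 = vcut i.+1.
Proof. by rewrite /vcut (cut_gapS _ _ i); field. Qed.

Lemma caret_id i x x' : x < x' -> x' <= vcut i -> affmap (caret i) x x' x x'.
Proof.
move=> xx xi; apply: (@affmapP _ _ _ _ _ _ 1); rewrite ?mul1r // => z /andP[_ zx].
have -> : val (caret i) z = z.
  by apply: (@caret_supported _ a e); rewrite // ltNge (le_trans zx).
by rewrite mul1r addrC subrK.
Qed.

Lemma caret_left i :
  affmap (caret i) (vcut i) (vcut i.+1) (vcut i) ((vcut i + vcut i.+1) / 2).
Proof.
have [E _ _] := caret_pieces da a0 b1 i.
apply: (@affmapP _ _ _ _ _ _ (1 / 2)); [exact: cutS|by field|].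
by move=> x /E ->; field.
Qed.

Lemma caret_right i :
  affmap (caret i) (vcut i.+1) (vcut i.+2) ((vcut i + vcut i.+1) / 2) (vcut i.+1).
Proof.
have [_ E _] := caret_pieces da a0 b1 i.
apply: (@affmapP _ _ _ _ _ _ 1); first exact: cutS.
  by rewrite /vcut (cut_gapS _ _ i) (cut_gapS _ _ i.+1); field.
by move=> x /E ->; rewrite /vcut (cut_gapS _ _ i) (cut_gapS _ _ i.+1); field.
Qed.

Lemma caret_shift i j : (i < j)%N ->
  affmap (caret i) (vcut j.+1) (vcut j.+2) (vcut j) (vcut j.+1) /\
  affmap (caret i) (vcut j.+1) b (vcut j) b.
Proof.
move=> ij; have [_ _ E] := caret_pieces da a0 b1 i.
have H x : vcut j.+1 <= x <= b -> val (caret i) x = vcut j + 2 * (x - vcut j.+1).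
  move=> /andP[jx xb]; rewrite E ?xb ?andbT; last by rewrite (le_trans _ jx) // cut_le.
  by rewrite /vcut (cut_gapS _ _ j); ring.
split; apply: (@affmapP _ _ _ _ _ _ 2).
- exact: cutS.
- by rewrite /vcut (cut_gapS _ _ j) (cut_gapS _ _ j.+1); ring.
- by move=> x /andP[jx xj]; apply: H; rewrite jx (le_trans xj) // ltW // cut_lt.
- exact: cut_lt.
- by rewrite /vcut (cut_gapS _ _ j); ring.
- exact: H.
Qed.

(** Bisecting interval [i] of the target costs one caret: [caret i] maps intervals i and i + 1 of
    the longer vine to the two halves of interval i of the shorter one and shifts the later
    intervals back by one. Bisecting the last interval is free, since the vine itself does it. *)
Lemma vine_split u k y i : (i < k)%N ->
  vine_to u k (fun j => y (if (j <= i)%N then j else j.+1)) ->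
  y i.+1 = (y i + y i.+2) / 2 ->
  exists s, vine_to (u * P s)%g k.+1 y.
Proof.
move=> ik H mid.
have ci : affmap u (vcut i) (vine k i.+1) (y i) (y i.+2).
  by have := H i ik; rewrite /= leqnn ltnn /vine ik.
have lo j : (j < i)%N -> affmap u (vcut j) (vcut j.+1) (y j) (y j.+1).
  move=> ji; have jk := ltn_trans ji ik; have := H j jk.
  by rewrite /= (ltnW ji) ji /vine jk (leq_ltn_trans ji ik).
have [ik1|ki1] := ltnP i.+1 k; last first.
  have {ki1} ki : k = i.+1 by apply/eqP; rewrite eqn_leq ik andbT.
  exists [::] => /=; rewrite mulg1 => j; rewrite ki ltnS leq_eqVlt => /orP[/eqP->|].
    rewrite /vine ltnSn ltnn.
    move: ci; rewrite /vine ki ltnn => /(affmap_halves (cut_lt a e i))[_].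
    by rewrite cut_mid mid.
  rewrite ltnS leq_eqVlt => /orP[/eqP->|ji].
    rewrite /vine !ltnS leqnSn leqnn.
    move: ci; rewrite /vine ki ltnn => /(affmap_halves (cut_lt a e i))[+ _].
    by rewrite cut_mid mid.
  by rewrite /vine !ltnS (leqW (ltnW ji)) (ltnW ji); exact: lo.
exists [:: i] => /=; rewrite mulg1 => j; rewrite ltnS => jk.
have ci' : affmap u (vcut i) (vcut i.+1) (y i) (y i.+2) by move: ci; rewrite /vine ik1.
have [c1 c2] := affmap_halves (cutS a e i) ci'; rewrite -mid in c1 c2.
have [ji|ij|ji] := ltngtP j i.
- rewrite /vine !ltnS jk (ltn_trans ji ik); apply: affmap_comp (lo _ ji).
    exact: cutS.
  by apply: caret_id; [exact: cutS|exact: cut_le].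
- have [|ji1] := ltnP i.+1 j; last first.
    have -> : j = i.+1 by apply/eqP; rewrite eqn_leq ij ji1.
    rewrite /vine !ltnS (ltnW ik1) ik1; apply: affmap_comp c2; first exact: cutS.
    exact: caret_right.
  case: j jk ij => // j jk ij; rewrite ltnS => ij'.
  have [s1 s2] := caret_shift ij'.
  have := H j jk; rewrite /= (leqNgt j i) ij' (ltnNge j i) (ltnW ij') /= /vine jk !ltnS.
  case: ifP => jk' Hj; rewrite jk.
    by apply: affmap_comp s1 Hj; exact: cutS.
  by apply: affmap_comp s2 Hj; exact: cut_lt.
- rewrite ji /vine !ltnS (ltnW ik) ik; apply: affmap_comp c1; first exact: cutS.
  exact: caret_left.
Qed.

Definition std n m : R := a + L * m%:R / 2 ^+ n.

Definition std_part k y := [/\ y 0%N = a, y k = b &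
  forall i, (i < k)%N -> exists n m, y i = std n m /\ y i.+1 = std n m.+1].

Lemma std_eq D n m n' m' : (n <= D)%N -> (n' <= D)%N -> std n m = std n' m' ->
  (m * 2 ^ (D - n) = m' * 2 ^ (D - n'))%N.
Proof.
move=> nD nD' /addrI E; apply/eqP; rewrite -(eqr_nat R) !natrM !natrX.
have p k : 2 ^+ k != 0 :> R by rewrite expf_neq0 ?pnatr_eq0.
have F k j : (k <= D)%N -> j%:R * 2 ^+ (D - k) = L * j%:R / 2 ^+ k * (2 ^+ e * 2 ^+ D) :> R.
  move=> kD; rewrite -{2}(subnK kD) exprD; field; by rewrite !p.
by rewrite !F // E.
Qed.

Lemma std_0 n : std n 0 = a.
Proof. by rewrite /std mulr0 mul0r addr0. Qed.

Lemma std_1 : std 0 1 = b.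
Proof. by rewrite /std mulr1 expr0 divr1. Qed.

Lemma std_half n m : std n.+1 m.*2 = std n m.
Proof.
rewrite /std -mul2n natrM exprS; congr (_ + _); field.
by rewrite !expf_neq0 ?pnatr_eq0.
Qed.

Lemma std_mid n m : std n m.+1 = (std n m + std n m.+2) / 2.
Proof.
rewrite /std -!natr1; field.
by rewrite !expf_neq0 ?pnatr_eq0.
Qed.

(* The first interval of maximal depth is a left child, and it is followed by
   its sibling. *)
Lemma std_part_sibling k y : (1 < k)%N -> std_part k y ->
  exists i, [/\ (i.+1 < k)%N, y i.+1 = (y i + y i.+2) / 2 &
    exists n m, y i = std n m /\ y i.+2 = std n m.+1].
Proof.
move=> k1 [y0 yk H].
have /choice[f fP] : forall i, exists nm : nat * nat,
    (i < k)%N -> y i = std nm.1 nm.2 /\ y i.+1 = std nm.1 nm.2.+1.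
  move=> i; have [/H[n [m E]]|] := boolP (i < k)%N; first by exists (n, m).
  by exists (0, 0)%N.
pose n i := (f i).1; pose m i := (f i).2.
pose D := \max_(i < k) n i.
have nD i : (i < k)%N -> (n i <= D)%N.
  by move=> ik; exact: (@leq_bigmax _ (fun i : 'I_k => n i) (Ordinal ik)).
have step i : (i.+1 < k)%N -> (m i.+1 * 2 ^ (D - n i.+1) = (m i).+1 * 2 ^ (D - n i))%N.
  move=> ik; apply: std_eq; [exact: nD|exact/nD/ltnW|].
  by have [_ <-] := fP i (ltnW ik); have [<- _] := fP _ ik.
have k0 : (0 < k)%N by exact: ltnW.
have m0 : m 0%N = 0%N.
  have [E _] := fP 0%N k0; rewrite y0 -(std_0 D) in E.
  have := std_eq (leqnn D) (nD _ k0) E; rewrite mul0n => /esym/eqP.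
  by rewrite muln_eq0 expn_eq0 /= orbF => /eqP.
have last_ : (2 ^ D = (m k.-1).+1 * 2 ^ (D - n k.-1))%N.
  have kk : (k.-1 < k)%N by rewrite prednK.
  have [_ E] := fP _ kk; rewrite prednK // yk -std_1 in E.
  by have := std_eq (leq0n D) (nD _ kk) E; rewrite mul1n subn0.
(* If the maximal depth were 0, every interval would have the length of [a, b] and there would be
   only one. *)
have D0 : (0 < D)%N.
  rewrite lt0n; apply/eqP => D0.
  have mi i : (i < k)%N -> m i = i.
    elim: i => [//|i IH] ik; have := step _ ik.
    by rewrite D0 !sub0n !muln1 IH ?(ltnW ik).
  move: last_; rewrite D0 sub0n muln1 mi ?prednK // => E.
  by rewrite -E in k1.
have [i0 i0k ni0] : exists2 i, (i < k)%N & n i == D.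
  have [|i E] := bigop.eq_bigmax (fun i : 'I_k => n i); first by rewrite card_ord.
  by exists (nat_of_ord i); [exact: ltn_ord|rewrite /D E eqxx].
have ex : exists i, (i < k)%N && (n i == D) by exists i0; rewrite i0k.
case: (ex_minnP ex) => i /andP[ik /eqP niD] imin.
(* The previous interval is shallower, so its right end has an even numerator when written at depth
   [D]; if there is no previous interval, the numerator is 0. *)
have mi_even : ~~ odd (m i).
  case: i ik niD imin => [|i] ik niD imin; first by rewrite m0.
  have := step _ ik; rewrite niD subnn muln1 => ->.
  have : (n i < D)%N.
    rewrite ltn_neqAle nD ?(ltnW ik) // andbT; apply/negP => niD'.
    by have := imin i; rewrite (ltnW ik) niD' ltnn => /(_ isT).
  by rewrite -subn_gt0 => dn; rewrite oddM oddX (gtn_eqF dn) andbF.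
(* Interval [i] ends at an odd numerator at depth [D], whereas [b] has the even numerator 2^D. *)
have ik1 : (i.+1 < k)%N.
  rewrite ltn_neqAle ik andbT; apply/eqP => E.
  move: last_; rewrite -E /= niD subnn muln1 => /(congr1 odd).
  by rewrite oddX /= (negbTE mi_even) gtn_eqF.
have := step _ ik1; rewrite niD subnn muln1 => E.
(* The next interval starts at an odd numerator at depth [D], hence cannot be shallower. *)
have ni1 : n i.+1 = D.
  apply/eqP; rewrite eqn_leq nD //= leqNgt -subn_gt0; apply/negP => dn.
  have := congr1 odd E; rewrite oddM oddX /= (negbTE mi_even).
  by rewrite orbF (gtn_eqF dn) andbF.
move: E; rewrite ni1 subnn muln1 => mi1.
have [Ei Ei1] := fP _ ik; have [_ Ei2] := fP _ ik1.
rewrite -/(n i) -/(m i) niD in Ei Ei1; rewrite -/(n i.+1) -/(m i.+1) ni1 mi1 in Ei2.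
exists i; split => //; first by rewrite Ei Ei1 Ei2 std_mid.
exists D.-1, (m i)./2.
by rewrite -(std_half D.-1 (m i)./2) -(std_half D.-1 (m i)./2.+1) prednK // doubleS even_halfK.
Qed.

(** Merging the two siblings leaves a standard subdivision with one interval less, and [vine_split]
    puts the bisection back. *)
Lemma std_part_forest k y : (0 < k)%N -> std_part k y -> exists s, vine_to (P s) k y.
Proof.
elim: k y => [//|[|k] IH] y _ yP.
  have [y0 y1 _] := yP; exists [::] => -[|//] _.
  rewrite /vine /= y0 y1 (cut0 a e) => x _ /=.
  by rewrite [a + L]addrC addrK divff ?gt_eqF ?L_gt0 //; ring.
have [//|i [ik mid [n [m [E1 E2]]]]] := std_part_sibling _ yP.
have [||s Hs] := IH (fun j => y (if (j <= i)%N then j else j.+1)).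
- by [].
- have [y0 yk H] := yP; split=> //; first by rewrite leqNgt (ik : (i < k.+1)%N).
  move=> j jk; have [ji|ij|->] := ltngtP j i.
  + exact/H/ltnW.
  + exact: H.
  + by exists n, m.
have [t Ht] := @vine_split (P s) k.+1 y i ik Hs mid.
by exists (s ++ t); rewrite forest_prod_cat.
Qed.

Lemma dyadic_std x : dyadic x -> a <= x -> exists t, forall t', (t <= t')%N ->
  exists r, x = std t' r.
Proof.
move=> dx ax; have [z [t E]] : dyadic (2 ^+ e * (x - a)).
  exact/dyadicX/dyadicB.
have p k : 2 ^+ k != 0 :> R by rewrite expf_neq0 ?pnatr_eq0.
have z0 : 0 <= z.
  have : 0 <= 2 ^+ e * (x - a) * 2 ^+ t by rewrite !mulr_ge0 ?exprn_ge0 ?subr_ge0.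
  by rewrite E divfK // ler0z.
case: z z0 E => // z _ E; exists t => t' tt'; exists (z * 2 ^ (t' - t))%N.
have {E} -> : x = a + z%:R / 2 ^+ t / 2 ^+ e.
  by rewrite pmulrn -E mulrAC divff // mul1r addrC subrK.
rewrite /std natrM natrX -{2}(subnK tt') exprD; congr (_ + _); field.
by rewrite !p.
Qed.

Lemma std_lt n m m' : (std n m < std n m') = (m < m')%N.
Proof.
by rewrite /std ltrD2l ltr_pM2r ?invr_gt0 ?exprn_gt0 // ltr_pM2l ?L_gt0 // ltr_nat.
Qed.

Lemma stdS n m : std n m.+1 = std n m + L * (1 / 2 ^+ n).
Proof.
rewrite /std -natr1; field.
by rewrite !expf_neq0 ?pnatr_eq0.
Qed.

Definition std_affine u D i := exists n m,
  affmap u (std D i) (std D i.+1) (std n m) (std n m.+1).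

(** On a piece of slope 2^k, a subinterval of level D + t' has an image of length L / 2^n with n = D
    + t' - k. The image is standard once the dyadic point u (std D i) is a bisection point of level
    n, and this holds for all large t'. *)
Lemma std_affine_deep u D i k c : supported u a b ->
  (forall x, std D i <= x <= std D i.+1 -> val u x = 2 ^ k * x + c) ->
  exists t, forall t', (t <= t')%N -> forall j, (j %/ 2 ^ t' = i)%N ->
    std_affine u (D + t') j.
Proof.
move=> Su uE; have p l : 2 ^+ l != 0 :> R by rewrite expf_neq0 ?pnatr_eq0.
have std_ge n m : a <= std n m.
  by rewrite /std lerDl !mulr_ge0 ?invr_ge0 ?exprn_ge0 // ltW // L_gt0.
have [||t0 Ht0] := @dyadic_std (val u (std D i)).
- apply: thompson_dyadic; rewrite /std -mulrA; apply: dyadicD => //.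
  rewrite mulrC.
  by rewrite mulrA mulr1; exact/dyadic_div/dyadic_div/dyadic_nat.
- have [<-|] := eqVneq a (std D i); first by rewrite Su ?ltxx.
  move=> ne; have ua : val u a = a by rewrite Su ?ltxx.
  by rewrite -{1}ua thompson_le.
(* Adding |k| compensates the slope and guarantees n >= t0. *)
exists (t0 + `|k|)%N => t' tt' j ji.
have [n nt nE] : exists2 n, (t0 <= n)%N & 2 ^ k / 2 ^+ (D + t') = 1 / 2 ^+ n :> R.
  case: k tt' {uE} => k tt'.
    exists (D + t' - k)%N; first by rewrite /= in tt'; lia.
    rewrite /= in tt'; have -> : (D + t' = (D + t' - k) + k)%N by lia.
    by rewrite -exprnP addnK exprD; field; rewrite !p.
  exists (D + t' + k.+1)%N; first by rewrite /= in tt'; lia.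
  by rewrite NegzE -exprnN [in RHS]exprD; field; rewrite !p.
have [r uD] := Ht0 n nt.
have jE : (j = i * 2 ^ t' + j %% 2 ^ t')%N by rewrite -ji -divn_eq.
have jlt : (j %% 2 ^ t' < 2 ^ t')%N by rewrite ltn_pmod // expn_gt0.
set rho := (j %% 2 ^ t')%N in jE jlt.
have stdE q : std (D + t') (i * 2 ^ t' + q) = std D i + L * q%:R / 2 ^+ (D + t').
  by rewrite /std natrD natrM natrX exprD; field; rewrite !p.
have inD q : (q <= 2 ^ t')%N -> std D i <= std (D + t') (i * 2 ^ t' + q) <= std D i.+1.
  move=> q2; rewrite stdE lerDl !mulr_ge0 ?invr_ge0 ?exprn_ge0 ?ler0n //=.
  rewrite [std D i.+1](_ : _ = std D i + L / 2 ^+ D); last first.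
    by rewrite /std -natr1; field; rewrite !p.
  rewrite lerD2l -mulrA ler_pM2l ?L_gt0 // exprD invfM mulrCA ger_pMr ?invr_gt0 ?exprn_gt0 //.
  by rewrite ler_pdivrMr ?exprn_gt0 // mul1r -natrX ler_nat.
exists n, (r + rho)%N; rewrite jE.
apply: (@affmapP _ _ _ _ _ _ (2 ^ k)).
- by rewrite std_lt.
- by rewrite !stdS ![_ + L * _]addrC !addrK -nE; field; rewrite !p.
move=> x /andP[jx xj].
have xD : std D i <= x <= std D i.+1.
  have /andP[h1 _] := inD _ (ltnW jlt); have /andP[_ h2] := inD _ jlt.
  by rewrite (le_trans h1 jx) (le_trans xj) // -addnS.
have := uE _ xD => ->; have := uE (std D i); rewrite lexx ltW ?std_lt // => /(_ isT).
rewrite uD => E; rewrite stdE.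
have -> : std n (r + rho) = std n r + L * rho%:R * (1 / 2 ^+ n).
  by rewrite /std natrD; field; rewrite !p.
rewrite E -nE; field; by rewrite !p.
Qed.

Lemma vine_cover k x : (0 < k)%N -> a <= x <= b ->
  exists2 j, (j < k)%N & vine k j <= x <= vine k j.+1.
Proof.
move=> k0 /andP[ax xb].
have [kx|xk] := leP (vcut k.-1) x.
  by exists k.-1; rewrite ?prednK // /vine !prednK // ltnn leqnn kx.
have [j jk jx] : exists2 j, (j < k.-1)%N & vcut j <= x <= vcut j.+1.
  elim: (k.-1) xk => [|i IH]; first by rewrite (cut0 a e) ltNge ax.
  have [ix xi|/IH[j ji jx] _] := leP (vcut i) x; first by exists i; rewrite // ix ltW.
  by exists j => //; rewrite ltnW.
have jk1 : (j.+1 < k)%N by rewrite -(prednK k0) ltnS.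
by exists j; rewrite ?(ltnW jk1) // /vine jk1 (ltnW jk1).
Qed.

(** The tree pair description of F. At a sufficiently deep level [u] maps every standard interval
    affinely onto a standard interval. Products of carets map the vine onto the subdivision y of the
    domain and onto its image z, so [u] is the second product times the inverse of the first. *)
Lemma forest_generation u : supported u a b -> forest_frac caret u.
Proof.
move=> Su; have [s [ds PL]] := thompson_pieces (thompsonP u).
(* A level at which every break point from [a] on is a bisection point, so that [u] is affine on
   each interval of that level. *)
have [D HD] : exists D, forall x, x \in s -> a <= x -> exists r, x = std D r.
  suff [D HD] : exists D, forall D', (D <= D')%N -> forall x, x \in s -> a <= x -> exists r, x = std D' r.
    by exists D; exact: HD.
  elim: s ds {PL} => [|x s IH] ds; first by exists 0%N.
  have [|D1 H1] := IH; first by move=> z zs; apply: ds; rewrite inE zs orbT.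
  have [ax|xa] := leP a x; last first.
    exists D1 => D' D1' z; rewrite inE => /orP[/eqP->|]; last exact: H1.
    by rewrite leNgt xa.
  have [|D2 H2] := dyadic_std _ ax; first by apply: ds; rewrite inE eqxx.
  exists (D1 + D2)%N => D' DD z; rewrite inE => /orP[/eqP-> _|zs az].
    by apply: H2; rewrite (leq_trans _ DD) // leq_addl.
  by apply: H1 => //; rewrite (leq_trans _ DD) // leq_addr.
have stdb n : std n (2 ^ n) = b.
  by rewrite /std natrX mulfK // expf_neq0 ?pnatr_eq0.
have std_le n m m' : (m <= m')%N -> std n m <= std n m'.
  by move=> mm; rewrite leNgt std_lt -leqNgt.
have thr i : (i < 2 ^ D)%N -> exists t, forall t', (t <= t')%N ->
    forall j, (j %/ 2 ^ t' = i)%N -> std_affine u (D + t') j.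
  move=> iD; have [||||k [c E]] := PL (std D i) (std D i.+1).
  - by rewrite (le_trans a0) // -(std_0 D) std_le.
  - by rewrite std_lt.
  - by rewrite (le_trans _ b1) // -(stdb D) std_le.
  - move=> x xs; rewrite in_itv /=; apply/negP => /andP[ix xi].
    have ax : a <= x by rewrite (le_trans _ (ltW ix)) // -(std_0 D) std_le.
    have [r xr] := HD _ xs ax; move: ix xi; rewrite xr !std_lt ltnS => ir ri.
    by have := leq_trans ir ri; rewrite ltnn.
  by apply: (@std_affine_deep u D i k c) => // x xD; apply: E; rewrite in_itv.
have [t Ht] : exists t, forall i, (i < 2 ^ D)%N ->
    forall j, (j %/ 2 ^ t = i)%N -> std_affine u (D + t) j.
  suff [t Ht] : exists t, forall t', (t <= t')%N -> forall i, (i < 2 ^ D)%N ->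
    forall j, (j %/ 2 ^ t' = i)%N -> std_affine u (D + t') j by exists t; exact: Ht.
  elim: (2 ^ D)%N thr => [|M IH] thr; first by exists 0%N.
  have [|t1 H1] := IH; first by move=> i iM; apply: thr; exact: ltnW.
  have [t2 H2] := thr M (ltnSn M).
  exists (t1 + t2)%N => t' tt i; rewrite ltnS leq_eqVlt => /orP[/eqP->|iM].
    by apply: H2; rewrite (leq_trans _ tt) // leq_addl.
  by apply: H1 => //; rewrite (leq_trans _ tt) // leq_addr.
pose k := (2 ^ (D + t))%N; pose y i := std (D + t) i; pose z i := val u (y i).
have k0 : (0 < k)%N by rewrite expn_gt0.
have good j : (j < k)%N -> std_affine u (D + t) j.
  move=> jk; apply: (Ht (j %/ 2 ^ t)%N) => //.
  by rewrite ltn_divLR ?expn_gt0 // -expnD.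
have yP : std_part k y.
  by split=> [||i _]; [exact: std_0|exact: stdb|exists (D + t)%N, i].
have zP : std_part k z.
  split=> [||i ik]; rewrite /z /y.
  - by rewrite std_0 Su ?ltxx.
  - by rewrite stdb Su ?ltxx ?andbF.
  have [n [m H]] := good _ ik; exists n, m.
  by apply: affmap_ends H; rewrite std_lt.
have [sy Hy] := std_part_forest k0 yP; have [sz Hz] := std_part_forest k0 zP.
exists sz, sy; apply: (mulIg (P sy)); rewrite mulgVK; apply: thompson_ext => x.
have [xab|nx] := boolP (a <= x <= b); last first.
  have nx' : ~~ (a < x < b).
    by apply: contra nx => /andP[/ltW -> /ltW ->].
  rewrite -[LHS]/(val u (val (P sy) x)).
  by rewrite !(forest_caret_supported da a0 b1) // Su.
have [j jk jx] := vine_cover k0 xab.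
have [n [m H]] := good _ jk.
have zE : std n m = z j /\ std n m.+1 = z j.+1.
  have lt1 : y j < y j.+1 by rewrite /y std_lt.
  by have [] := affmap_ends lt1 H.
rewrite !zE.1 !zE.2 in H.
rewrite (affmap_comp (vine_lt jk) (Hy _ jk) H jx).
by rewrite (Hz _ jk _ jx).
Qed.

End ForestGeneration.

(** * The case pq > 0 *)

(** P and Q are |p| and |q| divided by the gcd. The lemma makes (Q, P) a generator of the pairs of
    values of the two characters on the kernel; for pq < 0 it is used with -q. *)
Lemma lattice_pos (p q : int) : 0 < p * q -> exists P Q : nat,
  [/\ (0 < P)%N, (0 < Q)%N &
   forall k l : int, p * k = q * l <-> exists n : int, k = Q%:Z * n /\ l = P%:Z * n].
Proof.
move=> pq; have p0 : p != 0 by apply: contraTneq pq => ->; rewrite mul0r ltxx.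
have q0 : q != 0 by apply: contraTneq pq => ->; rewrite mulr0 ltxx.
have [p1 pE] := dvdzP (dvdz_gcdl p q); have [q1 qE] := dvdzP (dvdz_gcdr p q).
set d := gcdz p q in pE qE.
have d0 : d != 0 by rewrite gcdz_eq0 negb_and p0.
have cop : coprimez p1 q1.
  rewrite /coprimez; apply/eqP; apply: (mulIf d0); rewrite mul1r.
  by have := mulz_gcdl p1 q1 d; rewrite -pE -qE.
have pq1 : 0 < p1 * q1.
  move: pq; rewrite pE qE mulrACA pmulr_lgt0 //.
  by rewrite lt_def mulf_neq0 // -expr2 sqr_ge0.
have [p10 q10] : p1 != 0 /\ q1 != 0.
  by split; apply: contraTneq pq1 => ->; rewrite ?mulr0 ?mul0r ltxx.
have sol k l : p * k = q * l <-> exists n, k = q1 * n /\ l = p1 * n.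
  split=> [|[n [-> ->]]]; last by rewrite pE qE; ring.
  rewrite pE qE => E; have {}E : p1 * k = q1 * l.
    by apply: (mulfI d0); rewrite !mulrA ![d * _]mulrC.
  have : (q1 %| p1 * k)%Z by rewrite E dvdz_mulr.
  rewrite Gauss_dvdzr; last by rewrite coprimez_sym.
  move=> /dvdzP[n kE]; exists n; rewrite kE mulrC; split=> //.
  by apply: (mulfI q10); rewrite -E kE; ring.
exists `|p1|%N, `|q1|%N; split; rewrite ?absz_gt0 // => k l.
(* As p and q have the same sign, one sign [s] passes from p1, q1 to their absolute values, and [n]
   absorbs it. *)
have [s pqE] : exists s : int, s * s = 1 /\ (p1 = s * `|p1|%N /\ q1 = s * `|q1|%N).
  have [p1p|p1n] := leP 0 p1.
    have q1p : 0 < q1 by move: pq1; rewrite pmulr_rgt0 // lt_def p10.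
    by exists 1; rewrite !mul1r !gez0_abs ?(ltW q1p).
  have q1n : q1 < 0 by move: pq1; rewrite nmulr_rgt0.
  by exists (-1); rewrite !mulN1r !ltz0_abs // !opprK.
have [ss [ps qs]] := pqE; rewrite sol.
move: (absz p1) (absz q1) ps qs => a b -> ->.
have E (c : nat) n : c%:Z * n = s * c%:Z * (s * n).
  by rewrite mulrACA ss mul1r.
by split=> -[n [-> ->]]; exists (s * n); rewrite -?E //; split; ring.
Qed.

Section Pushing.
Variable R : realType.
Implicit Types (u v w t : thompson_group R) (a b c x y z : R).

Definition pushes w a b := supported w a b /\ forall x, a < x < b -> x < val w x.

Lemma pushesX w a b n : (0 < n)%N -> pushes w a b -> pushes (w ^+ n)%g a b.
Proof.
move=> + [Sw Hw]; case: n => // n _; split; first exact: supportedX.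
move=> x xab; elim: n => [|n IH]; first exact: Hw.
rewrite expgS; apply: lt_trans (IH) _.
by apply: Hw; rewrite (supported_itv x (supportedX n.+1 Sw)).
Qed.

Lemma pushes_ge w a b x : pushes w a b -> x <= val w x.
Proof. by move=> [Sw Hw]; have [/Hw/ltW|/Sw->] := boolP (a < x < b). Qed.

Lemma pushes_bumpV c h : bump_valid c h -> pushes (dyadic_bump c h)^-1%g c (c + 4 * h).
Proof.
move=> V; have S := bump_supported V; split; first exact: supportedV.
move=> x xab; rewrite -(thompson_lt (dyadic_bump c h)) thompson_invVK.
exact: bump_lt.
Qed.

Lemma bump_validE c h (i j : int) n : 0 < h -> 0 <= c -> c + 4 * h <= 1 ->
  c = i%:~R / 2 ^+ n -> h = j%:~R / 2 ^+ n -> bump_valid c h.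
Proof. by move=> h0 c0 c1 cE hE; split=> //; [exists i, n|exists j, n]. Qed.

Definition bump_left : thompson_group R := dyadic_bump 0 (1 / 8).
Definition bump_right : thompson_group R := dyadic_bump (1 / 2) (1 / 8).

Lemma bump_left_valid : bump_valid (0 : R) (1 / 8).
Proof. by apply: (@bump_validE _ _ 0 1 3); rewrite ?mul0r //; [lra..|rewrite -natrX]. Qed.

Lemma bump_right_valid : bump_valid (1 / 2 : R) (1 / 8).
Proof.
by apply: (@bump_validE _ _ 4 1 3); rewrite -?natrX //; lra.
Qed.

Lemma bump_left_end : 0 + 4 * (1 / 8) = 1 / 2 :> R. Proof. by lra. Qed.
Lemma bump_right_end : 1 / 2 + 4 * (1 / 8) = 1 :> R. Proof. by lra. Qed.

Lemma chi_bump_left : chi0 bump_left = -1 /\ chi1 bump_left = 0.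
Proof.
split; first exact: chi0_bump0 bump_left_valid.
by apply: (chi1_supported _ (bump_supported bump_left_valid)); lra.
Qed.

Lemma chi_bump_right : chi0 bump_right = 0 /\ chi1 bump_right = 1.
Proof.
split; last exact: chi1_bump1 bump_right_valid bump_right_end.
by apply: (chi0_supported _ (bump_supported bump_right_valid)); lra.
Qed.

Lemma pushes_left n : (0 < n)%N -> pushes (bump_left^-1 ^+ n)%g 0 (1 / 2).
Proof.
by move=> n0; apply: pushesX => //; have := pushes_bumpV bump_left_valid; rewrite bump_left_end.
Qed.

Lemma pushes_right n : (0 < n)%N -> pushes (bump_right^-1 ^+ n)%g (1 / 2) 1.
Proof.
by move=> n0; apply: pushesX => //; have := pushes_bumpV bump_right_valid; rewrite bump_right_end.
Qed.

Variables P Q : nat.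
Hypotheses (P0 : (0 < P)%N) (Q0 : (0 < Q)%N).

(** Slope 2 at 0 comes from the inverse left bump and slope 2 at 1 from the right bump; the
    exponents give the pair of characters the value (Q, P). *)
Definition pinch : thompson_group R := (bump_left^-1 ^+ Q * bump_right ^+ P)%g.

Lemma chi_pinch : chi0 pinch = Q%:R /\ chi1 pinch = P%:R.
Proof.
have [l0 l1] := chi_bump_left; have [r0 r1] := chi_bump_right.
rewrite /pinch chi0M chi1M !chi0X !chi1X chi0V chi1V l0 l1 r0 r1.
by rewrite opprK oppr0 !mul0rn addr0 add0r.
Qed.

Lemma pinch_left x : 0 < x < 1 / 2 -> x < val pinch x.
Proof.
move=> /andP[x0 x2]; have [_ H] := pushes_left Q0.
rewrite -[val pinch x]/(val (bump_left^-1 ^+ Q)%g (val (bump_right ^+ P)%g x)).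
rewrite (supportedX _ (bump_supported bump_right_valid)).
  by apply: H; rewrite x0.
by rewrite ltNge ltW.
Qed.

Lemma pinch_right x : 1 / 2 < x < 1 -> x < val pinch^-1%g x.
Proof.
move=> /andP[x2 x1]; have [Sr Hr] := pushes_right P0; have [Sl _] := pushes_left Q0.
rewrite invgM -expVgn.
rewrite -[val _ x]/(val (bump_right^-1 ^+ P)%g (val (bump_left^-1 ^+ Q)^-1%g x)).
rewrite (supportedV Sl); first by apply: Hr; rewrite x2.
by rewrite (ltNge x) ltW ?andbF.
Qed.

(** [pinch] maps [1/4, 3/4] into itself. Conjugation by its inverse is thus an endomorphism of the
    group of maps supported there, which makes the extension ascending. *)
Lemma pinch_core f : supported f (1 / 4) (3 / 4) ->
  supported (f ^ pinch^-1)%g (1 / 4) (3 / 4).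
Proof.
move=> Sf; apply: (supportedW _ _ (@supportedJV _ f pinch _ _ Sf)).
  by apply/ltW/pinch_left/andP; split; lra.
rewrite -(thompson_le pinch^-1%g) thompson_invK.
by apply/ltW/pinch_right/andP; split; lra.
Qed.

Lemma pinch_absorbs f a b : 0 < a -> b < 1 -> supported f a b ->
  exists n, supported (f ^ (pinch ^- n))%g (1 / 4) (3 / 4).
Proof.
move=> a0 b1 Sf.
have ge4 n : 1 / 4 <= val (pinch ^+ n)%g (1 / 4 : R).
  elim: n => [//|n IH]; rewrite expgSr; apply: le_trans (IH) _.
  by rewrite thompson_le; apply/ltW/pinch_left/andP; split; lra.
have le4 n : val (pinch ^+ n)%g (3 / 4 : R) <= 3 / 4.
  elim: n => [//|n IH]; rewrite expgSr; apply: le_trans _ (IH).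
  rewrite -[X in X <= _]/(val (pinch ^+ n)%g (val pinch (3 / 4))).
  rewrite thompson_le -(thompson_le pinch^-1%g) thompson_invK.
  by apply/ltW/pinch_right/andP; split; lra.
have [n1 H1] : exists n, 1 / 4 < val (pinch ^+ n)%g a.
  apply: thompson_push => x /andP[ax x4].
  by apply: pinch_left; apply/andP; split; lra.
have [n2 H2] : exists n, b < val (pinch^-1 ^+ n)%g (3 / 4).
  apply: thompson_push => x /andP[x4 xb].
  by apply: pinch_right; apply/andP; split; lra.
exists (n1 + n2)%N; apply: (supportedW _ _ (@supportedJV _ f (pinch ^+ (n1 + n2))%g _ _ Sf)).
  rewrite addnC expgnDr; apply: le_trans (ge4 n2) _.
  by rewrite -[X in _ <= X]/(val (pinch ^+ n2)%g (val (pinch ^+ n1)%g a)) thompson_le ltW.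
rewrite expgnDr; apply: le_trans (le4 n1).
rewrite -[X in X <= _]/(val (pinch ^+ n1)%g (val (pinch ^+ n2)%g b)) thompson_le.
rewrite ltW // -(thompson_lt (pinch ^- n2)%g) thompson_invK -expVgn.
exact: H2.
Qed.

End Pushing.

Section ForestHoms.
Variables (E G : groupType) (g : {multiplicative E -> G}).

Lemma hom_forest_fam x0 x1 n : g (forest_fam x0 x1 n) = forest_fam (g x0) (g x1) n.
Proof. by case: n => //= n; rewrite homJ homX. Qed.

Lemma hom_kernel_div x y : hom_kernel g (x / y)%g <-> g x = g y.
Proof.
rewrite /hom_kernel /= gmulfM homV; split=> [/divg1_eq//|->]; exact: mulgV.
Qed.

Lemma hom_forest_prod (e : nat -> E) s :
  g (forest_prod e s) = forest_prod (g \o e) s.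
Proof. by elim: s => [|i s IH] /=; rewrite ?hom1 // gmulfM IH. Qed.

Lemma eq_forest_prod (e e' : nat -> E) s : e =1 e' -> forest_prod e s = forest_prod e' s.
Proof. by move=> ee; elim: s => //= i s ->; rewrite ee. Qed.

End ForestHoms.

Section Ascending.
Local Open Scope group_scope.
Variables (E : groupType) (e : nat -> E) (t : E).
Hypotheses (re : forest_rel e) (t0 : forest_frac e (e 0%N ^ t^-1))
  (t1 : forest_frac e (e 1%N ^ t^-1)).

(** Conjugation is a homomorphism and [forest_famE] expresses all members of the family by the first
    two, so the two hypotheses suffice. *)
Lemma forest_frac_expand c : forest_frac e c -> forest_frac e (c ^ t^-1).
Proof.
pose S := fun c => forest_frac e (c ^ t^-1).
have SM x y : S x -> S y -> S (x * y) by rewrite /S conjMg; exact: forest_fracM.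
have SV x : S x -> S x^-1 by rewrite /S conjVg; exact: forest_frac_inv.
have S1 : S 1 by rewrite /S conj1g; exact: forest_frac1.
have Se i : S (e i).
  rewrite -(forest_famE re) /forest_fam; case: i => [//|i].
  have SX : S (e 0%N ^+ i).
    by elim: i => [//|i IH]; rewrite expgS; exact: SM.
  by rewrite conjgE; apply: (SM); [exact: SV|exact: SM].
have SP s : S (forest_prod e s) by elim: s => //= i s IH; exact: SM.
by move=> [s [s' ->]]; apply: SM => //; exact: SV.
Qed.

(** The normal form of an ascending HNN extension: since t c = (c ^ t^-1) t and [c ^ t^-1] is again
    a fraction, negative powers of t can stay on the left and positive ones on the right. *)
Definition ascending (y : E) : Prop :=
  exists i j c, forest_frac e c /\ y = t ^- i * c * t ^+ j.

Lemma ascending1 : ascending 1.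
Proof. by exists 0%N, 0%N, 1; split; [exact: forest_frac1|rewrite !mulg1 invg1]. Qed.

Lemma ascending_frac c y : forest_frac e c -> ascending y -> ascending (c * y).
Proof.
move=> Fc [i [j [d [Fd ->]]]].
have Fci : forest_frac e (c ^ (t ^- i)).
  elim: i => [|i IH]; first by rewrite invg1 conjg1.
  by rewrite expgS invgM conjgM; exact: forest_frac_expand.
exists i, j, (c ^ (t ^- i) * d); split; first exact: forest_fracM.
by rewrite conjgE invgK !mulgA mulVg mul1g.
Qed.

Lemma ascendingV y : ascending y -> ascending (t^-1 * y).
Proof.
move=> [i [j [c [Fc ->]]]]; exists i.+1, j, c; split=> //.
by rewrite expgSr invgM !mulgA.
Qed.

Lemma ascendingM y : ascending y -> ascending (t * y).
Proof.
move=> [[|i] [j [c [Fc ->]]]].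
  exists 0%N, j.+1, (c ^ t^-1); split; first exact: forest_frac_expand.
  by rewrite invg1 !mul1g expgS conjgE invgK !mulgA mulgVK.
by exists i, j, c; split=> //; rewrite expgSr invgM !mulgA mulgV mul1g.
Qed.

End Ascending.

Section KernelValues.
Variables (R : realType) (p q : int).
Local Notation N := (N_pq R p q).
Implicit Types (n m : N).

Lemma N_valM n m : val (n * m)%g = (val n * val m)%g.
Proof. exact: valM. Qed.

Lemma N_val1 : val (1%g : N) = 1%g.
Proof. by apply: (mulgI (val (1%g : N))); rewrite -N_valM !mulg1. Qed.

Lemma N_valV n : val n^-1%g = (val n)^-1%g.
Proof. by apply: (mulgI (val n)); rewrite -N_valM !mulgV N_val1. Qed.

Lemma N_valX n k : val (n ^+ k)%g = (val n ^+ k)%g.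
Proof. by elim: k => [|k IH]; rewrite ?N_val1 // !expgS N_valM IH. Qed.

Lemma N_valJ n m : val (n ^ m)%g = (val n ^ val m)%g.
Proof. by rewrite !conjgE !N_valM N_valV. Qed.

Lemma N_val_forest (e : nat -> N) (e' : nat -> thompson_group R) s :
  (forall i, val (e i) = e' i) -> val (forest_prod e s) = forest_prod e' s.
Proof.
move=> ee; elim: s => [|i s IH]; first exact: N_val1.
by rewrite [forest_prod _ _]/= N_valM ee IH.
Qed.

End KernelValues.

Section FinitePresentation.
Variables (R : realType) (p q : int) (P Q : nat).
Hypotheses (P0 : (0 < P)%N) (Q0 : (0 < Q)%N).
Hypothesis (PQ : forall k l : int, p * k = q * l <->
  exists n : int, k = Q%:Z * n /\ l = P%:Z * n).
Local Notation N := (N_pq R p q).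
Local Notation t := (pinch R P Q).

Lemma N_chi (n : N) : exists k : int,
  chi0 (val n) = (Q%:Z * k)%:~R /\ chi1 (val n) = (P%:Z * k)%:~R.
Proof.
have [k [_ [_ k0 _]]] := chi0P (val n); have [l [_ [_ l0 _]]] := chi1P (val n).
have := N_pqP n; rewrite /chi_pq k0 l0 -!intrM -intrB => /eqP.
rewrite intr_eq0 subr_eq0 => /eqP/PQ[m [-> ->]].
by exists m.
Qed.

Lemma N_chi_ex u (k : int) : chi0 u = (Q%:Z * k)%:~R -> chi1 u = (P%:Z * k)%:~R ->
  exists n : N, val n = u.
Proof.
move=> u0 u1; apply: N_pq_ex; rewrite /chi_pq u0 u1 -!intrM -intrB.
by apply/eqP; rewrite intr_eq0 subr_eq0; apply/eqP/PQ; exists k.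
Qed.

Lemma N_pinch : exists n : N, val n = t.
Proof.
have [t0 t1] := chi_pinch R P Q.
by apply: (@N_chi_ex _ 1); rewrite mulr1 ?t0 ?t1.
Qed.

Lemma core_end : 3 / 4 = 1 / 4 + 1 / 2 ^+ 1 :> R.
Proof. by rewrite expr1; field. Qed.

Lemma dyadic_quarter : dyadic (1 / 4 : R).
Proof. by have := dyadic_exp2 R 2; rewrite -natrX. Qed.

Let b1 : 1 / 4 + 1 / 2 ^+ 1 <= 1 :> R. Proof. by rewrite expr1; lra. Qed.
Let a0 : 0 <= 1 / 4 :> R. Proof. by lra. Qed.

Lemma core_caret_supported i : supported (caret (1 / 4 : R) 1 i) (1 / 4) (3 / 4).
Proof.
rewrite core_end.
apply: (supportedW _ _ (@caret_supported _ _ 1 dyadic_quarter a0 b1 i)) => //.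
exact: cut_ge.
Qed.

Lemma N_carets : exists xs : nat -> N, forall i, val (xs i) = caret (1 / 4) 1 i.
Proof.
have /choice[xs xsE] : forall i, exists n : N, val n = caret (1 / 4) 1 i.
  by move=> i; apply: (N_compact p q _ _ (core_caret_supported i)); lra.
by exists xs.
Qed.

Lemma N_ascends (n : N) : exists i j f,
  supported f (1 / 4) (3 / 4) /\ val n = (t ^- i * f * t ^+ j)%g.
Proof.
have [k [c0 c1]] := N_chi n.
move: (chi_pinch R P Q) (@pinch_absorbs R P Q P0 Q0).
move: t (val n) c0 c1 => s v c0 c1 [s0 s1] absorbs.
have [i [j kij]] : exists i j : nat, k = j%:Z - i%:Z.
  case: (intP k) => [|m|m]; [exists 0%N, 0%N|exists 0%N, m.+1|exists m.+1, 0%N];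
  by rewrite ?subr0 ?sub0r.
(* With k = j - i these factors cancel both characters, so [f] has compact support and a power of
   the pinch conjugates it into the core. *)
pose f := (s ^+ i * v * s ^- j)%g.
have f0 : chi0 f = 0.
  rewrite /f (chi0M (s ^+ i * v)%g) (chi0M (s ^+ i)%g) (chi0V (s ^+ j)%g) (chi0X s i) (chi0X s j).
  rewrite c0 s0 kij intrM intrB -(mulr_natr _ i) -(mulr_natr _ j); ring.
have f1 : chi1 f = 0.
  rewrite /f (chi1M (s ^+ i * v)%g) (chi1M (s ^+ i)%g) (chi1V (s ^+ j)%g) (chi1X s i) (chi1X s j).
  rewrite c1 s1 kij intrM intrB -(mulr_natr _ i) -(mulr_natr _ j); ring.
have [a [b [pa pb Sf]]] := supported_chi f0 f1.
have [m Sm] := absorbs _ _ _ pa pb Sf.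
exists (m + i)%N, (m + j)%N, (f ^ (s ^- m))%g; split=> //.
rewrite conjgE invgK !expgnDr !invgM /f !mulgA.
by rewrite !mulgVK mulVg mul1g.
Qed.

Definition three (G : Type) (x y z : G) (i : 'I_3) : G := nth z [:: x; y] i.

(** There are four relators: two for the copy of F, and two that write the conjugates of x_0 and x_1
    by t^-1 as fractions. They put every element of the presented group into the form t^-i c t^j,
    and it remains to see that such an element is 1 if its image in N is. *)
Theorem N_finitely_presentable : finitely_presentable N.
Proof.
have [xs xsE] := N_carets; have [tt ttE] := N_pinch.
pose phi : {multiplicative free_group 3 -> N} := free_eval (three (xs 0%N) (xs 1%N) tt).
pose o0 : 'I_3 := ord0; pose o1 : 'I_3 := @Ordinal 3 1 isT; pose o2 : 'I_3 := @Ordinal 3 2 isT.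
pose x0 := free_gen o0; pose x1 := free_gen o1; pose y := free_gen o2.
pose ef := forest_fam x0 x1.
have rx : forest_rel xs.
  move=> i j ij; apply: val_inj; rewrite !N_valM !xsE.
  exact: (caret_rel dyadic_quarter a0 b1 ij).
have phi0 : phi x0 = xs 0%N by exact: free_eval_gen.
have phi1 : phi x1 = xs 1%N by exact: free_eval_gen.
have phit : phi y = tt by exact: free_eval_gen.
have phief i : phi (ef i) = xs i.
  by rewrite /ef hom_forest_fam phi0 phi1 (forest_famE rx).
have phiP s : phi (forest_prod ef s) = forest_prod xs s.
  by rewrite hom_forest_prod; exact: eq_forest_prod.
have valP s : val (forest_prod xs s) = forest_prod (caret (1 / 4) 1) s.
  exact: N_val_forest.
have core (n : N) : supported (val n) (1 / 4) (3 / 4) -> exists s s',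
    n = phi (forest_prod ef s * (forest_prod ef s')^-1)%g.
  rewrite core_end => /(forest_generation dyadic_quarter a0 b1)[s [s' E]].
  exists s, s'; apply: val_inj; rewrite E gmulfM homV !phiP.
  by rewrite -!valP -N_valV -N_valM.
have conj_core i : supported (val (xs i ^ tt^-1)%g) (1 / 4) (3 / 4).
  rewrite N_valJ N_valV ttE xsE.
  by apply: pinch_core => //; exact: core_caret_supported.
have [s0 [s0' E0]] := core _ (conj_core 0%N).
have [s1 [s1' E1]] := core _ (conj_core 1%N).
set w0 := (_ * _)%g in E0; set w1 := (_ * _)%g in E1.
pose A : set (free_group 3) := [set ((ef 2%N ^ ef 1%N) / ef 3%N)%g;
  ((ef 3%N ^ ef 1%N) / ef 4%N)%g; ((x0 ^ y^-1) / w0)%g; ((x1 ^ y^-1) / w1)%g].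
have epi : epimorphism phi.
  move=> n; have [i [j [f [Sf nE]]]] := N_ascends n.
  have [fN fE] : exists n : N, val n = f by apply: (N_compact p q _ _ Sf); lra.
  have [|s [s' fE']] := core fN; first by rewrite fE.
  exists (y ^- i * (forest_prod ef s * (forest_prod ef s')^-1) * y ^+ j)%g.
  rewrite gmulfM gmulfM -fE' homV !homX phit.
  by apply: val_inj; rewrite nE !N_valM N_valV !N_valX ttE fE.
have kA : A `<=` hom_kernel phi.
  have rel x z : phi x = phi z -> hom_kernel phi (x / z)%g.
    by move=> H; apply/hom_kernel_div.
  have sh i j : (i < j)%N -> phi (ef j ^ ef i)%g = phi (ef j.+1).
    by move=> ij; rewrite homJ !phief conjgE (rx _ _ ij) mulKg.
  move=> _ [[[->|->]|->]|->]; apply: rel; [exact: sh|exact: sh| |].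
    by rewrite homJ homV phi0 phit E0.
  by rewrite homJ homV phi1 phit E1.
apply: (@finitely_presentableP N 3 phi A) => //.
  by rewrite /A !finite_setU; repeat split; exact: finite_set1.
move=> E f g Af gf.
have rel x z : A (x / z)%g -> f x = f z.
  by move=> /Af /hom_kernel_div.
pose e := forest_fam (f x0) (f x1).
have fef i : f (ef i) = e i by exact: hom_forest_fam.
have fP s : f (forest_prod ef s) = forest_prod e s.
  by rewrite hom_forest_prod; exact: eq_forest_prod.
have re : forest_rel e.
  apply: forest_fam_rel; rewrite -/e -!fef -homJ; apply: rel.
    by left; left; left.
  by left; left; right.
have te0 : forest_frac e (e 0%N ^ (f y)^-1)%g.
  exists s0, s0'; rewrite -[e 0%N]/(f x0) -homV -homJ -!fP -homV -gmulfM.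
  by apply: rel; left; right.
have te1 : forest_frac e (e 1%N ^ (f y)^-1)%g.
  exists s1, s1'; rewrite -fef -homV -homJ -!fP -homV -gmulfM.
  by apply: rel; right; rewrite /ef /= conjg1.
have gen0 : forest_frac e (f x0) by exact: (forest_frac_gen e 0).
have gen1 : forest_frac e (f x1).
  by have := forest_frac_gen e 1; rewrite /e /= conjg1.
have asc x : ascending e (f y) (f x).
  elim/free_ind: x => [|i x IH|i x IH]; first by rewrite hom1; exact: ascending1.
    rewrite gmulfM; case: i => -[|[|[|//]]] i3.
    - by apply: ascending_frac => //; rewrite (_ : Ordinal i3 = o0) //; exact: val_inj.
    - by apply: ascending_frac => //; rewrite (_ : Ordinal i3 = o1) //; exact: val_inj.
    - by rewrite (_ : Ordinal i3 = o2); [exact: ascendingM|exact: val_inj].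
  rewrite gmulfM homV; case: i => -[|[|[|//]]] i3.
  - apply: ascending_frac => //; apply: forest_frac_inv.
    by rewrite (_ : Ordinal i3 = o0) //; exact: val_inj.
  - apply: ascending_frac => //; apply: forest_frac_inv.
    by rewrite (_ : Ordinal i3 = o1) //; exact: val_inj.
  - by rewrite (_ : Ordinal i3 = o2); [exact: ascendingV|exact: val_inj].
have gP s : g (forest_prod e s) = forest_prod xs s by rewrite -fP gf phiP.
move=> x; have [i [j [c [[s [s' cE]] fxE]]]] := asc x.
rewrite -gf fxE !gmulfM homV !homX gf phit cE gmulfM homV !gP => H.
set c' := (_ * _^-1)%g in H.
have {}H : (c' * tt ^+ j = tt ^+ i)%g.
  by apply: (mulgI (tt ^- i)%g); rewrite mulgA H mulVg.
have Sc : supported (val c') (1 / 4) (3 / 4).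
  rewrite N_valM N_valV !valP core_end.
  apply: supportedM; last apply: supportedV;
  exact: (forest_caret_supported dyadic_quarter a0 b1).
have hX k : chi0 (val (tt ^+ k)%g) = (Q * k)%:R.
  have [t0 _] := chi_pinch R P Q.
  by rewrite N_valX chi0X ttE t0 natrM mulr_natr.
(* The core has trivial germ at 0, while chi0 (t^k) = Q k with Q > 0. *)
have ij : i = j.
  have := congr1 (fun n : N => chi0 (val n)) H.
  rewrite N_valM chi0M !hX (chi0_supported _ Sc) ?add0r; last by lra.
  by move=> /eqP; rewrite eqr_nat eqn_pmul2l // => /eqP.
have c1 : forest_prod xs s = forest_prod xs s'.
  by apply: divg1_eq; apply: (mulIg (tt ^+ i)%g); rewrite mul1g {1}ij.
(* Both parts of the fraction give the same map, and a sorted word is determined by its map. Sorting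
   uses only the forest relations, which hold in [E] as well. *)
have ss : forest_sort s = forest_sort s'.
  apply: (forest_caret_inj dyadic_quarter a0 b1); rewrite ?forest_sort_sorted //.
  by rewrite -!valP !forest_sortE // c1.
rewrite -(forest_sortE s re) ss (forest_sortE s' re) mulgV mulg1 ij.
exact: mulVg.
Qed.

End FinitePresentation.

Lemma commg_mulr_commute (G : groupType) (a b c : G) : commute c a -> commute c b ->
  [~ (a * c)%g, b]%g = [~ a, b]%g.
Proof.
move=> ca cb; rewrite commgEl conjMg invgM.
have -> : (c ^ b = c)%g by rewrite conjgE cb mulKg.
have -> : ([~ a, b] = c^-1 * [~ a, b] * c)%g.
  have : commute c [~ a, b]%g.
    by rewrite /commg conjgE; do !apply: commuteM => //; apply: commuteV.
  by move=> E; rewrite -mulgA -E mulKg.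
by rewrite commgEl !mulgA.
Qed.

(** * A nontrivial element common to all nontrivial normal subgroups *)

Section Isolation.
Variables (R : realType) (p q : int).
Local Notation N := (N_pq R p q).

(** The double commutator trick. A nontrivial [h] in [M] moves some interval off itself. If A and B
    are supported there, then [M] contains A C with C supported in the image interval, and C drops
    out of [A C, B] = [A, B]. A compactly supported element of N squeezes a fixed noncommuting pair
    into the interval, so [M] contains the commutator of that pair up to conjugation. *)
Lemma N_monolith : exists2 w : N, w <> 1%g &
  forall M : set N, normal_subgroup M -> (exists2 x, M x & x <> 1%g) -> M w.
Proof.
have V : bump_valid (1 / 4 : R) (1 / 8).
  by apply: (@bump_validE _ _ _ 2 1 3); rewrite -?natrX //; lra.
have e1 : 1 / 4 + 4 * (1 / 8) = 3 / 4 :> R by lra.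
have [V2 ncomm] := bump_noncommute V.
have S1 := bump_supported V; rewrite e1 in S1.
have S2 : supported (dyadic_bump (1 / 4 : R) (1 / 8 / 2)) (1 / 4) (3 / 4).
  by apply: (supportedW _ _ (bump_supported V2)); lra.
have q0 : 0 < 1 / 4 :> R by lra.
have q1 : 3 / 4 < 1 :> R by lra.
have [al alE] := N_compact p q q0 q1 S1; have [be beE] := N_compact p q q0 q1 S2.
exists [~ al^-1, be]%g.
  move=> /eqP/commgP; move=> /(@commute_sym _ _ _)/commuteV; rewrite invgK.
  by move=> /(congr1 val); rewrite !N_valM alE beE => /esym /ncomm.
move=> M [[M1 MF] MJ] [g Mg g1].
have MV x : M x -> M x^-1%g by move=> Mx; rewrite -div1g; exact: MF.
have MM x y : M x -> M y -> M (x * y)%g.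
  by move=> Mx My; rewrite -[y]invgK; apply: MF => //; exact: MV.
(* Replacing [g] by its inverse if necessary, some point is moved to the right. *)
have [h [x [Mh x0 x1 hx]]] : exists h x, [/\ M h, 0 < x, x < 1 & x < val (val h) x].
  have [x gx] : exists x, val (val g) x != x.
    apply: contrapT => /forallNP H; apply: g1; apply: val_inj; apply: thompson_ext => x.
    by rewrite N_val1; apply/eqP; have /negP := H x; rewrite negbK.
  have /andP[x0 x1] : 0 < x < 1.
    by apply: contraNT gx => nx; rewrite thompson_out.
  have [gxx|xgx|E] := ltgtP (val (val g) x) x; last by rewrite E eqxx in gx.
    exists g^-1%g, x; split=> //; first exact: MV.
    by rewrite N_valV -(thompson_lt (val g)) thompson_invVK.
  by exists g, x.
set v := val h in hx.
(* The interval (i, j) around [x] will satisfy v^-1 m < i and j <= m, so [v] maps it to the right of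
   [m], off itself. The truncations at 0 and 1 keep it inside (0, 1). *)
pose m := (x + val v x) / 2.
have xm : x < m by rewrite /m; lra.
have mv : m < val v x by rewrite /m; lra.
have vm : val v^-1%g m < x by rewrite -(thompson_lt v) thompson_invVK.
pose i := (Num.max 0 (val v^-1%g m) + x) / 2.
have [i0 im ix] : [/\ 0 < i, val v^-1%g m < i & i < x].
  by rewrite /i; case: (leP 0 (val v^-1%g m)) => ?; split; lra.
have vi : m < val v i by rewrite -(thompson_lt v^-1%g) thompson_invK.
pose j := (x + Num.min m 1) / 2.
have [xj jm j1] : [/\ x < j, j <= m & j < 1].
  by rewrite /j; case: (leP m 1) => ?; split; lra.
have q01 : 1 / 4 < 3 / 4 :> R by lra.
have [u [c [d [c0 d1 Su iu uj]]]] := squeeze q0 q01 q1 i0 (lt_trans ix xj) j1.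
have [un unE] := N_compact p q c0 d1 Su.
pose A := ((al^-1) ^ un^-1)%g; pose B := (be ^ un^-1)%g.
have SA : supported (val A) i j.
  rewrite N_valJ !N_valV alE unE.
  by apply: (supportedW _ _ (supportedJV (supportedV S1))); exact: ltW.
have SB : supported (val B) i j.
  rewrite N_valJ !N_valV beE unE.
  by apply: (supportedW _ _ (supportedJV S2)); exact: ltW.
pose C := (A^-1 ^ h^-1)%g.
have SC : supported (val C) (val v i) (val v j).
  by rewrite N_valJ !N_valV; apply/supportedJV/supportedV.
have jvi : j <= val v i by rewrite (le_trans jm) // ltW.
have comm (X : N) : supported (val X) i j -> commute C X.
  move=> SX; apply: val_inj; rewrite !N_valM; apply/esym.
  exact: (supported_commute jvi SX SC).
(* A C = A h A^-1 h^-1 is a product of a conjugate of [h] and the inverse of [h]. *)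
have MAC : M (A * C)%g.
  have -> : (A * C = h ^ A^-1 * h^-1)%g by rewrite /C !conjgE !invgK !mulgA.
  by apply: MM; [exact: MJ|exact: MV].
have : M [~ (A * C)%g, B]%g by rewrite commgEl; apply: MM; [exact: MV|exact: MJ].
rewrite commg_mulr_commute; [|exact: comm|exact: comm].
by rewrite /A /B -conjRg => /(MJ _ un); rewrite conjgKV.
Qed.

Lemma N_isolated : finitely_presentable N -> isolated_group N.
Proof. by have [w w1 H] := N_monolith; exact: isolated_groupP w1 H. Qed.

End Isolation.

(** * The case pq < 0 *)

Section Translation.
Variables (R : realType) (P Q : nat).
Hypotheses (P0 : (0 < P)%N) (Q0 : (0 < Q)%N).
Implicit Types (u v w : thompson_group R) (x y z : R).

Definition bump_full : thompson_group R := dyadic_bump 0 (1 / 4).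

Lemma bump_full_valid : bump_valid (0 : R) (1 / 4).
Proof. by apply: (@bump_validE _ _ _ 0 1 2); rewrite ?mul0r -?natrX //; lra. Qed.

(** The inverse of the full bump moves every point of (0, 1) to the right and already contributes
    (1, -1) to the characters, hence the exponents Q - 1 and P - 1. The other factors never move a
    point to the left. *)
Definition translation : thompson_group R :=
  ((bump_left R)^-1 ^+ Q.-1 * ((bump_right R)^-1 ^+ P.-1 * bump_full^-1))%g.

Lemma chi_translation : chi0 translation = Q%:R /\ chi1 translation = - P%:R.
Proof.
have [l0 l1] := chi_bump_left R; have [r0 r1] := chi_bump_right R.
have f0 : chi0 bump_full = -1 by exact: chi0_bump0 bump_full_valid.
have f1 : chi1 bump_full = 1 by apply: (chi1_bump1 bump_full_valid); field.
rewrite /translation !chi0M !chi1M !chi0X !chi1X !chi0V !chi1V l0 l1 r0 r1 f0 f1.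
by rewrite !(oppr0, opprK, mul0rn, add0r, mulNrn) -opprD !natr1 !prednK.
Qed.

Lemma pushes_geX w a b n x : pushes w a b -> x <= val (w ^+ n)%g x.
Proof.
by move=> W; case: n => [//|n]; apply: (@pushes_ge _ _ a b); exact: pushesX.
Qed.

Lemma translation_gt x : 0 < x < 1 -> x < val translation x.
Proof.
move=> x01; rewrite -[val _ x]/(val ((bump_left R)^-1 ^+ Q.-1)%g
  (val ((bump_right R)^-1 ^+ P.-1)%g (val bump_full^-1%g x))).
apply: lt_le_trans (pushes_geX _ _ (pushes_bumpV (bump_left_valid R))).
apply: lt_le_trans (pushes_geX _ _ (pushes_bumpV (bump_right_valid R))).
have [_] := pushes_bumpV bump_full_valid; apply.
by have -> : 0 + 4 * (1 / 4) = 1 :> R by lra.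
Qed.

End Translation.

Section Cyclic.
Variables (R : realType) (t : thompson_group R).
Hypothesis tgt : forall x, 0 < x < 1 -> x < val t x.
Implicit Types (u v w z : thompson_group R) (a b x y : R).

Definition cyc z := exists i j, z = (t ^+ i * t ^- j)%g.

Lemma cyc_commute z w : cyc z -> cyc w -> commute z w.
Proof.
move=> [i [j ->]] [k [l ->]].
have C m n : commute (t ^+ m)%g (t ^+ n)%g by apply: commuteX2.
have D m : commute (t ^+ m)%g (t ^+ k * t ^- l)%g.
  by apply: commuteM; [|apply: commuteV].
by apply/commute_sym/commuteM; [|apply: commuteV]; apply: commute_sym.
Qed.

Lemma cyc1 : cyc 1%g.
Proof. by exists 0%N, 0%N; rewrite mulgV. Qed.

Lemma cycX i : cyc (t ^+ i)%g.
Proof. by exists i, 0%N; rewrite invg1 mulg1. Qed.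

Lemma cycV z : cyc z -> cyc z^-1%g.
Proof. by move=> [i [j ->]]; exists j, i; rewrite invgM invgK. Qed.

Lemma cycM z w : cyc z -> cyc w -> cyc (z * w)%g.
Proof.
move=> [i [j ->]] [k [l ->]]; exists (i + k)%N, (l + j)%N.
rewrite !expgnDr invgM !mulgA; congr (_ * _)%g.
rewrite -!mulgA; congr (_ * _)%g.
by apply: cyc_commute; [apply: cycV; exact: cycX|exact: cycX].
Qed.

Lemma cyc_cases z : cyc z -> exists n, z = (t ^+ n)%g \/ z = (t ^- n)%g.
Proof.
move=> [i [j ->]]; have [ij|/ltnW ji] := leqP j i.
  by exists (i - j)%N; left; rewrite expgnFr.
exists (j - i)%N; right; rewrite (expgnFr _ ji) invgM invgK //.
Qed.

Lemma iter_ge n x : 0 < x < 1 -> x <= val (t ^+ n)%g x.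
Proof.
move=> x01; elim: n => [//|n IH]; rewrite expgS; apply: le_trans (IH) _.
by apply/ltW/tgt; rewrite thompson_itv.
Qed.

Lemma iter_gt n x : 0 < x < 1 -> val t x <= val (t ^+ n.+1)%g x.
Proof.
move=> x01; rewrite expgSr -[X in _ <= X]/(val (t ^+ n)%g (val t x)).
by apply: iter_ge; rewrite thompson_itv.
Qed.

(** As b <= t a, positive powers of [t] move (a, b) beyond [b] and negative ones move it below
    [a]. *)
Lemma cyc_wander a b z y : 0 < a -> b < 1 -> b <= val t a -> cyc z ->
  a < y < b -> a < val z y < b -> z = 1%g.
Proof.
move=> a0 b1 bta /cyc_cases[[|n] [->|->]] //; rewrite ?invg1 //.
  move=> /andP[ay yb] /andP[_ tyb].
  have a01 : 0 < a < 1 by rewrite a0 (lt_trans ay (lt_trans yb b1)).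
  have := iter_gt n a01; rewrite leNgt => /negP; case.
  by rewrite (lt_le_trans _ bta) // (lt_trans _ tyb) // thompson_lt.
move=> /andP[ay yb] /andP[aty tyb].
have a01 : 0 < a < 1 by rewrite a0 (lt_trans ay (lt_trans yb b1)).
have := iter_gt n a01; rewrite leNgt => /negP; case.
rewrite (lt_le_trans _ bta) // (lt_trans _ yb) //.
by rewrite -(thompson_lt (t ^- n.+1)%g) thompson_invK.
Qed.

Lemma iter_escape a b : 0 < a -> b < 1 -> exists n0, forall n, (n0 <= n)%N ->
  b < val (t ^+ n)%g a.
Proof.
move=> a0 b1; have [n0 H] : exists n, b < val (t ^+ n)%g a.
  apply: thompson_push => x /andP[ax xb]; apply: tgt.
  by rewrite (lt_le_trans a0 ax) (le_lt_trans xb b1).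
exists n0 => n /subnKC <-; apply: lt_le_trans H _.
have [a1|a1] := ltP a 1; last by rewrite !thompson_out // !ltNge ?a1 ?andbF.
rewrite addnC expgnDr -[X in _ <= X]/(val (t ^+ (n - n0))%g (val (t ^+ n0)%g a)).
by apply: iter_ge; rewrite thompson_itv a0.
Qed.

End Cyclic.

Section NegativeKernel.
Variables (R : realType) (p q : int) (P Q : nat).
Hypotheses (P0 : (0 < P)%N) (Q0 : (0 < Q)%N).
Hypothesis (PQ : forall k l : int, p * k = - q * l <->
  exists n : int, k = Q%:Z * n /\ l = P%:Z * n).
Local Notation N := (N_pq R p q).
Local Notation t := (translation R P Q).

Definition compactly (u : thompson_group R) :=
  exists a b, [/\ 0 < a, b < 1 & supported u a b].

Lemma N_neg_chi (n : N) : exists k : int,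
  chi0 (val n) = (Q%:Z * k)%:~R /\ chi1 (val n) = - (P%:Z * k)%:~R.
Proof.
have [k [_ [_ k0 _]]] := chi0P (val n); have [l [_ [_ l0 _]]] := chi1P (val n).
have := N_pqP n; rewrite /chi_pq k0 l0 -!intrM -intrB => /eqP.
rewrite intr_eq0 subr_eq0 => /eqP E.
have /PQ[m [-> lm]] : p * k = - q * - l by rewrite mulrNN.
by exists m; rewrite -lm intrN opprK.
Qed.

Lemma N_translation : exists n : N, val n = t.
Proof.
have [t0 t1] := chi_translation R P0 Q0.
apply: N_pq_ex; rewrite /chi_pq t0 t1 !pmulrn mulrN opprK -!intrM -intrD.
have /PQ E : exists n : int, Q%:Z = Q%:Z * n /\ P%:Z = P%:Z * n by exists 1; rewrite !mulr1.
by rewrite E mulNr addNr.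
Qed.

Lemma N_decomposition (n : N) : exists z f,
  [/\ cyc t z, compactly f & val n = (z * f)%g].
Proof.
have [k [c0 c1]] := N_neg_chi n; have [t0 t1] := chi_translation R P0 Q0.
move: t (val n) c0 c1 t0 t1 => s v c0 c1 s0 s1.
have [i [j kij]] : exists i j : nat, k = i%:Z - j%:Z.
  case: (intP k) => [|m|m]; [exists 0%N, 0%N|exists m.+1, 0%N|exists 0%N, m.+1];
  by rewrite ?subr0 ?sub0r.
pose z := (s ^+ i * s ^- j)%g.
have z0 : chi0 z = (Q%:Z * k)%:~R.
  rewrite /z (chi0M (s ^+ i)%g) (chi0V (s ^+ j)%g) (chi0X s i) (chi0X s j) s0.
  by rewrite kij intrM intrB -(mulr_natr _ i) -(mulr_natr _ j); ring.
have z1 : chi1 z = - (P%:Z * k)%:~R.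
  rewrite /z (chi1M (s ^+ i)%g) (chi1V (s ^+ j)%g) (chi1X s i) (chi1X s j) s1.
  by rewrite kij intrM intrB -(mulr_natr _ i) -(mulr_natr _ j); ring.
exists z, (z^-1 * v)%g; split; [by exists i, j| |by rewrite mulVKg].
have f0 : chi0 (z^-1 * v)%g = 0 by rewrite (chi0M z^-1%g v) (chi0V z) z0 c0 addNr.
have f1 : chi1 (z^-1 * v)%g = 0 by rewrite (chi1M z^-1%g v) (chi1V z) z1 c1 addNr.
exact: supported_chi f0 f1.
Qed.

(** chi0 is injective on the powers of t and zero on compactly supported maps. This makes the
    decomposition of elements of N unique. *)
Lemma cyc_compact z : cyc t z -> compactly z -> z = 1%g.
Proof.
move=> [i [j ->]] [a [b [a0 _ Sf]]]; have [t0 t1] := chi_translation R P0 Q0.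
have := chi0_supported a0 Sf.
move: t t0 t1 {Sf} => s s0 _.
rewrite (chi0M (s ^+ i)%g) (chi0V (s ^+ j)%g) (chi0X s i) (chi0X s j) s0.
rewrite -(mulr_natr _ i) -(mulr_natr _ j) -!natrM => /eqP.
by rewrite subr_eq0 eqr_nat eqn_pmul2l // => /eqP ->; rewrite mulgV.
Qed.

Lemma translation_gt01 x : 0 < x < 1 -> x < val t x.
Proof. exact: translation_gt. Qed.

(** The maps supported in one interval [a, b] form a copy of F, generated by two carets. If [a, b]
    overlaps its translate by t, the translates cover (0, 1), and fragmentation produces all
    compactly supported maps from the core and t. *)
Lemma N_neg_finitely_generated : finitely_generated N.
Proof.
have [k0 [e0 [e00 k0E E]]] := chi0P t.
have [t0 t1] := chi_translation R P0 Q0.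
have {}k0E : k0 = Q by apply/eqP; rewrite -(eqr_int R) -k0E t0.
rewrite {}k0E in E.
have [k kQ ke] := exp2_small (Q + 2) e00.
(* Near 0 the map t is multiplication by 2^Q, so t a = 2^-e. Then b = a + 2^-e exceeds t a, and b -
   a is a power of 2, as [forest_generation] requires. From k >= Q + 2 follows e >= 2, which keeps b
   < 1. *)
pose a : R := 1 / 2 ^+ k; pose e := (k - Q)%N; pose b : R := a + 1 / 2 ^+ e.
have p2 n : 0 < 2 ^+ n :> R by rewrite exprn_gt0.
have a0 : 0 < a by rewrite divr_gt0.
have da : dyadic a by exact: dyadic_exp2.
have small n : (2 <= n)%N -> 1 / 2 ^+ n <= 1 / 4 :> R.
  move=> n2; rewrite !div1r lef_pV2 ?posrE // -(subnK n2) exprD -[4]/(2 * 2)%:R natrM.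
  by rewrite -expr2 ler_peMl ?exprn_ge0 // exprn_ege1 // ler1n.
have b1 : b < 1.
  have := small k; have := small e; rewrite /b /a; rewrite /e => h1 h2.
  have {}h1 := h1 ltac:(lia); have {}h2 := h2 ltac:(lia); lra.
have ta : val t a = 1 / 2 ^+ e.
  rewrite E; last by rewrite (ltW a0) /= ltW.
  rewrite /a /e -exprnP; have -> : 2 ^+ k = 2 ^+ (k - Q) * 2 ^+ Q :> R.
    by rewrite -exprD subnK //; lia.
  by field; rewrite !gt_eqF.
have tab : val t a < b by rewrite ta /b ltrDr.
have ab : a < b by rewrite /b ltrDl divr_gt0.
have a01 : 0 < a < 1 by rewrite a0 (lt_trans ab).
have b01 : 0 < b < 1 by rewrite (lt_trans a0).
have Sc i : supported (caret a e i) a b.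
  apply: (supportedW _ _ (@caret_supported _ _ e da (ltW a0) (ltW b1) i)) => //.
  exact: cut_ge.
have /choice[xs xsE] : forall i, exists n : N, val n = caret a e i.
  by move=> i; exact: (N_compact p q a0 b1 (Sc i)).
have [tt ttE] := N_translation.
exists [set xs 0%N; xs 1%N; tt]; split.
  by rewrite !finite_setU; repeat split; exact: finite_set1.
rewrite -subTset => n _ S [[S1 SF] AS].
have SV x : S x -> S x^-1%g by move=> Sx; rewrite -div1g; exact: SF.
have SM x y : S x -> S y -> S (x * y)%g.
  by move=> Sx Sy; rewrite -[y]invgK; apply: SF => //; exact: SV.
have SX x i : S x -> S (x ^+ i)%g.
  by move=> Sx; elim: i => [//|i IH]; rewrite expgS; exact: SM.
have SJ x y : S x -> S y -> S (x ^ y)%g.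
  by move=> Sx Sy; rewrite conjgE; apply: (SM); [exact: SV|exact: SM].
have St : S tt by apply: AS; right.
have rx : forest_rel xs.
  move=> i j ij; apply: val_inj; rewrite !N_valM !xsE.
  exact: (caret_rel da (ltW a0) (ltW b1) ij).
have Sx i : S (xs i).
  rewrite -(forest_famE rx); case: i => [|i] /=; first by apply: AS; left; left.
  by apply: SJ; [apply: AS; left; right|apply: SX; apply: AS; left; left].
have SP s : S (forest_prod xs s) by elim: s => //= i s IH; exact: SM.
have core (m : N) : supported (val m) a b -> S m.
  move=> /(forest_generation da (ltW a0) (ltW b1))[s [s' E']].
  have -> : m = (forest_prod xs s * (forest_prod xs s')^-1)%g.
    by apply: val_inj; rewrite N_valM N_valV !(N_val_forest _ xsE).
  by apply: SM => //; exact: SV.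
(* Fragmentation splits [m] into maps supported in (a, t^i b), covered by induction, and maps
   supported in (t^(i+1) a, t^(i+1) b), conjugates of core maps. The required overlap t^(i+1) a <
   t^i b follows from t a < b. *)
have step i (m : N) : supported (val m) a (val (t ^+ i)%g b) -> S m.
  elim: i m => [|i IH] m Sm; first exact: core.
  have tib j : 0 < val (t ^+ j)%g b < 1 by rewrite thompson_itv.
  have adi : a < val (t ^+ i.+1)%g a.
    exact: lt_le_trans (translation_gt01 a01) (iter_gt translation_gt01 i a01).
  have dib : val (t ^+ i.+1)%g a < val (t ^+ i)%g b.
    by rewrite expgSr -[X in X < _]/(val (t ^+ i)%g (val t a)) thompson_lt.
  have bic : val (t ^+ i)%g b < val (t ^+ i.+1)%g b.
    by rewrite expgSr -[X in _ < X]/(val (t ^+ i)%g (val t b)) thompson_lt; exact: translation_gt01.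
  have ci1 : val (t ^+ i.+1)%g b <= 1 by apply/ltW; case/andP: (tib i.+1).
  have [k' [v [w [Sk Sv Sw mE]]]] := supported_fragment (ltW a0) adi dib bic ci1 Sm.
  have bi1 : val (t ^+ i)%g b < 1 by case/andP: (tib i).
  have left_ u : supported u a (val (t ^+ i)%g b) -> exists2 n : N, val n = u & S n.
    move=> Su; have [n' nE] := N_compact p q a0 bi1 Su; exists n' => //.
    by apply: IH; rewrite nE.
  have right_ u : supported u (val (t ^+ i.+1)%g a) (val (t ^+ i.+1)%g b) ->
      exists2 n : N, val n = u & S n.
    move=> Su; have c1 : val (t ^+ i.+1)%g b < 1 by case/andP: (tib i.+1).
    have [n' nE] := N_compact p q (lt_trans a0 adi) c1 Su; exists n' => //.
    rewrite -(conjgK (tt ^+ i.+1)%g n'); apply: SJ; last by apply/SV/SX.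
    apply: core; rewrite N_valJ N_valX ttE nE.
    exact: supportedJ.
  have [vn vE Sv'] := left_ _ Sv; have [wn wE Sw'] := right_ _ Sw.
  have [kn kE Sk'] : exists2 n : N, val n = k' & S n.
    by case: Sk => Sk; [exact: left_|exact: right_].
  have -> : m = (kn * (vn * wn))%g by apply: val_inj; rewrite !N_valM kE vE wE mE.
  by apply: (SM) => //; exact: SM.
(* Conjugation by t^-i moves the support to the right of [a], and some t^j b lies beyond its right
   end. *)
have comp (m : N) : compactly (val m) -> S m.
  move=> [al [be [al0 be1 Sm]]].
  have a1 : a < 1 by case/andP: a01.
  have [i Hi] := iter_escape translation_gt01 al0 a1.
  have tbe : val (t ^+ i)%g be < 1.
    have [be0|be0] := ltP 0 be; first by have := thompson_itv (t ^+ i)%g be; rewrite be0 be1 => /andP[].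
    by rewrite thompson_out ?(le_lt_trans be0) // ltNge be0.
  have b0 : 0 < b by case/andP: b01.
  have [j Hj] := iter_escape translation_gt01 b0 tbe.
  rewrite -(conjgK (tt ^- i)%g m); apply: SJ; last by apply/SV/SV/SX.
  apply: (step j); rewrite N_valJ N_valV N_valX ttE.
  apply: (supportedW _ _ (@supportedJV _ (val m) (t ^+ i)%g _ _ Sm)).
    exact/ltW/Hi.
  exact/ltW/Hj.
have [z [f [cz cf nE]]] := N_decomposition n.
have [i [j zE]] := cz.
have [al [be [al0 be1 Sf]]] := cf.
have [fn fE] := N_compact p q al0 be1 Sf.
have -> : n = (tt ^+ i * tt ^- j * fn)%g.
  by apply: val_inj; rewrite nE zE !N_valM N_valV !N_valX ttE fE.
apply: (SM); last by apply: comp; rewrite fE.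
by apply: SM; [exact: SX|apply/SV/SX].
Qed.

End NegativeKernel.

(** * Periodic extension of maps along a group of translations *)

Section Bijections.
Variable R : realType.

(** A periodic extension can have break points accumulating at 0 and 1 and so leave F. Only the
    group law of the target matters for kernels, so no regularity is imposed on its elements. *)
Definition bijections := {f : R -> R | `[< bijective f >]}.

HB.instance Definition _ := Choice.on bijections.

Implicit Types u v w : bijections.

Definition mk_bij (f g : R -> R) (fK : cancel f g) (gK : cancel g f) : bijections :=
  exist _ f (asboolT (Bijective fK gK)).

Lemma bij_ex u : exists g, cancel (val u) g /\ cancel g (val u).
Proof. by have /asboolP[g gK Kg] := valP u; exists g. Qed.

Definition bij_invfun u : R -> R := projT1 (cid (bij_ex u)).

Lemma bij_invK u : cancel (val u) (bij_invfun u).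
Proof. by rewrite /bij_invfun; case: cid => g []. Qed.

Lemma bij_Kinv u : cancel (bij_invfun u) (val u).
Proof. by rewrite /bij_invfun; case: cid => g []. Qed.

Definition bij_one : bijections := mk_bij (fun x => erefl (id x)) (fun x => erefl (id x)).
Definition bij_mul u v : bijections :=
  mk_bij (can_comp (bij_invK u) (bij_invK v)) (can_comp (bij_Kinv v) (bij_Kinv u)).
Definition bij_inv u : bijections := mk_bij (bij_Kinv u) (bij_invK u).

Fact bij_mulA : associative bij_mul.
Proof. by move=> u v w; apply: val_inj. Qed.

Fact bij_mul1g : left_id bij_one bij_mul.
Proof. by move=> u; apply: val_inj. Qed.

Fact bij_mulg1 : right_id bij_one bij_mul.
Proof. by move=> u; apply: val_inj. Qed.

Fact bij_mulVg : left_inverse bij_one bij_inv bij_mul.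
Proof. by move=> u; apply: val_inj; apply/funext => x /=; rewrite bij_invK. Qed.

Fact bij_mulgV : right_inverse bij_one bij_inv bij_mul.
Proof. by move=> u; apply: val_inj; apply/funext => x /=; rewrite bij_Kinv. Qed.

HB.instance Definition _ := isGroup.Build bijections
  bij_mulA bij_mul1g bij_mulg1 bij_mulVg bij_mulgV.

Lemma bij_ext u v : val u =1 val v -> u = v.
Proof. by move=> uv; apply: val_inj; apply/funext. Qed.

Definition bij_of (u : thompson_group R) : bijections :=
  mk_bij (thompson_invK u) (thompson_invVK u).

Fact bij_ofM : {morph bij_of : u v / (u * v)%g}.
Proof. by move=> u v; apply: bij_ext. Qed.

HB.instance Definition _ := isMultiplicative.Build (thompson_group R) bijections
  bij_of bij_ofM.

End Bijections.

Section PeriodicExtension.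
Variables (R : realType) (Z : set (thompson_group R)).
Hypotheses (sZ : subgroup Z).
Implicit Types (f g w z : thompson_group R) (U : set R) (x y : R).

Let Z1 : Z 1%g. Proof. by case: sZ. Qed.
Let ZF z z' : Z z -> Z z' -> Z (z / z')%g. Proof. by case: sZ => _; exact. Qed.
Let ZV z : Z z -> Z z^-1%g. Proof. by move=> Zz; rewrite -div1g; exact: ZF. Qed.

(** Equivalently, distinct elements of [Z] map [U] to disjoint sets, so the conjugates of a map
    supported in [U] have disjoint supports. *)
Definition wandering U := forall z y, Z z -> U y -> U (val z y) -> z = 1%g.

Definition supported_on f U := forall x, ~ U x -> val f x = x.

Lemma supported_on_stable f U y : supported_on f U -> U y -> U (val f y).
Proof.
move=> Sf Uy; apply: contrapT => nU; apply: (nU).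
have E := Sf _ nU; have {}E : val f y = y.
  by rewrite -[LHS](thompson_invK f) E thompson_invK.
by rewrite E.
Qed.

Lemma supported_onM f g U : supported_on f U -> supported_on g U ->
  supported_on (f * g)%g U.
Proof. by move=> Sf Sg x nU /=; rewrite Sg ?Sf. Qed.

Lemma supported_onV f U : supported_on f U -> supported_on f^-1%g U.
Proof. by move=> Sf x nU; rewrite -{1}(Sf x nU) thompson_invK. Qed.

(** Formulated by [f] alone, so that the periodic map does not depend on a wandering set: results
    obtained with different sets [U] then concern the same map. *)
Definition displaced f x := exists2 z, Z z & val f (val z^-1%g x) <> val z^-1%g x.

(* The product of the conjugates of [f] by all elements of [Z], meaningful when
   they have disjoint supports. *)
Definition periodic_fun f x : R :=
  if pselect (displaced f x) is left H then
    let z := projT1 (cid2 H) in val z (val f (val z^-1%g x))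
  else x.

Lemma periodic_fun_on f U z y : wandering U -> supported_on f U -> Z z -> U y ->
  periodic_fun f (val z y) = val z (val f y).
Proof.
move=> W Sf Zz Uy; rewrite /periodic_fun; case: pselect => [H|nH].
  case: cid2 => z' Zz' fz'.
  rewrite -[LHS]/(val z' (val f (val z'^-1%g (val z y)))).
  have Uz' : U (val (z'^-1 * z)%g y).
    by apply: contrapT => nU; apply: fz'; exact: Sf.
  have E : (z'^-1 * z = 1)%g.
    by apply: (W _ y) => //; rewrite -[z]invgK; apply/ZF/ZV => //; exact: ZV.
  have -> : z' = z by rewrite -[z](mulVKg z') E mulg1.
  by rewrite thompson_invK.
have -> : val f y = y; last by [].
by apply: contrapT => H; apply: nH; exists z; rewrite ?thompson_invK.
Qed.

Lemma periodic_fun_off f U x : supported_on f U ->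
  (forall z y, Z z -> U y -> val z y <> x) -> periodic_fun f x = x.
Proof.
move=> Sf H; rewrite /periodic_fun; case: pselect => // -[z Zz] nf.
exfalso; apply: nf; apply: Sf => Uz.
by apply: (H z _ Zz Uz); rewrite thompson_invVK.
Qed.

Lemma periodic_funP U x : (exists z y, [/\ Z z, U y & x = val z y]) \/
  (forall z y, Z z -> U y -> val z y <> x).
Proof.
have [H|H] := pselect (exists z y, [/\ Z z, U y & x = val z y]); [by left|right].
by move=> z y Zz Uy E; apply: H; exists z, y.
Qed.

Lemma periodic_funM f g U : wandering U -> supported_on f U -> supported_on g U ->
  periodic_fun f \o periodic_fun g = periodic_fun (f * g)%g.
Proof.
move=> W Sf Sg; apply/funext => x /=; have Sfg := supported_onM Sf Sg.
have [[z [y [Zz Uy ->]]]|H] := periodic_funP U x; last first.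
  by rewrite !(periodic_fun_off _ H).
rewrite !(periodic_fun_on W _ Zz) //.
exact: supported_on_stable.
Qed.

Lemma periodic_fun1 : periodic_fun 1%g = id.
Proof. by apply/funext => x; apply: (@periodic_fun_off _ set0) => // z y _ []. Qed.

Lemma periodized_ex f U : wandering U -> supported_on f U ->
  exists b : bijections R, val b = periodic_fun f.
Proof.
move=> W Sf; have Sf' := supported_onV Sf.
have K : cancel (periodic_fun f) (periodic_fun f^-1%g).
  move=> x; rewrite -[LHS]/((periodic_fun f^-1%g \o periodic_fun f) x).
  by rewrite (periodic_funM W) // mulVg periodic_fun1.
have K' : cancel (periodic_fun f^-1%g) (periodic_fun f).
  move=> x; rewrite -[LHS]/((periodic_fun f \o periodic_fun f^-1%g) x).
  by rewrite (periodic_funM W) // mulgV periodic_fun1.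
by exists (mk_bij K K').
Qed.

Definition periodized f : bijections R :=
  xget 1%g [set b : bijections R | val b = periodic_fun f].

Lemma periodizedE f U : wandering U -> supported_on f U ->
  val (periodized f) = periodic_fun f.
Proof.
move=> W Sf; have [b bE] := periodized_ex W Sf; rewrite /periodized.
by case: xgetP => [c _ ->//|/(_ b)].
Qed.

Lemma periodizedM f g U : wandering U -> supported_on f U -> supported_on g U ->
  periodized (f * g)%g = (periodized f * periodized g)%g.
Proof.
move=> W Sf Sg; apply: val_inj; rewrite (periodizedE W (supported_onM Sf Sg)).
by rewrite -(periodic_funM W) // -(periodizedE W Sf) -(periodizedE W Sg).
Qed.

Lemma periodized1 : periodized 1%g = 1%g.
Proof.
apply: val_inj; rewrite (@periodizedE 1%g set0) ?periodic_fun1 //.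
Qed.

Lemma periodizedV f U : wandering U -> supported_on f U ->
  periodized f^-1%g = (periodized f)^-1%g.
Proof.
move=> W Sf; apply: (mulgI (periodized f)).
by rewrite -(periodizedM W) ?mulgV ?periodized1 //; exact: supported_onV.
Qed.

Lemma periodized_commute f U z : wandering U -> supported_on f U -> Z z ->
  commute (periodized f) (bij_of z).
Proof.
move=> W Sf Zz; apply: bij_ext => x.
rewrite -[LHS]/(val (periodized f) (val z x)) -[RHS]/(val z (val (periodized f) x)).
rewrite (periodizedE W Sf).
have ZM z' : Z z' -> Z (z * z')%g by move=> Zz'; rewrite -[z']invgK; apply/ZF/ZV.
have [[z' [y [Zz' Uy ->]]]|H] := periodic_funP U x.
  rewrite -[val z (val z' y)]/(val (z * z')%g y).
  by rewrite (periodic_fun_on W Sf (ZM _ Zz') Uy) (periodic_fun_on W Sf Zz' Uy).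
rewrite (periodic_fun_off Sf H) (periodic_fun_off Sf) // => z' y Zz' Uy E.
apply: (H (z^-1 * z')%g y) => //; first by rewrite -[z']invgK; apply/ZF/ZV => //; exact: ZV.
by rewrite -[LHS]/(val z^-1%g (val z' y)) E thompson_invK.
Qed.

Lemma periodized_inj f g U : wandering U -> supported_on f U -> supported_on g U ->
  periodized f = periodized g -> f = g.
Proof.
move=> W Sf Sg /(congr1 val); rewrite (periodizedE W Sf) (periodizedE W Sg) => E.
apply: thompson_ext => x; have [Ux|nU] := pselect (U x); last by rewrite Sf ?Sg.
have := congr1 (@^~ x) E.
by have := periodic_fun_on W Sf Z1 Ux; have := periodic_fun_on W Sg Z1 Ux => /= -> ->.
Qed.

Definition translate w U : set R := [set x | U (val w^-1%g x)].

Lemma translate_supported f w U : supported_on f U ->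
  supported_on (f ^ w^-1)%g (translate w U).
Proof.
move=> Sf x nU; rewrite conjgE invgK.
by rewrite -[LHS]/(val w (val f (val w^-1%g x))) Sf // thompson_invVK.
Qed.

Lemma translate_wandering w U : (forall z, Z z -> commute w z) -> wandering U ->
  wandering (translate w U).
Proof.
move=> C W z y Zz; rewrite /translate /= => Uy Uzy; apply: (W z _ Zz Uy).
have -> // : val z (val w^-1%g y) = val w^-1%g (val z y).
by rewrite -[LHS]/(val (z * w^-1)%g y) (commuteV (commute_sym (C z Zz))).
Qed.

Lemma periodizedJ f w U : wandering U -> supported_on f U ->
  (forall z, Z z -> commute w z) ->
  (bij_of w * periodized f = periodized (f ^ w^-1) * bij_of w)%g.
Proof.
move=> W Sf C; have W' := translate_wandering C W; have Sf' := @translate_supported f w U Sf.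
apply: bij_ext => x; rewrite -[LHS]/(val w (val (periodized f) x)).
rewrite -[RHS]/(val (periodized (f ^ w^-1)%g) (val w x)) (periodizedE W Sf) (periodizedE W' Sf').
have wU y : U y -> translate w U (val w y) by rewrite /translate /mkset thompson_invK.
have [[z [y [Zz Uy ->]]]|H] := periodic_funP U x.
  rewrite (periodic_fun_on W Sf Zz Uy).
  have E v : val w (val z v) = val z (val w v).
    by rewrite -[LHS]/(val (w * z)%g v) (C z Zz).
  rewrite !E (periodic_fun_on W' Sf' Zz (wU _ Uy)) conjgE invgK.
  congr (val z _); rewrite -[RHS]/(val w (val f (val w^-1%g (val w y)))).
  by rewrite thompson_invK.
rewrite (periodic_fun_off Sf H) (periodic_fun_off Sf') // => z y Zz Uy E.
apply: (H z (val w^-1%g y) Zz Uy); apply: (can_inj (thompson_invK w)).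
by rewrite -E -[LHS]/(val (w * z * w^-1)%g y) (C z Zz) mulgK.
Qed.

End PeriodicExtension.

Lemma prime_sequence r0 : exists pr : nat -> nat,
  [/\ injective pr, forall n, prime (pr n) & forall n, (r0 <= pr n)%N].
Proof.
pose nxt k := s2val (prime_above k); pose pr n := iter n.+1 nxt r0.
have nxt_gt k : (k < nxt k)%N by exact: (s2valP (prime_above k)).
have lt m n : (m < n)%N -> (pr m < pr n)%N.
  elim: n => // n IH; rewrite ltnS leq_eqVlt => /orP[/eqP->|/IH h].
    exact: nxt_gt.
  exact: ltn_trans h (nxt_gt _).
exists pr; split.
- move=> m n E; have [/lt|/lt|//] := ltngtP m n; by rewrite E ltnn.
- by move=> n; exact: (s2valP' (prime_above (iter n nxt r0))).
- move=> n; elim: n => [|n IH]; first exact/ltnW/nxt_gt.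
  by rewrite (leq_trans IH) // ltnW // lt.
Qed.

(** Cantor's diagonal argument, run on the codes c (K S). *)
Lemma uncountable_family (T : Type) (A : set T) (K : set nat -> T) :
  (forall S, A (K S)) -> injective K -> ~ countable A.
Proof.
move=> AK injK /countable_injP[c injc].
pose D := [set n | exists S, c (K S) = n /\ ~ S n].
have inj S S' : c (K S) = c (K S') -> S = S'.
  by move=> /injc E; apply: injK; apply: E; rewrite inE.
have [Dn|nDn] := pselect (D (c (K D))).
  by have [S [/inj E nS]] := Dn; apply: nS; rewrite E.
by apply: (nDn); exists D.
Qed.

(** * Approximating actions and uncountably many kernels *)

Section Condensation.
Variables (R : realType) (p q : int) (P Q : nat).
Hypotheses (P0 : (0 < P)%N) (Q0 : (0 < Q)%N).
Hypothesis (PQ : forall k l : int, p * k = - q * l <->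
  exists n : int, k = Q%:Z * n /\ l = P%:Z * n).
Local Notation N := (N_pq R p q).
Local Notation t := (translation R P Q).
Implicit Types (u v w z f g : thompson_group R) (U : set R) (r l : nat).

Let tgt x : 0 < x < 1 -> x < val t x. Proof. exact: translation_gt. Qed.

Definition cyc_power r : set (thompson_group R) := cyc (t ^+ r)%g.
Local Notation per r := (periodized (cyc_power r)).

Lemma cyc_power_subgroup r : subgroup (cyc_power r).
Proof.
split; first exact: cyc1.
by move=> z z' Zz Zz'; apply: cycM => //; exact: cycV.
Qed.

Lemma cyc_power_sub r z : cyc_power r z -> cyc t z.
Proof. by move=> [i [j ->]]; exists (r * i)%N, (r * j)%N; rewrite !expgnA. Qed.

Lemma cyc_power_comm r w z : cyc t w -> cyc_power r z -> commute w z.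
Proof. by move=> cw /cyc_power_sub; exact: cyc_commute. Qed.

Lemma chi0_iter i : chi0 (t ^+ i)%g = (Q * i)%:R.
Proof.
have [t0 _] := chi_translation R P0 Q0.
by rewrite chi0X t0 natrM mulr_natr.
Qed.

Lemma cyc_power_dvd r l : cyc_power r (t ^+ l)%g -> (r %| l)%N.
Proof.
move=> [i [j]]; rewrite -!expgnA => /(congr1 (@chi0 R)).
rewrite chi0M chi0V !chi0_iter => /eqP.
rewrite eq_sym subr_eq -natrD eqr_nat -mulnDr eqn_pmul2l // => /eqP E.
by rewrite -(@dvdn_addl (r * j)) ?dvdn_mulr // -E dvdn_mulr.
Qed.

Lemma compact1 : compactly (1%g : thompson_group R).
Proof. by exists (1 / 4), (1 / 2); split; [lra|lra|exact: supported1]. Qed.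

Lemma compactV f : compactly f -> compactly f^-1%g.
Proof. by move=> [a [b [a0 b1 Sf]]]; exists a, b; split=> //; exact: supportedV. Qed.

Lemma compact_common f g : compactly f -> compactly g ->
  exists a b, [/\ 0 < a, b < 1, supported f a b & supported g a b].
Proof.
move=> [a [b [a0 b1 Sf]]] [c [d [c0 d1 Sg]]]; exists (Num.min a c), (Num.max b d).
rewrite lt_min gt_max a0 b1 c0 d1; split=> //.
  by apply: (supportedW _ _ Sf); rewrite ?ge_min ?le_max lexx.
by apply: (supportedW _ _ Sg); rewrite ?ge_min ?le_max lexx orbT.
Qed.

Lemma compactM f g : compactly f -> compactly g -> compactly (f * g)%g.
Proof.
move=> cf cg; have [a [b [a0 b1 Sf Sg]]] := compact_common cf cg.
by exists a, b; split=> //; exact: supportedM.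
Qed.

Lemma compactJ f w : compactly f -> compactly (f ^ w)%g.
Proof.
move=> [a [b [a0 b1 Sf]]]; exists (val w^-1%g a), (val w^-1%g b); split.
- by rewrite -(thompson_0 w^-1%g) thompson_lt.
- by rewrite -(thompson_1 w^-1%g) thompson_lt.
- by apply: supportedJ; rewrite !thompson_invVK.
Qed.

Definition openitv (a b : R) : set R := [set x | a < x < b].

Lemma supported_openitv f a b : supported f a b -> supported_on f (openitv a b).
Proof. by move=> Sf x /negP; exact: Sf. Qed.

(** A common support [a, b] satisfies b <= t^r a for all large r, and then it lies in a fundamental
    domain of t^r. *)
Lemma wandering_common f g : compactly f -> compactly g -> exists r0 U,
  [/\ supported_on f U, supported_on g U &
   forall r, (r0 <= r)%N -> wandering (cyc_power r) U].
Proof.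
move=> cf cg; have [a [b [a0 b1 Sf Sg]]] := compact_common cf cg.
have [r0 Hr] := iter_escape tgt a0 b1.
exists r0.+1, (openitv a b); split; [exact: supported_openitv|exact: supported_openitv|].
move=> r rr z y Zz; apply: (@cyc_wander R (t ^+ r)%g _ a b) => //.
  move=> x x01; have r1 : r = r.-1.+1 by rewrite prednK // (leq_ltn_trans _ rr).
  by rewrite r1; apply: lt_le_trans (tgt x01) (iter_gt tgt _ x01).
exact/ltW/Hr/ltnW.
Qed.

Lemma periodic_shift f z : compactly f -> cyc t z -> exists r0, forall r, (r0 <= r)%N ->
  (per r f * bij_of z = bij_of z * per r (f ^ z))%g.
Proof.
move=> cf cz; have [r0 [U [Sf _ W]]] := wandering_common cf cf.
exists r0 => r /W Wr.
have := @periodizedJ R _ (cyc_power_subgroup r) f z^-1%g U Wr Sf.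
rewrite invgK (homV (@bij_of R)) => H; apply: (mulgI (bij_of z)^-1%g).
rewrite mulgA H; first by rewrite mulgVK mulKg.
by move=> z' Zz'; apply: cyc_power_comm Zz'; exact: cycV.
Qed.

(* [S r] is, for large [r], the image of [u] when the translation [t] is made
   periodized: the compactly supported part of [u] is repeated along [t^r]. *)
Definition approximates u (S : nat -> bijections R) := exists z f r0,
  [/\ cyc t z, compactly f, u = (z * f)%g &
   forall r, (r0 <= r)%N -> S r = (bij_of z * per r f)%g].

Lemma approximates1 : approximates 1%g (fun=> 1%g).
Proof.
exists 1%g, 1%g, 0%N; split; [exact: cyc1|exact: compact1|by rewrite mulg1|].
by move=> r _; rewrite hom1 mul1g (periodized1 (cyc_power_subgroup r)).
Qed.

(** In N one has (z f) (w g) = (z w) (f^w g). The periodized maps obey the same rule once r is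
    beyond the thresholds for moving [w] past [f] and for a common wandering set. *)
Lemma approximatesM u v S T : approximates u S -> approximates v T ->
  approximates (u * v)%g (fun r => S r * T r)%g.
Proof.
move=> [z [f [r1 [cz cf -> HS]]]] [w [g [r2 [cw cg -> HT]]]].
have [r3 H3] := periodic_shift cf cw.
have cfw := compactJ w cf.
have [r4 [U [SU SV W]]] := wandering_common cfw cg.
exists (z * w)%g, (f ^ w * g)%g, (r1 + r2 + r3 + r4)%N; split.
- exact: cycM.
- exact: compactM.
- by rewrite conjgE !mulgA mulgK.
move=> r rr; rewrite HS ?HT; [|by lia|by lia].
rewrite (periodizedM (cyc_power_subgroup r) (W r _) SU SV); last by lia.
rewrite gmulfM -!mulgA; congr (_ * _)%g; rewrite !mulgA H3 //; by lia.
Qed.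

Lemma approximatesV u S : approximates u S -> approximates u^-1%g (fun r => (S r)^-1)%g.
Proof.
move=> [z [f [r1 [cz cf -> HS]]]].
have [r2 H2] := periodic_shift (compactV cf) (cycV cz).
have [r3 [U [SU _ W]]] := wandering_common cf cf.
exists z^-1%g, (f^-1 ^ z^-1)%g, (r1 + r2 + r3)%N; split.
- exact: cycV.
- exact/compactJ/compactV.
- by rewrite conjgE invgK invgM !mulgA mulVg mul1g.
move=> r rr; rewrite HS; last by lia.
rewrite -H2; last by lia.
rewrite (periodizedV (cyc_power_subgroup r) (W r _) SU); last by lia.
by rewrite invgM (homV (@bij_of R)).
Qed.

(** Powers of t and compactly supported maps meet only in 1, so the decomposition is unique and the
    values of [S] for large r depend on the element alone. Relators, which decompose as 1 times 1,
    are therefore eventually killed. *)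
Lemma approximates_eq z f S : approximates (z * f)%g S -> cyc t z -> compactly f ->
  exists r0, forall r, (r0 <= r)%N -> S r = (bij_of z * per r f)%g.
Proof.
move=> [w [g [r0 [cw cg E HS]]]] cz cf; exists r0 => r /HS ->.
have zw : (w^-1 * z = g * f^-1)%g.
  by apply: (mulgI w); rewrite mulVKg mulgA -E mulgK.
have : (w^-1 * z = 1)%g.
  apply: (@cyc_compact R P Q P0 Q0); first by apply: cycM => //; exact: cycV.
  by rewrite zw; apply: compactM => //; exact: compactV.
move=> E1; have wz : w = z by rewrite -[z](mulVKg w) E1 mulg1.
by move: E; rewrite wz => /mulgI ->.
Qed.

Lemma noncommuting_pair : exists a b x y, [/\ 0 < a, b < 1, b <= val t a,
  supported x a b /\ supported y a b & ~ commute x y].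
Proof.
have q01 : 0 < (1 / 4 : R) < 1 by apply/andP; split; lra.
have [b db /andP[ab bt]] := dyadic_dense (tgt q01).
have /andP[_ t1] : 0 < val t (1 / 4) < 1 by rewrite thompson_itv.
have b1 := lt_trans bt t1; have a0 : 0 < 1 / 4 :> R by lra.
have [V e4] := bump_between (dyadic_quarter R) db (ltW a0) ab (ltW b1).
have [V2 nc] := bump_noncommute V.
exists (1 / 4), b, (dyadic_bump (1 / 4) ((b - 1 / 4) / 4)),
  (dyadic_bump (1 / 4) ((b - 1 / 4) / 4 / 2)); split=> //; first exact: ltW.
have := bump_supported V; rewrite e4 => S1; split=> //.
by apply: (supportedW _ _ (bump_supported V2)); lra.
Qed.

Section Pair.
Variables (a b : R) (x y : thompson_group R).
Hypotheses (a0 : 0 < a) (b1 : b < 1) (bta : b <= val t a).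
Hypotheses (Sx : supported x a b) (Sy : supported y a b).
Local Notation U := (openitv a b).

Let SxU : supported_on x U. Proof. exact: supported_openitv. Qed.
Let SyU : supported_on y U. Proof. exact: supported_openitv. Qed.

Let W r : wandering (cyc_power r) U.
Proof. by move=> z v /cyc_power_sub; exact: cyc_wander. Qed.

Lemma conj_commute l : (0 < l)%N -> commute x (y ^ (t ^+ l))%g.
Proof.
move=> l0; have Sy' : supported (y ^ (t ^+ l))%g (val (t ^- l)%g a) (val (t ^- l)%g b).
  by apply: supportedJ; rewrite !thompson_invVK.
have [ab|ba] := ltP a b; last first.
  have -> : x = 1%g; last exact/commute_sym/commute1.
  apply: thompson_ext => v; apply: Sx; apply/negP => /andP[av vb].
  by have := lt_trans av vb; rewrite ltNge ba.
apply/commute_sym; apply: supported_commute Sy' Sx.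
rewrite -(thompson_le (t ^+ l)%g) thompson_invVK; apply: le_trans bta _.
by rewrite -(prednK l0); apply: (iter_gt tgt); rewrite a0 (lt_trans ab).
Qed.

(** The periodized map of [y] commutes with t^r, so the conjugation disappears, and periodizing is
    injective and multiplicative on maps supported in [U]. *)
Lemma periodic_noncommute r : ~ commute x y ->
  [~ per r x, per r y ^ (bij_of t ^+ r)]%g <> 1%g.
Proof.
move=> nc.
have -> : (per r y ^ (bij_of t ^+ r) = per r y)%g.
  rewrite -(homX (@bij_of R)) conjgE.
  have := @periodized_commute R _ (cyc_power_subgroup r) y U (t ^+ r)%g (@W r) SyU.
  move=> -> //; first by rewrite mulKg.
  by exists 1%N, 0%N; rewrite invg1 mulg1 expg1.
move=> /eqP/commgP => H; apply: nc.
apply: (@periodized_inj R _ (cyc_power_subgroup r) _ _ U (@W r)).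
- exact: supported_onM.
- exact: supported_onM.
by rewrite !(periodizedM (cyc_power_subgroup r) (@W r)).
Qed.

(** As t^l is not a power of t^r, the union of U and t^-l U is still wandering for the group
    generated by t^r. Periodizing is then multiplicative on maps supported in the union, and [x] and
    [y ^ (t ^+ l)] commute. *)
Lemma periodic_commuting r l : (0 < l)%N -> ~~ (r %| l)%N ->
  [~ per r x, per r y ^ (bij_of t ^+ l)]%g = 1%g.
Proof.
move=> l0 nrl; set y' := (y ^ (t ^+ l))%g.
pose V : set R := U `|` translate (t ^- l)%g U.
have Sy' : supported_on y' (translate (t ^- l)%g U).
  by have := @translate_supported _ y (t ^- l)%g U SyU; rewrite invgK.
have SxV : supported_on x V by move=> v nV; apply: SxU => Uv; apply: nV; left.
have SyV : supported_on y' V by move=> v nV; apply: Sy' => Uv; apply: nV; right.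
have nl z : cyc_power r z -> (t ^+ l * z)%g <> 1%g.
  move=> Zz E; case/negP: nrl; apply: cyc_power_dvd.
  have -> : (t ^+ l = z^-1)%g by apply: (mulIg z); rewrite E mulVg.
  exact: cycV.
have WV : wandering (cyc_power r) V.
  move=> z v Zz; have cz := cyc_power_sub Zz.
  have tz s : val (t ^+ l)%g (val z s) = val z (val (t ^+ l)%g s).
    rewrite -[LHS]/(val (t ^+ l * z)%g s).
    by rewrite (cyc_commute (cycX t l) cz).
  rewrite /V /translate /setU /mkset invgK tz.
  move=> [Uv|Uv] [Uzv|Uzv].
  - exact: W Zz Uv Uzv.
  - exfalso; apply: (nl z Zz); apply: (cyc_wander tgt a0 b1 bta _ Uv).
      by apply: cycM => //; exact: cycX.
    by rewrite -[val (t ^+ l * z)%g v]/(val (t ^+ l)%g (val z v)) tz.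
  - exfalso; apply: (nl z^-1%g); first exact: cycV.
    have := @cyc_wander R t tgt a b (z * t ^- l)%g _ a0 b1 bta _ Uv.
    rewrite -[val (z * t ^- l)%g (val (t ^+ l)%g v)]/(val z (val (t ^- l)%g (val (t ^+ l)%g v))).
    rewrite thompson_invK.
    move=> H; apply: invg_inj; rewrite invg1 invgM invgK; apply: H => //.
    by apply: cycM => //; apply: cycV; exact: cycX.
  - exact: W Zz Uv Uzv.
have -> : (per r y ^ (bij_of t ^+ l) = per r y')%g.
  rewrite -(homX (@bij_of R)) conjgE.
  have := @periodizedJ R _ (cyc_power_subgroup r) y (t ^- l)%g U (@W r) SyU.
  rewrite invgK (homV (@bij_of R)) => H; rewrite mulgA H ?mulgVK //.
  by move=> z Zz; apply: cyc_power_comm Zz; apply: cycV; exact: cycX.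
apply/eqP/commgP; rewrite /commute.
rewrite -!(periodizedM (cyc_power_subgroup r) WV) //.
by rewrite (conj_commute l0).
Qed.

End Pair.
(** A set S of indices yields the subgroup of those elements of the kernel that are killed by the
    actions for all primes with index in S. The n-th commutator lies in it exactly when n is not in
    S, so S can be recovered. *)
Lemma N_condensation (H : groupType) (phi : {multiplicative H -> N}) :
  finitely_presentable H -> epimorphism phi ->
  ~ countable [set K : set H | normal_subgroup K /\ K `<=` hom_kernel phi].
Proof.
move=> [m [pi [A [epi fA kA]]]] ephi.
have /choice[d dE] : forall i : 'I_m, exists zf : thompson_group R * thompson_group R,
    [/\ cyc t zf.1, compactly zf.2 & val (phi (pi (free_gen i))) = (zf.1 * zf.2)%g].
  by move=> i; have [z [f [? ? ?]]] := N_decomposition P0 Q0 PQ (phi (pi (free_gen i)));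
    exists (z, f).
pose Psi r : {multiplicative free_group m -> bijections R} :=
  free_eval (fun i => bij_of (d i).1 * per r (d i).2)%g.
have ap (w : free_group m) : approximates (val (phi (pi w))) (fun r => Psi r w).
  have apg i : approximates (val (phi (pi (free_gen i)))) (fun r => Psi r (free_gen i)).
    have [cz cf E] := dE i; exists (d i).1, (d i).2, 0%N; split=> // r _.
    exact: free_eval_gen.
  have ext u (S T : nat -> bijections R) : S =1 T -> approximates u S -> approximates u T by move=> /funext ->.
  elim/free_ind: w => [|i w IH|i w IH].
  - rewrite !hom1; apply: ext approximates1 => r; by rewrite hom1.
  - rewrite !gmulfM; apply: ext (approximatesM (apg i) IH) => r.
    by rewrite -gmulfM.
  - rewrite !gmulfM !homV.
    apply: ext (approximatesM (approximatesV (apg i)) IH) => r.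
    by rewrite -homV -gmulfM.
(* Each relator is killed from some r on, and finitely many relators have a common threshold; beyond
   it Psi_r descends to [H]. *)
have [r1 ker1] : exists r1, forall r, (r1 <= r)%N -> hom_kernel pi `<=` hom_kernel (Psi r).
  have [r1 Hr] : exists r1, forall r, (r1 <= r)%N -> A `<=` hom_kernel (Psi r).
    have Api (w : free_group m) : A w -> pi w = 1%g.
      by move=> Aw; have : hom_kernel pi w by rewrite kA; exact: normal_closure_sub.
    move/finite_seqP: fA Api => [s ->]; elim: s => [|w s IH] Api; first by exists 0%N.
    have [|r1 H1] := IH; first by move=> v vs; apply: Api; rewrite /= inE vs orbT.
    have := ap w; rewrite Api ?hom1 ?N_val1 /= ?inE ?eqxx // -[1%g](mulg1 1%g) => apw.
    have [r2 H2] := approximates_eq apw (cyc1 t) compact1.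
    exists (r1 + r2)%N => r rr v; rewrite /= inE => /orP[/eqP->|vs].
      rewrite /hom_kernel /mkset; apply: etrans (H2 r _) _; first by lia.
      by rewrite hom1 mul1g (periodized1 (cyc_power_subgroup r)).
    by apply: (H1 r) => //; lia.
  exists r1 => r rr; rewrite kA => w; apply; split; first exact: kernel_normal.
  exact: Hr.
have [a [b [x [y [a0 b1 bta [Sx Sy] nc]]]]] := noncommuting_pair.
have surj (n : N) : exists w : free_group m, phi (pi w) = n.
  by have [h <-] := ephi n; have [w <-] := epi h; exists w.
have [xn xE] := N_compact p q a0 b1 Sx; have [yn yE] := N_compact p q a0 b1 Sy.
have [tn tE] := N_translation R P0 Q0 PQ.
have [xw xwE] := surj xn; have [yw ywE] := surj yn; have [tw twE] := surj tn.
have cx : compactly x by exists a, b.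
have cy : compactly y by exists a, b.
have [r2 H2] : exists r2, forall r, (r2 <= r)%N ->
    [/\ Psi r xw = per r x, Psi r yw = per r y & Psi r tw = bij_of t].
  have comp (w : free_group m) f : compactly f -> val (phi (pi w)) = f ->
      exists r0, forall r, (r0 <= r)%N -> Psi r w = per r f.
    move=> cf E; have := ap w; rewrite E -[f in approximates f]mul1g => apw.
    have [r0 H0] := approximates_eq apw (cyc1 t) cf.
    by exists r0 => r /H0 ->; rewrite hom1 mul1g.
  have [rx Hx] := comp xw x cx (etrans (congr1 val xwE) xE).
  have [ry Hy] := comp yw y cy (etrans (congr1 val ywE) yE).
  have := ap tw; rewrite twE tE -[t in approximates t]mulg1 => apt.
  have [rt Ht] := approximates_eq apt (cycX t 1) compact1.
  exists (rx + ry + rt)%N => r rr; split; [apply: Hx; lia|apply: Hy; lia|].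
  by rewrite Ht ?(periodized1 (cyc_power_subgroup r)) ?mulg1 //; lia.
(* Primes above r1 give actions that descend to [H]; above r2 their values on the lifts of x, y and
   t are known. *)
have [pr [prI prP prr]] := prime_sequence (r1 + r2).
pose w n := [~ xw, yw ^ (tw ^+ pr n)]%g.
have phiw n : phi (pi (w n)) = 1%g.
  rewrite /w !(homR, homJ, homX) xwE ywE twE.
  have pn0 : (0 < pr n)%N by exact: prime_gt0.
  have C : commute xn (yn ^ (tn ^+ pr n))%g.
    apply: val_inj; rewrite [LHS]N_valM [RHS]N_valM N_valJ N_valX xE yE tE.
    exact: (conj_commute a0 b1 bta Sx Sy pn0).
  by apply/eqP/commgP.
have Psiw i n : Psi (pr i) (w n) = 1%g <-> i <> n.
  have [Ex Ey Et] := H2 (pr i) (leq_trans (leq_addl _ _) (prr i)).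
  have -> : Psi (pr i) (w n) = [~ per (pr i) x, per (pr i) y ^ (bij_of t ^+ pr n)]%g.
    by rewrite /w homR homJ homX Ex Ey Et.
  split=> [E in_|ni]; last first.
    apply: (periodic_commuting a0 b1 bta Sx Sy); first exact: prime_gt0.
    by rewrite dvdn_prime2 //; apply/eqP => /prI.
  by move: E; rewrite in_; exact: (periodic_noncommute a0 b1 bta Sx Sy nc).
(* Psi is defined on the free group, so membership is expressed by a lift. Two lifts differ by an
   element of the kernel of [pi], which [ker1] shows to be killed by Psi for all these primes. *)
pose K (S : set nat) : set H := [set h | exists v : free_group m, [/\ pi v = h, phi h = 1%g &
  forall n, S n -> Psi (pr n) v = 1%g]].
apply: (@uncountable_family _ _ K) => [S|S S' E].
  split; last by move=> h [v []].
  split; first split.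
  - exists 1%g; split; [exact: hom1|exact: hom1|by move=> n _; exact: hom1].
  - move=> h h' [v [vE ph Pv]] [v' [vE' ph' Pv']]; exists (v / v')%g; split.
    + by rewrite gmulfM homV vE vE'.
    + by rewrite gmulfM homV ph ph' mulgV.
    + by move=> n Sn; rewrite gmulfM homV Pv ?Pv' ?mulgV.
  - move=> h h' [v [vE ph Pv]]; have [v' vE'] := epi h'; exists (v ^ v')%g; split.
    + by rewrite homJ vE vE'.
    + by rewrite homJ ph conj1g.
    + by move=> n Sn; rewrite homJ Pv ?conj1g.
have KE T n : K T (pi (w n)) <-> ~ T n.
  split=> [[v [vE _ Pv]] Tn|nT].
    have := (Psiw n n).1; apply => //; rewrite -(Pv n Tn).
    have : hom_kernel pi (v / w n)%g by rewrite hom_kernel_div.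
    move/(ker1 _ (leq_trans (leq_addr _ _) (prr n))).
    by rewrite hom_kernel_div.
  exists (w n); split => // i Ti; apply/Psiw => in_; apply: nT; by rewrite -in_.
apply/seteqP; split=> n Sn; apply: contrapT => nSn.
  by have /KE := nSn; rewrite -E => /KE; apply.
by have /KE := nSn; rewrite E => /KE; apply.
Qed.

End Condensation.

(** For H = G and the identity map the kernel is trivial and contains a single normal subgroup. *)
Lemma condensation_not_presentable (G : groupType) :
  extrinsic_condensation G -> finitely_presentable G -> False.
Proof.
move=> [_ cond] fp; apply: (cond G idfun) => //; first by move=> y; exists y.
apply: (@sub_countable _ _ _ [set [set 1%g]]); last exact: finite_set_countable.
apply: subset_card_le => K [[[K1 _] _] K1s]; apply/seteqP; split=> // x ->.
exact: K1.
Qed.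

Theorem corollary1p10 (R : realType) (p q : int) (hpq : (p, q) <> (0, 0)) :
  [/\ p * q = 0 -> infinitely_generated (N_pq R p q),
      0 < p * q ->
        finitely_presentable (N_pq R p q) /\ isolated_group (N_pq R p q) &
      p * q < 0 ->
        [/\ finitely_generated (N_pq R p q),
            extrinsic_condensation (N_pq R p q) &
            infinitely_presented (N_pq R p q)]].
Proof.
split.
- move=> /eqP; rewrite mulf_eq0; have [p0|p0] := eqVneq p 0 => /= [_|/eqP q0].
    apply: N_infinitely_generated1 => //; apply/eqP => q0.
    by apply: hpq; rewrite p0 q0.
  exact: N_infinitely_generated0.
- move=> /lattice_pos[P [Q [P0 Q0 PQ]]].
  have fp := N_finitely_presentable R P0 Q0 PQ.
  by split=> //; exact: N_isolated.
(* Changing the sign of q reduces the lattice of character values to the positive case. *)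
- move=> pq; have /lattice_pos[P [Q [P0 Q0 PQ]]] : 0 < p * - q.
    by rewrite mulrN oppr_gt0.
  have fg := N_neg_finitely_generated R P0 Q0 PQ.
  have cond : extrinsic_condensation (N_pq R p q).
    by split=> // H phi; exact: N_condensation P0 Q0 PQ H phi.
  by split=> //; split=> // fp; exact: condensation_not_presentable cond fp.
Qed.
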